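(* Let $(X,d)$ be a proper metric space of bounded geometry that satisfies property A$'$, let $\mu$ be a Borel measure on $X$ and $p\in(1,\infty)$. Then: (a) $M_f\in\mathrm{BDO}^p$ for all $f\in L_\infty(X,\mu)$. (b) $\mathrm{BO}$ is an algebra and $\mathrm{BDO}^p$ is a closed subalgebra of $\mathcal{L}(L_p(X,\mu))$. (c) Let $A\in\mathrm{BDO}^p$ be Fredholm and let $B\in\mathcal{L}(L_p(X,\mu))$ be a regulariser for $A$ (i.e. $AB-I$ and $BA-I$ are compact). Then $B\in\mathrm{BDO}^p$. In particular, $\mathrm{BDO}^p$ is inverse closed in $\mathcal{L}(L_p(X,\mu))$. (d) $\mathrm{BDO}^p$ contains $\mathcal{K}(L_p(X,\mu))$ as a closed two-sided ideal. (e) If $A\in\mathrm{BDO}^p$ and $\frac1p+\frac1q=1$, then $A^*\in\mathrm{BDO}^q$.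
   Context: Let $(X,d)$ be a metric space; $B(x,r)$ denotes the open ball. $X$ is proper if closed balls are compact. $X$ has bounded geometry if there is $\varepsilon>0$ such that for all $r>0$ there is $N_r\in\mathbb{N}$ such that for all $x\in X$ the ball $B(x,r)$ can be covered by at most $N_r$ open balls of radius $\varepsilon$. A proper metric space $X$ of bounded geometry has property A$'$ if for every $t>0$ there is a countably infinite collection $(\varrho_{j,t})_{j\in\mathbb{N}}$ of non-zero measurable functions $\varrho_{j,t}\colon X\to[0,1]$ such that (i) $\sum_{j}\varrho_{j,t}(x)=1$ for all $x\in X$; (ii) $\sup_{j}\operatorname{diam}(\operatorname{spt}\varrho_{j,t})<\infty$, where $\operatorname{spt}$ denotes the support; (iii) $d(x,y)\le\frac1t$ implies $\sum_{j}|\varrho_{j,t}(x)-\varrho_{j,t}(y)|<t$; (iv) for all $x\in X$, $s>0$ the set $\{j:\operatorname{spt}\varrho_{j,t}\cap B(x,s)\neq\varnothing\}$ is finite. $L_p(X,\mu)$ is complex-valued, $\mathcal{L}(E)$ and $\mathcal{K}(E)$ denote the bounded and the compact operators on a Banach space $E$, $M_f$ is multiplication by $f$, $\mathbf{1}_K$ the indicator function of a measurable set $K$. For $A\in\mathcal{L}(L_p(X,\mu))$, $\operatorname{prop}(A):=\sup\{\operatorname{dist}(K,K'):K,K'\subseteq X\text{ measurable},\ M_{\mathbf{1}_{K'}}AM_{\mathbf{1}_K}\neq0\}\in[0,\infty]$, where $\operatorname{dist}(K,K')=\inf_{x\in K,y\in K'}d(x,y)$. $\mathrm{BO}:=\{A:\operatorname{prop}(A)<\infty\}$,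 and $\mathrm{BDO}^p:=\overline{\mathrm{BO}}$ is its operator-norm closure in $\mathcal{L}(L_p(X,\mu))$; $\mathrm{BDO}^q\subseteq\mathcal{L}(L_q(X,\mu))$ is defined in the same way. The adjoint $A^*$ acts on $L_q(X,\mu)$ via the usual duality $L_p(X,\mu)^*=L_q(X,\mu)$. *)

(* Defs.v *)
From HB Require Import structures.
From mathcomp Require Import all_boot all_order all_algebra.
From mathcomp Require Import generic_quotient ring_quotient complex.
From mathcomp Require Import all_classical all_reals all_analysis.
From mathcomp Require Import ess_sup_inf measurable_realfun.

Set Implicit Arguments.
Unset Strict Implicit.
Unset Printing Implicit Defensive.
Import Order.TTheory GRing.Theory Num.Theory.
Import numFieldNormedType.Exports.

Local Open Scope classical_set_scope.
Local Open Scope ring_scope.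
Local Open Scope complex_scope.

Section BoundedOperators.
Variables (R : realType) (E : normedModType R[i]).

Definition bounded_linear : {pred E -> E} := [pred A : E -> E |
  `[< linear A /\ exists M : R[i], forall x, `|A x| <= M * `|x| >]].

Record bop := Bop { bop_fun :> E -> E ; bopP : bop_fun \in bounded_linear }.

HB.instance Definition _ := [isSub for bop_fun].
HB.instance Definition _ := gen_eqMixin bop.
HB.instance Definition _ := gen_choiceMixin bop.

Lemma bounded_linearP (A : E -> E) : A \in bounded_linear <->
  linear A /\ exists M : R[i], forall x, `|A x| <= M * `|x|.
Proof. by split=> [/asboolP//|?]; apply/asboolP. Qed.

Lemma bounded_linear_submod : submod_closed bounded_linear.
Proof.
split.
  apply/bounded_linearP; split=> [a x y|]; first by rewrite scaler0 addr0.
  by exists 0 => x; rewrite normr0 mul0r.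
move=> a f g /bounded_linearP[lf [M fM]] /bounded_linearP[lg [N gN]].
apply/bounded_linearP; split=> [b x y|].
  rewrite /= !fctE lf lg scalerDr scalerDr !scalerA mulrC.
  by rewrite -!addrA; congr (_ + _); rewrite addrCA.
exists (`|a| * M + N) => x; rewrite fctE (le_trans (ler_normD _ _))//.
by rewrite mulrDl lerD// normrZ -mulrA ler_wpM2l.
Qed.

HB.instance Definition _ := GRing.isSubmodClosed.Build _ _ bounded_linear
  bounded_linear_submod.
HB.instance Definition _ := [SubChoice_isSubLmodule of bop by <:].

Lemma bop_eqP (A B : bop) : A =1 B -> A = B.
Proof. by move=> AB; apply/val_inj/funext. Qed.


Let bop_linear (A : bop) : linear A.
Proof. by have /bounded_linearP[] := bopP A. Qed.

HB.instance Definition _ (A : bop) :=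
  GRing.isLinear.Build R[i] E E *:%R A (bop_linear A).

Lemma bop_id_subproof : (id : E -> E) \in bounded_linear.
Proof.
by apply/bounded_linearP; split=> //; exists 1 => x; rewrite mul1r.
Qed.

Lemma bop_comp_subproof (A B : bop) : (A \o B : E -> E) \in bounded_linear.
Proof.
apply/bounded_linearP; split=> [a x y|]; first by rewrite /= !linearP.
have /bounded_linearP[_ [M AM]] := bopP A.
have /bounded_linearP[_ [N BN]] := bopP B.
exists (`|M| * `|N|) => x /=; apply: (le_trans (AM _)).
have [->|Bx0] := eqVneq (B x) 0.
  by rewrite normr0 mulr0 !mulr_ge0.
have nBx : 0 < `|B x| by rewrite normr_gt0.
have M0 : 0 <= M by rewrite -(pmulr_lge0 _ nBx) (le_trans _ (AM _)).
have x0 : 0 < `|x|.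
  by rewrite normr_gt0; apply: contra_neq Bx0 => ->; rewrite linear0.
have N0 : 0 <= N by rewrite -(pmulr_lge0 _ x0) (le_trans _ (BN _)).
by rewrite !ger0_norm// -mulrA ler_wpM2l.
Qed.

Definition bop_id : bop := Bop bop_id_subproof.
Definition bop_comp (A B : bop) : bop := Bop (bop_comp_subproof A B).

Lemma bopDE (A B : bop) x : (A + B) x = A x + B x. Proof. by []. Qed.
Lemma bopNE (A : bop) x : (- A) x = - A x. Proof. by []. Qed.
Lemma bopZE a (A : bop) x : (a *: A) x = a *: A x. Proof. by []. Qed.
Lemma bop0E x : (0 : bop) x = 0. Proof. by []. Qed.

Let bop_compA : associative bop_comp.
Proof. by move=> A B C; exact: bop_eqP. Qed.
Let bop_comp1l : left_id bop_id bop_comp.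
Proof. by move=> A; exact: bop_eqP. Qed.
Let bop_comp1r : right_id bop_id bop_comp.
Proof. by move=> A; exact: bop_eqP. Qed.
Let bop_compDl : left_distributive bop_comp +%R.
Proof. by move=> A B C; exact: bop_eqP. Qed.
Let bop_compDr : right_distributive bop_comp +%R.
Proof. by move=> A B C; apply: bop_eqP => x; exact: (linearD A). Qed.

(* Only a [pzRingType]: [E] may be the zero space. *)
HB.instance Definition _ := GRing.Zmodule_isPzRing.Build bop
  bop_compA bop_comp1l bop_comp1r bop_compDl bop_compDr.

Lemma bopME (A B : bop) x : (A * B) x = A (B x). Proof. by []. Qed.
Lemma bop1E x : (1 : bop) x = x. Proof. by []. Qed.

(* Norms on a [normedModType R[i]] are [R[i]]-valued; [complex.Re] recovers the real
   number. *)
Definition opnorm (A : bop) : R :=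
  sup [set complex.Re `|A x| | x in [set x : E | `|x| <= 1]].

Let NA (A : bop) := [set complex.Re `|A x| | x in [set x : E | `|x| <= 1]].

Let ReK (z : E) : (complex.Re `|z|)%:C = `|z|.
Proof. by apply/RRe_real/ger0_real. Qed.

Let leRe (x y : R[i]) : x <= y -> complex.Re x <= complex.Re y.
Proof. by case: x => a b; case: y => c d; rewrite lecE => /andP[]. Qed.

Let has_supNA A : has_sup (NA A).
Proof.
split; first by exists (complex.Re `|A 0|), 0 => //=; rewrite normr0.
have /bounded_linearP[_ [M AM]] := bopP A.
exists (complex.Re `|M|); move=> _ [x x1 <-]; apply: leRe; apply: (le_trans (AM _)).
have [->|x0] := eqVneq x 0; first by rewrite normr0 mulr0.
have nx : 0 < `|x| by rewrite normr_gt0.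
have M0 : 0 <= M by rewrite -(pmulr_lge0 _ nx) (le_trans _ (AM _)).
by rewrite ger0_norm// ler_piMr.
Qed.

Lemma opnorm_ge0 A : 0 <= opnorm A.
Proof.
have := sup_upper_bound (has_supNA A); apply.
by exists 0 => /=; rewrite ?normr0 // linear0 normr0.
Qed.

Lemma opnormP (A : bop) x : `|A x| <= (opnorm A)%:C * `|x|.
Proof.
have [->|x0] := eqVneq x 0; first by rewrite linear0 !normr0 mulr0.
have nx : 0 < `|x| by rewrite normr_gt0.
rewrite -ler_pdivrMr//.
have -> : `|A x| / `|x| = `|A (`|x|^-1 *: x)|.
  by rewrite linearZ/= normrZ normrV ?unitfE ?gt_eqF// normr_id mulrC.
rewrite -ReK lecR; apply: (sup_upper_bound (has_supNA A)).
exists (`|x|^-1 *: x) => //=.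
by rewrite normrZ normrV ?unitfE ?gt_eqF// normr_id mulVf// gt_eqF.
Qed.

Lemma opnorm_le (A : bop) (M : R) : 0 <= M ->
  (forall x, `|A x| <= M%:C * `|x|) -> opnorm A <= M.
Proof.
move=> M0 AM; apply: ge_sup; first by case: (has_supNA A).
move=> _ [x /= x1 <-]; rewrite -lecR ReK (le_trans (AM _))//.
by rewrite ler_piMr// lecR.
Qed.

Let bop_norm A : R[i] := (opnorm A)%:C.

Let ler_bop_normD A B : bop_norm (A + B) <= bop_norm A + bop_norm B.
Proof.
rewrite -rmorphD lecR; apply: opnorm_le => [|x].
  by rewrite addr_ge0 ?opnorm_ge0.
by rewrite bopDE (le_trans (ler_normD _ _))// rmorphD mulrDl lerD ?opnormP.
Qed.

Let bop_normZ_le a A : bop_norm (a *: A) <= `|a| * bop_norm A.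
Proof.
have Ea : `|a| = (complex.Re `|a|)%:C by rewrite RRe_real ?ger0_real.
have a0 : 0 <= complex.Re `|a| by exact: (leRe (normr_ge0 a)).
rewrite Ea -rmorphM lecR; apply: opnorm_le => [|x].
  by rewrite mulr_ge0 ?opnorm_ge0.
by rewrite bopZE normrZ rmorphM -mulrA [in leLHS]Ea ler_wpM2l ?opnormP ?lecR.
Qed.

Let bop_normZ a A : bop_norm (a *: A) = `|a| * bop_norm A.
Proof.
apply/eqP; rewrite eq_le bop_normZ_le/=.
have [->|a0] := eqVneq a 0.
  by rewrite normr0 mul0r lecR opnorm_ge0.
have := bop_normZ_le a^-1 (a *: A).
rewrite scalerA mulVf// scale1r normrV ?unitfE//.
by rewrite ler_pdivlMl ?normr_gt0.
Qed.

Let bop_norm_eq0 A : bop_norm A = 0 -> A = 0.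
Proof.
move=> A0; apply: bop_eqP => x; apply/eqP.
rewrite -normr_le0 (le_trans (opnormP A x))//.
by rewrite [(opnorm A)%:C]A0 mul0r.
Qed.

HB.instance Definition _ := @Lmodule_isNormed.Build R[i] bop bop_norm
  ler_bop_normD bop_normZ bop_norm_eq0.

Lemma bop_normE (A : bop) : `|A| = (opnorm A)%:C.
Proof. by []. Qed.

Definition compact_op (A : bop) : Prop :=
  precompact (A @` [set x : E | `|x| <= 1]).

(* Finite-dimensional kernel and range of finite codimension; on a Banach space
   the range is then automatically closed. *)
Definition fredholm (A : bop) : Prop :=
  (exists n (v : 'I_n -> E), forall x, A x = 0 ->
     exists c : 'I_n -> R[i], x = \sum_i c i *: v i) /\
  (exists n (w : 'I_n -> E), forall y,
     exists x (c : 'I_n -> R[i]), y = A x + \sum_i c i *: w i).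

Definition regulariser (A B : bop) : Prop :=
  compact_op (A * B - 1) /\ compact_op (B * A - 1).

Definition subalgebra (S : set bop) : Prop :=
  submod_closed (mem S) /\ GRing.mulr_2closed (mem S).

Definition two_sided_ideal (S J : set bop) : Prop :=
  [/\ J `<=` S, submod_closed (mem J) &
      forall A B, S A -> J B -> J (A * B) /\ J (B * A)].

Definition inverse_closed (S : set bop) : Prop :=
  forall A B, S A -> A * B = 1 -> B * A = 1 -> S B.

End BoundedOperators.

Arguments bop {R} E.


(* Complex-valued L^p spaces: a function is measurable when its real and
   imaginary parts are, and its p-norm is the library's [Lnorm] of its
   modulus. *)

Section ComplexLspace.
Context d (T : measurableType d) (R : realType).
Variable mu : {measure set T -> \bar R}.

Definition cmod (f : T -> R[i]) (x : T) : R := Normc.normc (f x).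

Definition cmeasurable (f : T -> R[i]) : Prop :=
  measurable_fun setT (fun x => complex.Re (f x)) /\
  measurable_fun setT (fun x => complex.Im (f x)).

Lemma cmod_ge0 f x : 0 <= cmod f x.
Proof. by rewrite /cmod; case: (f x) => a b; exact: sqrtr_ge0. Qed.

Lemma measurable_cmod f : cmeasurable f -> measurable_fun setT (cmod f).
Proof.
move=> [mr mi].
rewrite (_ : cmod f =
    (@Num.sqrt R) \o (fun x => complex.Re (f x) ^+ 2 + complex.Im (f x) ^+ 2)).
  apply: measurableT_comp.
    by apply: measurable_realfun.continuous_measurable_fun; exact: sqrt_continuous.
  by apply: measurable_funD; exact: measurable_funX.
by apply/funext => x; rewrite /cmod /=; case: (f x).
Qed.

Lemma cmeasurableM f g : cmeasurable f -> cmeasurable g ->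
  cmeasurable (fun x => f x * g x).
Proof.
move=> [fr fi] [gr gi]; split.
- rewrite (_ : (fun x => _) = (fun x => complex.Re (f x) * complex.Re (g x) -
      complex.Im (f x) * complex.Im (g x))).
    by apply: measurable_funB; exact: measurable_funM.
  by apply/funext => x; case: (f x) (g x) => a b [].
- rewrite (_ : (fun x => _) = (fun x => complex.Re (f x) * complex.Im (g x) +
      complex.Im (f x) * complex.Re (g x))).
    by apply: measurable_funD; exact: measurable_funM.
  by apply/funext => x; case: (f x) (g x) => a b [].
Qed.

Lemma cmeasurableD f g : cmeasurable f -> cmeasurable g -> cmeasurable (f + g).
Proof.
move=> [fr fi] [gr gi]; split.
- rewrite (_ : (fun x => _) = (fun x => complex.Re (f x) + complex.Re (g x))).
    exact: measurable_funD.
  by apply/funext => x; rewrite fctE; case: (f x) (g x) => a b [].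
- rewrite (_ : (fun x => _) = (fun x => complex.Im (f x) + complex.Im (g x))).
    exact: measurable_funD.
  by apply/funext => x; rewrite fctE; case: (f x) (g x) => a b [].
Qed.

Lemma cmeasurable_cst c : cmeasurable (fun=> c).
Proof. by split; exact: measurable_cst. Qed.

Lemma le_Lnorm (p : \bar R) (f g : T -> R) : (1 <= p)%E ->
  measurable_fun setT f -> measurable_fun setT g ->
  (\forall x \ae mu, `|f x| <= `|g x|) ->
  ('N[mu]_p[EFin \o f] <= 'N[mu]_p[EFin \o g])%E.
Proof.
move=> p1 mf mg fg; rewrite unlock /Lnorm.
case: p p1 => [r r1|_|//]; last first.
  case: ifPn => // _; apply: le_ess_sup.
  by apply: filterS fg => x /=; rewrite lee_fin.
have r0 : 0 < r by rewrite (lt_le_trans ltr01).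
apply: gt0_ler_poweR; first by rewrite invr_ge0 ltW.
- by rewrite in_itv/= leey integral_ge0.
- by rewrite in_itv/= leey integral_ge0.
have mpow (h : T -> R) : measurable_fun setT h ->
    measurable_fun setT (fun x => `|(EFin \o h) x| `^ r)%E.
  move=> mh; apply/(measurableT_comp (f := fun y : \bar R => y `^ r)%E).
    exact: measurable_poweR.
  by apply: measurableT_comp => //; exact/measurable_EFinP.
apply: ae_ge0_le_integral => //.
- by move=> x _; exact: poweR_ge0.
- exact: mpow.
- by move=> x _; exact: poweR_ge0.
- exact: mpow.
apply: filterS fg => x fgx _ /=.
by rewrite lee_fin ge0_ler_powR ?nnegrE// ltW.
Qed.

Section Fixed_exponent.
Variables (p : \bar R) (p1 : (1 <= p)%E).

Definition cLfun & (1 <= p)%E : {pred T -> R[i]} := [pred f : T -> R[i] |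
  `[< cmeasurable f /\ finite_norm mu p (cmod f) >] ].

Lemma cLfunP (f : T -> R[i]) : f \in cLfun p1 <->
  cmeasurable f /\ finite_norm mu p (cmod f).
Proof. by split=> [/asboolP//|?]; apply/asboolP. Qed.

Lemma Lnorm_cmodZ (c : R) (f : T -> R) : 0 <= c ->
  measurable_fun setT f -> finite_norm mu p f ->
  ('N[mu]_p[EFin \o (c \*: f)%R] = c%:E * 'N[mu]_p[EFin \o f])%E.
Proof.
move=> c0 mf Nf.
have Pf : f \in Lfun mu p by rewrite inE; apply/andP; split; apply: mem_set.
by have := LnormZ (Lfun_Sub p1 Pf) c; rewrite ger0_norm.
Qed.

Lemma cLfun_submod_closed : submod_closed (cLfun p1).
Proof.
split.
  apply/cLfunP; split; first exact: cmeasurable_cst.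
  rewrite (_ : cmod 0 = cst 0); last first.
    by apply/funext => x; rewrite /cmod Normc.normc0.
  exact: finite_norm_cst0.
move=> a f g /cLfunP[mf Nf] /cLfunP[mg Ng].
have maf : cmeasurable (a *: f).
  exact: (cmeasurableM (cmeasurable_cst a) mf).
apply/cLfunP; split; first exact: cmeasurableD.
have mcaf := measurable_cmod maf.
rewrite /finite_norm.
have mZ : measurable_fun setT (Normc.normc a \*: cmod f).
  exact: (measurable_funM (measurable_cst _) (measurable_cmod mf)).
apply: (@le_lt_trans _ _
  ('N[mu]_p[EFin \o ((Normc.normc a \*: cmod f) \+ cmod g)%R])%E).
  apply: le_Lnorm => //.
  - exact/measurable_cmod/cmeasurableD.
  - by apply: measurable_funD => //; exact: measurable_cmod.
  apply/nearW => x; rewrite ger0_norm ?cmod_ge0// ger0_norm; last first.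
    rewrite addr_ge0 ?cmod_ge0//; apply: mulr_ge0 (cmod_ge0 f x).
    by case: (a) => ? ?; exact: sqrtr_ge0.
  rewrite /cmod fctE (le_trans (le_normcD _ _))// lerD2r.
  by rewrite (_ : (a *: f) x = a * f x)// Normc.normcM.
apply: (le_lt_trans (eminkowski _ _ _ _)) => //; first exact: measurable_cmod.
rewrite lte_add_pinfty// Lnorm_cmodZ//.
- by rewrite lte_mul_pinfty// ?lee_fin//; case: (a) => ? ?; exact: sqrtr_ge0.
- by case: (a) => ? ?; exact: sqrtr_ge0.
- exact: measurable_cmod.
Qed.

HB.instance Definition _ := GRing.isSubmodClosed.Build _ _ (cLfun p1)
  cLfun_submod_closed.

Record cLfunType := CLfun { cLfun_fun :> T -> R[i] ;
                            cLfun_funP : cLfun_fun \in cLfun p1 }.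
HB.instance Definition _ := [isSub for cLfun_fun].
HB.instance Definition _ := gen_eqMixin cLfunType.
HB.instance Definition _ := gen_choiceMixin cLfunType.
HB.instance Definition _ := [SubChoice_isSubLmodule of cLfunType by <:].

Definition cLnull : {pred cLfunType} := [pred f : cLfunType |
  `[< \forall x \ae mu, f x = 0 >] ].

Lemma cLnullP (f : cLfunType) : f \in cLnull <-> \forall x \ae mu, f x = 0.
Proof. by split=> [/asboolP//|?]; apply/asboolP. Qed.

Lemma cLnull_submod_closed : submod_closed cLnull.
Proof.
split; first by apply/cLnullP; apply/nearW.
move=> a f g /cLnullP f0 /cLnullP g0; apply/cLnullP.
apply: filterS2 f0 g0 => x fx gx.
by rewrite (_ : (a *: f + g) x = a * f x + g x)// fx gx mulr0 addr0.
Qed.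

HB.instance Definition _ := GRing.isSubmodClosed.Build _ _ cLnull
  cLnull_submod_closed.

Definition cLspace : Type := Quotient.quot cLnull.

HB.instance Definition _ := GRing.Zmodule.on cLspace.
HB.instance Definition _ := EqQuotient.on cLspace.

Definition Lclass (f : cLfunType) : cLspace := (\pi_cLspace f)%qT.

(* A representative of an L^p class. *)
Definition Lrepr (u : cLspace) : cLfunType := repr u.

Lemma LclassK u : Lclass (Lrepr u) = u.
Proof. exact: reprK. Qed.

Lemma Lclass_eqP (f g : cLfunType) :
  Lclass f = Lclass g <-> \forall x \ae mu, f x = g x.
Proof.
have -> : (Lclass f = Lclass g) <-> (f - g \in cLnull).
  by rewrite Quotient.idealrBE; split=> [fg|/eqP//]; exact/eqP.
rewrite cLnullP; split; apply: filterS => x.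
  by move/eqP; rewrite (_ : (f - g) x = f x - g x)// subr_eq0 => /eqP.
by move=> fg; rewrite (_ : (f - g) x = f x - g x)// fg subrr.
Qed.

Lemma LreprK (f : cLfunType) : \forall x \ae mu, Lrepr (Lclass f) x = f x.
Proof. by apply/Lclass_eqP; rewrite LclassK. Qed.

Lemma LclassD f g : Lclass (f + g) = Lclass f + Lclass g.
Proof. exact: Quotient.pi_add. Qed.

Definition Lscale (a : R[i]) (u : cLspace) : cLspace := Lclass (a *: Lrepr u).

Lemma LclassZ a f : Lclass (a *: f) = Lscale a (Lclass f).
Proof.
apply/Lclass_eqP; have := LreprK f; apply: filterS => x fx.
by rewrite !(_ : forall g : cLfunType, (a *: g) x = a * g x)// fx.
Qed.

Let LscaleA a b u : Lscale a (Lscale b u) = Lscale (a * b) u.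
Proof. by rewrite -[u]LclassK -!LclassZ scalerA. Qed.

Let Lscale1 : left_id 1 Lscale.
Proof. by move=> u; rewrite -[u]LclassK -!LclassZ scale1r. Qed.

Let LscaleDr : right_distributive Lscale +%R.
Proof.
move=> a u v.
by rewrite -[u]LclassK -[v]LclassK -LclassD -!LclassZ -LclassD scalerDr.
Qed.

Let LscaleDl u : {morph Lscale^~ u : a b / a + b}.
Proof. by move=> a b; rewrite -[u]LclassK -!LclassZ -LclassD scalerDl. Qed.

HB.instance Definition _ := GRing.Zmodule_isLmodule.Build R[i] cLspace
  LscaleA Lscale1 LscaleDr LscaleDl.

Definition Lnorm_fun (f : cLfunType) : R := fine ('N[mu]_p[EFin \o cmod f])%E.

Lemma cLfun_measurable (f : cLfunType) : cmeasurable f.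
Proof. by have /cLfunP[] := cLfun_funP f. Qed.

Lemma cLfun_finite (f : cLfunType) : finite_norm mu p (cmod f).
Proof. by have /cLfunP[] := cLfun_funP f. Qed.

Lemma Lnorm_funK (f : cLfunType) :
  ((Lnorm_fun f)%:E = 'N[mu]_p[EFin \o cmod f])%E.
Proof.
by rewrite fineK// ge0_fin_numE ?Lnorm_ge0//; exact: cLfun_finite.
Qed.

Lemma eq_Lnorm_fun (f g : cLfunType) : (\forall x \ae mu, f x = g x) ->
  Lnorm_fun f = Lnorm_fun g.
Proof.
move=> fg; rewrite /Lnorm_fun; congr fine; apply/eqP; rewrite eq_le.
have mc (h : cLfunType) : measurable_fun setT (cmod h).
  exact/measurable_cmod/cLfun_measurable.
by rewrite !le_Lnorm//; apply: filterS fg => x; rewrite /cmod => ->.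
Qed.

Definition cLnorm (u : cLspace) : R[i] := (Lnorm_fun (Lrepr u))%:C.

Lemma cLnorm_class (f : cLfunType) : cLnorm (Lclass f) = (Lnorm_fun f)%:C.
Proof. by congr _%:C; apply/eq_Lnorm_fun/LreprK. Qed.

Let ler_cLnormD u v : cLnorm (u + v) <= cLnorm u + cLnorm v.
Proof.
rewrite -[u]LclassK -[v]LclassK -LclassD !cLnorm_class -rmorphD lecR.
move: (Lrepr u) (Lrepr v) => f g; rewrite -lee_fin EFinD !Lnorm_funK.
have mc (h : cLfunType) : measurable_fun setT (cmod h).
  exact/measurable_cmod/cLfun_measurable.
apply: le_trans (eminkowski _ (mc f) (mc g) p1).
apply: le_Lnorm => //; first exact: measurable_funD.
apply/nearW => x; rewrite ger0_norm ?cmod_ge0// ger0_norm; last first.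
  by rewrite addr_ge0 ?cmod_ge0.
exact: le_normcD.
Qed.

Let cLnormZ a u : cLnorm (a *: u) = `|a| * cLnorm u.
Proof.
rewrite -[u]LclassK -[a *: Lclass _]LclassZ !cLnorm_class.
rewrite -[`|a|]/((Normc.normc a)%:C) -rmorphM; congr _%:C.
move: (Lrepr u) => f; apply: EFin_inj.
have a0 : 0 <= Normc.normc a by case: (a) => ? ?; exact: sqrtr_ge0.
rewrite EFinM !Lnorm_funK -Lnorm_cmodZ//; last 2 first.
- exact/measurable_cmod/cLfun_measurable.
- exact: cLfun_finite.
congr ('N[mu]_p[EFin \o _])%E; apply/funext => x.
by rewrite /cmod (_ : (a *: f) x = a * f x)// Normc.normcM.
Qed.

Let cLnorm_eq0 u : cLnorm u = 0 -> u = 0.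
Proof.
rewrite -[u]LclassK cLnorm_class => Nu0.
have f0 : Lnorm_fun (Lrepr u) = 0 by move: Nu0; rewrite /real_complex_def; case.
rewrite (_ : 0 = Lclass 0); last first.
  by apply: (addrI (Lclass 0)); rewrite -LclassD !addr0.
apply/Lclass_eqP.
have N0 : ('N[mu]_p[EFin \o cmod (Lrepr u)] = 0)%E by rewrite -Lnorm_funK f0.
have mc : measurable_fun setT (EFin \o cmod (Lrepr u)).
  exact/measurable_EFinP/measurable_cmod/cLfun_measurable.
have := Lnorm_eq0_eq0 mc (lt_le_trans lte01 p1) N0.
apply: filterS => x /(_ I)[].
exact: Normc.eq0_normc.
Qed.

HB.instance Definition _ := @Lmodule_isNormed.Build R[i] cLspace cLnorm
  ler_cLnormD cLnormZ cLnorm_eq0.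

Lemma cLspace_normE (f : cLfunType) : `|Lclass f| = (Lnorm_fun f)%:C.
Proof. exact: cLnorm_class. Qed.

End Fixed_exponent.
End ComplexLspace.

Section MultiplicationOperators.
Context d (T : measurableType d) (R : realType).
Variables (mu : {measure set T -> \bar R}) (p : \bar R) (p1 : (1 <= p)%E).

Definition cLinfty : Type := cLfunType mu (leey 1%E).

Lemma cLinfty_bounded (f : cLinfty) :
  exists2 C : R, 0 <= C & \forall x \ae mu, cmod f x <= C.
Proof.
have := cLfun_finite f; rewrite /finite_norm unlock /Lnorm.
case: ifPn => [_ /ess_supr_bounded[M fM]|mu0 _].
  exists `|M| => //; apply: filterS fM => x; rewrite ger0_norm ?cmod_ge0//.
  by move/le_trans; apply; exact: ler_norm.
have {}mu0 : mu setT = 0%E.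
  by apply/eqP; rewrite eq_le measure_ge0 andbT leNgt.
by exists 0 => //; exists setT; split.
Qed.

Lemma Lnorm_mul_le (f : cLinfty) (g : cLfunType mu p1) (C : R) : 0 <= C ->
  (\forall x \ae mu, cmod f x <= C) ->
  ('N[mu]_p[EFin \o cmod (fun x => f x * g x)%R] <=
    C%:E * 'N[mu]_p[EFin \o cmod g])%E.
Proof.
move=> C0 fC; have mg := cLfun_measurable g.
rewrite -Lnorm_cmodZ//; last 2 first.
- exact: measurable_cmod.
- exact: cLfun_finite.
apply: le_Lnorm => //.
- by apply/measurable_cmod/cmeasurableM => //; exact: cLfun_measurable.
- exact: (measurable_funM (measurable_cst _) (measurable_cmod mg)).
apply: filterS fC => x fx.
rewrite !ger0_norm ?cmod_ge0//; last exact: mulr_ge0 C0 (cmod_ge0 g x).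
by rewrite [leLHS]Normc.normcM; apply: ler_wpM2r fx; exact: cmod_ge0.
Qed.

Lemma mul_cLfun_subproof (f : cLinfty) (g : cLfunType mu p1) :
  (fun x => f x * g x) \in cLfun mu p1.
Proof.
apply/cLfunP; split; first by apply: cmeasurableM; exact: cLfun_measurable.
have [C C0 fC] := cLinfty_bounded f.
apply: le_lt_trans (Lnorm_mul_le g C0 fC) _.
by rewrite lte_mul_pinfty// ?lee_fin//; exact: cLfun_finite.
Qed.

Definition mul_cLfun (f : cLinfty) (g : cLfunType mu p1) : cLfunType mu p1 :=
  CLfun (mul_cLfun_subproof f g).

Definition mulop_fun (f : cLinfty) (u : cLspace mu p1) : cLspace mu p1 :=
  Lclass (mul_cLfun f (Lrepr u)).

Lemma mulop_class (f : cLinfty) g :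
  mulop_fun f (Lclass g) = Lclass (mul_cLfun f g).
Proof.
by apply/Lclass_eqP; have := LreprK g; apply: filterS => x /= ->.
Qed.

Lemma mulop_subproof (f : cLinfty) : mulop_fun f \in @bounded_linear R _.
Proof.
apply/bounded_linearP; split=> [a u v|].
  rewrite -[u]LclassK -[v]LclassK.
  rewrite -[a *: Lclass _]LclassZ -LclassD !mulop_class.
  rewrite -[a *: Lclass _]LclassZ -LclassD; congr Lclass.
  apply/val_inj/funext => x.
  change (f x * (a * Lrepr u x + Lrepr v x) =
    a * (f x * Lrepr u x) + f x * Lrepr v x).
  by rewrite mulrDr mulrCA.
have [C C0 fC] := cLinfty_bounded f.
exists C%:C => u; rewrite -[u]LclassK mulop_class.
rewrite -![`|Lclass _|]/(cLnorm _) !cLnorm_class -rmorphM lecR.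
by rewrite -lee_fin EFinM !Lnorm_funK; exact: Lnorm_mul_le.
Qed.

Definition mulop (f : cLinfty) : bop (cLspace mu p1) := Bop (mulop_subproof f).

Lemma cindic_subproof (K : set T) : measurable K ->
  (fun x => (\1_K x : R)%:C) \in cLfun mu (leey 1%E).
Proof.
move=> mK.
have cE : cmod (fun x => (\1_K x : R)%:C) = \1_K.
  apply/funext => x; rewrite /cmod /= expr0n addr0 sqrtr_sqr ger0_norm//.
apply/cLfunP; split; first by split; [exact: measurable_indic|exact: measurable_cst].
rewrite /finite_norm cE.
have N1 : ('N[mu]_+oo[EFin \o (cst 1%R : T -> R)] < +oo)%E.
  rewrite unlock /Lnorm; case: ifPn => [mu0|_]; last exact: ltry.
  rewrite (_ : _ \o _ = cst 1%E) ?ess_sup_cst ?ltry//.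
  by apply/funext => x /=; rewrite normr1.
apply: (le_lt_trans _ N1); apply: le_Lnorm; [by rewrite leey|exact: measurable_indic|exact: measurable_cst|].
by apply/nearW => x; rewrite indicE normr1 ger0_norm//; case: (x \in K).
Qed.

Definition cindic (K : set T) (mK : measurable K) : cLinfty :=
  CLfun (cindic_subproof mK).

End MultiplicationOperators.

Section Duality.
Context d (T : measurableType d) (R : realType).
Variables (mu : {measure set T -> \bar R}).

Definition cintegral (h : T -> R[i]) : R[i] :=
  (\int[mu]_x complex.Re (h x)) +i* (\int[mu]_x complex.Im (h x)).

Variables (p q : \bar R) (p1 : (1 <= p)%E) (q1 : (1 <= q)%E).

(* The bilinear pairing, without conjugation. *)
Definition pairing (u : cLspace mu p1) (v : cLspace mu q1) : R[i] :=
  cintegral (fun x => Lrepr u x * Lrepr v x).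

Definition is_adjoint (A : bop (cLspace mu p1)) (B : bop (cLspace mu q1)) :
  Prop := forall u v, pairing (A u) v = pairing u (B v).

End Duality.

(* [Pointed] is required by the library's [measurableType]; it costs nothing
   here, since [propertyA'] forces the space to be nonempty. *)
#[short(type="pmetricType")]
HB.structure Definition PointedMetric (R : numDomainType) :=
  {X of Pointed X & Metric R X}.

Notation borel X := (g_sigma_algebraType (@open X)).

Section MetricGeometry.
Context {R : realType} (X : pmetricType R).

(* Not the library's [closed_ball], which is the closure of the open ball. *)
Definition proper_space : Prop :=
  forall (x : X) (r : R), compact [set y : X | mdist x y <= r].

Definition bounded_geometry : Prop :=
  exists2 eps : R, 0 < eps & forall r : R, 0 < r ->
    exists N : nat, forall x : X, exists2 s : seq X, (size s <= N)%N &
      ball x r `<=` \bigcup_(y in [set` s]) ball y eps.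

Definition diam (A : set X) : \bar R :=
  ereal_sup [set (mdist x y)%:E | x in A & y in A].

Definition set_dist (A B : set X) : \bar R :=
  ereal_inf [set (mdist x y)%:E | x in A & y in B].

Definition spt (f : X -> R) : set X := closure [set x | f x != 0].

Definition propertyA' : Prop :=
  forall t : R, 0 < t -> exists rho : nat -> borel X -> R,
    [/\ forall j, [/\ measurable_fun setT (rho j),
          forall x, 0 <= rho j x <= 1 & exists x, rho j x != 0],
        forall x : X, (\sum_(0 <= j <oo) (rho j x)%:E = 1)%E,
        (ereal_sup [set diam (spt (rho j)) | j in setT] < +oo)%E,
        forall x y : X, mdist x y <= t^-1 ->
          (\sum_(0 <= j <oo) `|rho j x - rho j y|%:E < t%:E)%E &
        forall (x : X) (s : R), 0 < s ->
          finite_set [set j | spt (rho j) `&` ball x s !=set0] ].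

End MetricGeometry.

Section BandDominated.
Context {R : realType} (X : pmetricType R).
Variables (mu : {measure set (borel X) -> \bar R}).
Variables (p : \bar R) (p1 : (1 <= p)%E).

(* Supremum in [0, +oo]: it is 0 over the empty family. *)
Definition propagation (A : bop (cLspace mu p1)) : \bar R :=
  Order.max (0 : \bar R)%E (ereal_sup [set e | exists (K K' : set (borel X))
    (mK : measurable K) (mK' : measurable K'),
    e = set_dist K K' /\
    mulop p1 (cindic mu mK') * A * mulop p1 (cindic mu mK) != 0]).

Definition BO : set (bop (cLspace mu p1)) :=
  [set A | (propagation A < +oo)%E].

Definition BDO : set (bop (cLspace mu p1)) := closure BO.

End BandDominated.

Lemma Lp_ge1 (R : realType) (p : R) : 1 < p -> (1 <= p%:E)%E.
Proof. by move=> p1; rewrite lee_fin ltW. Qed.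

Arguments mulop {d T R mu p} p1 f.
Arguments BO {R X} mu {p} p1.
Arguments BDO {R X} mu {p} p1.

(* Main.v *)
From mathcomp Require Import all_boot all_order all_algebra.
From mathcomp Require Import complex.
From mathcomp Require Import all_classical all_reals all_analysis.
From mathcomp Require Import ess_sup_inf measurable_realfun.
From mathcomp Require Import ring lra.
Require Import Defs.

(** The idea is to recognise band-dominated operators by their commutators.

    Let [rho] be a partition of unity as in property A' with parameter [t], and let
    [M_j] be multiplication by [rho_j^(1/p)]. Call the commutators of [A] small when,
    for every [e > 0] and all small enough [t], the sum over [j] of
    [|[A, M_j] u|^p] is at most [e |u|^p]. Then [A] is band-dominated if and only if
    its commutators are small.

    - A band operator has small commutators ([band_small]). Bounded geometry cuts the
      space into disjoint pieces [Q_k] of bounded size, with neighbourhoods [N_k] of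
      bounded overlap such that [A] maps functions on [Q_k] to functions on [N_k]
      ([bounded_geometry_partition]). On [N_k] the functions [rho_j^(1/p)] are nearly
      constant, and constants commute with [A]. Smallness survives norm limits
      ([small_comm_closed]).

    - Conversely, the averages [sum_j rho_j^(1/q) A rho_j^(1/p)] have finite
      propagation, because the supports of the [rho_j] have uniformly bounded
      diameter, and they differ from [A] by [sum_j rho_j^(1/q) [A, M_j]]. By Hoelder's
      inequality the norm of this difference is controlled by the sum of the
      [|[A, M_j] u|^p] ([small_BDO]).

    If [K = AB - 1] and [L = BA - 1] are compact, then
    [[B, M] = - B [A, M] B + [L, M] B + B [K, M] - [LB, M]] for every [M]. The
    commutators of [K], [L] and [LB] are small since compact operators are
    band-dominated, so those of [B] are small, and [B] is band-dominated
    ([regulariser_BDO]). The case [K = L = 0] is inverse closedness.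

    A compact operator is a norm limit of its compressions to balls ([compact_BDO]).
    Cutting off on the left is harmless by total boundedness of the image of the unit
    ball. Cutting off on the right is where [p > 1] enters: otherwise [N] disjointly
    supported vectors, whose sum has norm about [N^(1/p)], would have almost the same
    nonzero image. Compactness is handled through total boundedness, which requires
    completeness of [L^p] ([Lp_complete]).

    The adjoint is obtained from the representation of bounded functionals [phi] on
    [L^p] by elements of [L^q] ([Riesz_representation]), for an arbitrary measure.
    The functional [|u|^p / p - Re phi(u)] has a minimiser, because [L^p] is uniformly
    convex and complete; the first-order condition there says that [phi] is the pairing
    with [|u|^(p-2) conj u]. Since multiplications are their own adjoints, the adjoint
    of a band operator is a band operator, and continuity of the adjoint passes this to
    the closure ([adjoint_BDO]). *)

Set Implicit Arguments.
Unset Strict Implicit.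
Unset Printing Implicit Defensive.
Import Order.TTheory GRing.Theory Num.Theory.
Import numFieldNormedType.Exports.

Local Open Scope classical_set_scope.
Local Open Scope ring_scope.
Local Open Scope complex_scope.

(** * Real-valued norms *)

Section RealNorm.
Variables (R : realType) (E : normedModType R[i]).
Implicit Types (x y : E) (S : set E).

(** Norms over [R[i]] are [R[i]]-valued; all estimates below are between real
    numbers, where the order is total and real powers exist. *)
Definition nr (x : E) : R := complex.Re `|x|.

Lemma nrK x : (nr x)%:C = `|x|.
Proof. by apply/RRe_real/ger0_real. Qed.

Lemma le_nrC x (a : R) : (`|x| <= a%:C) = (nr x <= a).
Proof. by rewrite -nrK lecR. Qed.

Lemma lt_nrC x (a : R) : (`|x| < a%:C) = (nr x < a).
Proof. by rewrite -nrK ltcR. Qed.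

Lemma nr_ge0 x : 0 <= nr x.
Proof. by rewrite -lecR nrK; exact: (normr_ge0 x). Qed.

Lemma nr0 : nr 0 = 0.
Proof. by rewrite /nr normr0. Qed.

Lemma nr_eq0 x : nr x = 0 -> x = 0.
Proof. by move=> x0; apply/eqP; rewrite -normr_eq0 -nrK x0. Qed.

Lemma ler_nrD x y : nr (x + y) <= nr x + nr y.
Proof. by rewrite -lecR rmorphD/= !nrK; exact: ler_normD. Qed.

Lemma nrN x : nr (- x) = nr x.
Proof. by rewrite /nr normrN. Qed.

Lemma nrBC x y : nr (x - y) = nr (y - x).
Proof. by rewrite /nr distrC. Qed.

Lemma nr_triangle y x z : nr (x - z) <= nr (x - y) + nr (y - z).
Proof. by rewrite -[x - z](subrKA y); exact: ler_nrD. Qed.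

Lemma ler_nrB x y : nr x - nr y <= nr (x - y).
Proof. by rewrite lerBlDr; have := ler_nrD (x - y) y; rewrite subrK. Qed.

Lemma nrZ (a : R[i]) x : nr (a *: x) = Normc.normc a * nr x.
Proof.
apply: (@complexI R); rewrite rmorphM /= !nrK normrZ.
by rewrite -[`|a|]/((Normc.normc a)%:C).
Qed.

Lemma nrZ_ge0 (a : R) x : 0 <= a -> nr (a%:C *: x) = a * nr x.
Proof. by move=> a0; rewrite nrZ /= expr0n addr0 sqrtr_sqr ger0_norm. Qed.

Lemma ler_nr_sum (I : Type) (r : seq I) (P : pred I) (F : I -> E) :
  nr (\sum_(i <- r | P i) F i) <= \sum_(i <- r | P i) nr (F i).
Proof.
elim/big_ind2 : _ => //; first by rewrite nr0.
by move=> x a y b xa yb; exact: le_trans (ler_nrD _ _) (lerD xa yb).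
Qed.

Lemma nbhs_nrP x (U : set E) :
  nbhs x U <-> exists2 e : R, 0 < e & forall y, nr (x - y) < e -> U y.
Proof.
split=> [/nbhs_ballP[e /= e0]|[e e0 eU]].
  rewrite -ball_normE => eU; exists (complex.Re e).
    by case: e e0 {eU} => a b; rewrite ltcE /= => /andP[].
  move=> y xy; apply: eU => /=.
  have -> : e = (complex.Re e)%:C.
    by apply/esym/RRe_real/ger0_real/ltW.
  by rewrite lt_nrC.
apply/nbhs_ballP; exists e%:C; first by rewrite /= ltcR.
by rewrite -ball_normE => y /=; rewrite lt_nrC; exact: eU.
Qed.

Lemma closure_nrP S x :
  closure S x <-> forall e : R, 0 < e -> exists2 y, S y & nr (x - y) < e.
Proof.
split=> [Sx e e0|Sx U /nbhs_nrP[e e0 eU]].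
  have /Sx[y [Sy xy]] : nbhs x [set y | nr (x - y) < e].
    by apply/nbhs_nrP; exists e.
  by exists y.
by have [y Sy /eU Uy] := Sx e e0; exists y.
Qed.

End RealNorm.

Section Sequences.
Variables (R : realType) (E : normedModType R[i]).
Implicit Types (u v : nat -> E) (x y : E).

Definition nrcvg u x := forall e : R, 0 < e ->
  exists n0, forall n, (n0 <= n)%N -> nr (u n - x) < e.

Definition nrcauchy u := forall e : R, 0 < e ->
  exists n0, forall n m, (n0 <= n)%N -> (n0 <= m)%N -> nr (u n - u m) < e.

Definition nrcomplete := forall u, nrcauchy u -> exists x, nrcvg u x.

Lemma nrcvgD u v x y : nrcvg u x -> nrcvg v y -> nrcvg (u \+ v) (x + y).
Proof.
move=> ux vy e e0; have e20 : 0 < e / 2 by rewrite divr_gt0.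
have [n0 n0P] := ux _ e20; have [m0 m0P] := vy _ e20.
exists (maxn n0 m0) => n; rewrite geq_max => /andP[/n0P un /m0P vn].
rewrite /= opprD addrACA (le_lt_trans (ler_nrD _ _))// [ltRHS]splitr.
exact: ltrD.
Qed.

Lemma nrcvgZ (a : R[i]) u x : nrcvg u x -> nrcvg (fun n => a *: u n) (a *: x).
Proof.
move=> ux e e0; set c := Normc.normc a.
have c0 : 0 <= c by case: (a) @c => ? ?; exact: sqrtr_ge0.
have c10 : 0 < c + 1 by rewrite ltr_wpDl.
have [n0 n0P] := ux (e / (c + 1)) (divr_gt0 e0 c10).
exists n0 => n /n0P unx; rewrite -scalerBr nrZ -/c.
rewrite (le_lt_trans (y := (c + 1) * nr (u n - x)))//.
  by rewrite ler_wpM2r ?nr_ge0// lerDl.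
by rewrite mulrC -ltr_pdivlMr.
Qed.

Lemma nrcvg_le u x y (c : R) (n1 : nat) : nrcvg u x ->
  (forall n, (n1 <= n)%N -> nr (u n - y) <= c) -> nr (x - y) <= c.
Proof.
move=> ux uy; apply/ler_addgt0Pl => e e0.
have [n0 n0P] := ux e e0.
have := n0P (maxn n0 n1) (leq_maxl _ _); have := uy _ (leq_maxr n0 n1).
move=> h1 h2; rewrite (le_trans (nr_triangle (u (maxn n0 n1)) _ _))//.
by apply: lerD => //; rewrite nrBC ltW.
Qed.

Lemma nrcvg_le0 u x (c : R) : nrcvg u x ->
  (forall n, nr (u n) <= c) -> nr x <= c.
Proof.
move=> ux uc; rewrite -[x]subr0; apply: (nrcvg_le (n1 := 0%N) ux) => n _.
by rewrite subr0.
Qed.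

Lemma nrcvg_unique u x y : nrcvg u x -> nrcvg u y -> x = y.
Proof.
move=> ux uy; apply/eqP; rewrite -subr_eq0; apply/eqP/nr_eq0/eqP.
rewrite eq_le nr_ge0 andbT; apply/ler_addgt0Pl => e e0; rewrite addr0.
have [n0 n0P] := uy e e0.
by apply: (nrcvg_le (n1 := n0) ux) => n /n0P/ltW.
Qed.

Lemma nrcvg_nr u x : nrcvg u x -> nr (u n) @[n --> \oo] --> nr x.
Proof.
move=> ux; apply/cvgrPdist_lt => e /ux[n0 n0P]; exists n0 => // n /= /n0P.
apply: le_lt_trans; rewrite ler_norml lerNl opprB.
by rewrite [X in _ && (_ <= X)]nrBC !ler_nrB.
Qed.

End Sequences.

(** * Bounded operators *)

Section Operators.
Variables (R : realType) (E : normedModType R[i]).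
Implicit Types (A B : bop E) (x y : E).

Lemma ler_nr_bop A x : nr (A x) <= nr A * nr x.
Proof.
rewrite -lecR nrK (le_trans (opnormP A x))// rmorphM /= nrK.
by rewrite nrK.
Qed.

Lemma nr_bop_le A (M : R) : 0 <= M ->
  (forall x, nr (A x) <= M * nr x) -> nr A <= M.
Proof.
move=> M0 AM; apply: (opnorm_le (A := A)) => // x.
by rewrite -!nrK -rmorphM lecR; exact: AM.
Qed.

Lemma nr_bop_le_ball A (M : R) : 0 <= M ->
  (forall x, nr x <= 1 -> nr (A x) <= M) -> nr A <= M.
Proof.
move=> M0 AM; apply: nr_bop_le => // x.
have [x0|x0] := eqVneq (nr x) 0.
  by rewrite (nr_eq0 x0) linear0 nr0 mulr0.
have {}x0 : 0 < nr x by rewrite lt_neqAle eq_sym x0 nr_ge0.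
have ix0 : 0 <= (nr x)^-1 by rewrite invr_ge0 ltW.
have := AM ((nr x)^-1%:C *: x).
rewrite linearZ /= !nrZ_ge0// mulVf ?gt_eqF// => /(_ (lexx _)).
by rewrite mulrC ler_pdivrMr.
Qed.

Lemma nrcvg_bop A (u : nat -> E) x : nrcvg u x -> nrcvg (A \o u) (A x).
Proof.
move=> ux e e0; have A0 : 0 < nr A + 1 by rewrite ltr_wpDl ?nr_ge0.
have [n0 n0P] := ux _ (divr_gt0 e0 A0).
exists n0 => n /n0P; rewrite /= -linearB ltr_pdivlMr// mulrC.
apply: le_lt_trans; apply: le_trans (ler_nr_bop _ _) _.
by rewrite ler_wpM2r ?nr_ge0// lerDl.
Qed.

Lemma nr_bopM A B : nr (A * B) <= nr A * nr B.
Proof.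
apply: nr_bop_le => [|x]; first by rewrite mulr_ge0 ?nr_ge0.
rewrite bopME -mulrA (le_trans (ler_nr_bop _ _))// ler_wpM2l ?nr_ge0//.
exact: ler_nr_bop.
Qed.

Lemma bop_of_bound (f : E -> E) (M : R) : linear f ->
  (forall x, nr (f x) <= M * nr x) -> exists A : bop E, forall x, A x = f x.
Proof.
move=> lf fM.
have fP : f \in @bounded_linear R E.
  apply/bounded_linearP; split=> //; exists M%:C => x.
  by rewrite -!nrK -rmorphM lecR; exact: fM.
by exists (Bop fP).
Qed.

(** Partial sums of infinite sums of operators converge strongly and not in norm,
    so this is how the averages of an operator over a partition are formed. *)
Lemma bop_strong_limit (T : nat -> bop E) (M : R) :
  nrcomplete E -> (forall n x, nr (T n x) <= M * nr x) ->
  (forall x, nrcauchy (T^~ x)) -> exists A : bop E, forall x, nrcvg (T^~ x) (A x).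
Proof.
move=> cE TM cT; pose f x := projT1 (cid (cE _ (cT x))).
have fP x : nrcvg (T^~ x) (f x) by exact: projT2 (cid (cE _ (cT x))).
have [||A Af] := @bop_of_bound f M.
- move=> a x y; apply: (nrcvg_unique (fP _)).
  rewrite (_ : T^~ _ = (fun n => a *: T n x) \+ T^~ y).
    by apply: nrcvgD => //; exact: nrcvgZ.
  by apply/funext => n /=; rewrite linearP.
- by move=> x; apply: nrcvg_le0 (fP x) _ => n; exact: TM.
by exists A => x; rewrite Af.
Qed.

End Operators.

(** * Compact operators *)

Section CompactOperators.
Variables (R : realType) (E : normedModType R[i]).
Hypothesis cE : nrcomplete E.
Implicit Types (A B : bop E) (x y : E).

(** Unlike relative compactness of the image of the ball, this condition passes
    through sums, products and norm limits by direct estimates. *)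
Definition totally_bounded_op A := forall e : R, 0 < e ->
  exists s : seq E, forall x, nr x <= 1 ->
    exists2 y, y \in s & nr (A x - y) < e.

Lemma ultra_seq_cover (F : set_system E) (UF : UltraFilter F)
    (s : seq E) (e : R) (S : set E) : F S ->
  (forall x, S x -> exists2 y, y \in s & nr (x - y) < e) ->
  exists y, F [set x | nr (x - y) < e].
Proof.
elim: s S => [|y s IH] S FS Ss.
  suff S0 : S = set0 by move: FS; rewrite S0 => /filter_ex[].
  by rewrite -subset0 => x /Ss[].
have [Fy|Fy] := in_ultra_setVsetC [set x | nr (x - y) < e] UF.
  by exists y.
apply: (IH (S `&` ~` [set x | nr (x - y) < e])); first exact: filterI.
move=> x [/Ss[z]]; rewrite inE => /predU1P[->//|zs xz _].
by exists z.
Qed.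

(** An ultrafilter on [S] contains a ball of radius [1/(n+1)] for each [n]; the
    centres may be replaced by points of the intersections of these balls, which
    form a Cauchy sequence, and the ultrafilter converges to its limit. *)
Lemma totally_bounded_precompact (S : set E) :
  (forall e : R, 0 < e -> exists s : seq E, forall x, S x ->
     exists2 y, y \in s & nr (x - y) < e) -> precompact S.
Proof.
move=> tS; rewrite precompactE compact_ultra => F UF FS.
have {}tS (e : R) : 0 < e -> exists y, F [set x | nr (x - y) < e].
  move=> e0; have e20 : 0 < e / 2 by rewrite divr_gt0.
  have [s sP] := tS _ e20.
  apply: (ultra_seq_cover UF (s := s) FS) => x /closure_nrP/(_ _ e20)[z Sz xz].
  have [y ys zy] := sP z Sz; exists y => //.
  by rewrite (le_lt_trans (nr_triangle z _ _))// [ltRHS]splitr ltrD.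
pose e n : R := n.+1%:R^-1.
have e0 n : 0 < e n by rewrite /e.
pose y n := projT1 (cid (tS _ (e0 n))).
pose G n := [set x | nr (x - y n) < e n].
have FG n : F (G n) by exact: projT2 (cid (tS _ (e0 n))).
have : forall n, exists x, forall k, (k <= n)%N -> G k x.
  move=> n; suff : F [set x | forall k, (k <= n)%N -> G k x].
    by move=> /filter_ex[x xP]; exists x.
  elim: n => [|n IH].
    by apply: filterS (FG 0%N) => x Gx k; rewrite leqn0 => /eqP->.
  apply: filterS (filterI IH (FG n.+1)) => x [xP Gx] k.
  by rewrite leq_eqVlt => /predU1P[->//|]; rewrite ltnS; exact: xP.
move=> /choice[x xP].
have esmall (d : R) : 0 < d -> exists n, e n < d.
  move=> d0; have := @cvg_harmonic R => /cvgrPdist_lt/(_ d d0)[n _ /(_ n (leqnn n))].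
  rewrite /= sub0r normrN ger0_norm ?invr_ge0// => hn; exists n; exact: hn.
have cx : nrcauchy x.
  move=> d d0; have [n en] := esmall _ (divr_gt0 d0 (ltr0Sn _ 1)).
  exists n => k l nk nl.
  rewrite (le_lt_trans (nr_triangle (y n) _ _))// [ltRHS]splitr ltrD//.
    by rewrite (lt_trans _ en)//; exact: xP.
  by rewrite nrBC (lt_trans _ en)//; exact: xP.
have [z xz] := cE cx.
have Fz : F --> z.
  move=> U /nbhs_nrP[d d0 dU].
  have [n en] := esmall _ (divr_gt0 d0 (ltr0Sn _ 2)).
  have [m mP] := xz _ (divr_gt0 d0 (ltr0Sn _ 2)).
  apply: filterS (FG n) => w Gw; apply: dU.
  have h1 := mP (maxn m n) (leq_maxl _ _).
  have h2 : G n (x (maxn m n)) by apply: xP; exact: leq_maxr.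
  have hw : nr (z - w) <= nr (x (maxn m n) - z) +
      (nr (x (maxn m n) - y n) + nr (w - y n)).
    rewrite (le_trans (nr_triangle (x (maxn m n)) _ _))// nrBC lerD2l.
    by rewrite (le_trans (nr_triangle (y n) _ _))// lerD2l nrBC.
  apply: (le_lt_trans hw); rewrite (_ : d = d / 3 + (d / 3 + d / 3)).
    by apply: ltrD => //; apply: ltrD; exact: (lt_trans _ en).
  by lra.
exists z; split => //; apply: closed_closure => U /Fz FU.
exact: filter_ex (filterI FS FU).
Qed.

Lemma compact_opP A : compact_op A <-> totally_bounded_op A.
Proof.
split=> [|tA].
  rewrite /compact_op precompactE compact_cover => cA e e0.
  pose f (y : E) := interior [set x | nr (x - y) < e].
  have [||D _ AD] := cA E setT f.
  - by move=> y _; exact: open_interior.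
  - move=> x _; exists x => //; apply/nbhs_nrP; exists e => // y.
    by rewrite nrBC.
  exists (finmap.enum_fset D) => x x1.
  have [|y /= yD /interior_subset xy] := AD (A x).
    apply: subset_closure; exists x => //=.
    by have := x1; rewrite -le_nrC.
  by exists y.
apply: totally_bounded_precompact => e /tA[s sP]; exists s => _ [x /= x1 <-].
by apply: sP; rewrite -le_nrC.
Qed.

Lemma totally_bounded_opD A B : totally_bounded_op A -> totally_bounded_op B ->
  totally_bounded_op (A + B).
Proof.
move=> tA tB e e0; have e20 : 0 < e / 2 by rewrite divr_gt0.
have [s sP] := tA _ e20; have [t tP] := tB _ e20.
exists [seq y + z | y <- s, z <- t] => x x1.
have [y ys Ay] := sP x x1; have [z zt Bz] := tP x x1.
exists (y + z); first exact: allpairs_f.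
by rewrite bopDE opprD addrACA (le_lt_trans (ler_nrD _ _))// [ltRHS]splitr ltrD.
Qed.

Lemma totally_bounded_opMl A B : totally_bounded_op B ->
  totally_bounded_op (A * B).
Proof.
move=> tB e e0; have A1 : 0 < nr A + 1 by rewrite ltr_wpDl ?nr_ge0.
have [s sP] := tB _ (divr_gt0 e0 A1).
exists [seq A y | y <- s] => x /sP[y ys xy].
exists (A y); first exact: map_f.
rewrite bopME -linearB (le_lt_trans (ler_nr_bop _ _))//.
rewrite (le_lt_trans (y := (nr A + 1) * nr (B x - y)))//.
  by rewrite ler_wpM2r ?nr_ge0// lerDl.
by rewrite mulrC -ltr_pdivlMr.
Qed.

Lemma totally_bounded_opMr A B : totally_bounded_op A ->
  totally_bounded_op (A * B).
Proof.
move=> tA e e0; have B1 : 0 < nr B + 1 by rewrite ltr_wpDl ?nr_ge0.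
have [s sP] := tA _ (divr_gt0 e0 B1).
exists [seq (nr B + 1)%:C *: y | y <- s] => x x1.
pose z := (nr B + 1)^-1%:C *: B x.
have z1 : nr z <= 1.
  rewrite /z nrZ_ge0; last by rewrite invr_ge0 ltW.
  rewrite ler_pdivrMl// mulr1.
  rewrite (le_trans (ler_nr_bop _ _))// (le_trans (y := nr B * 1))//.
    by rewrite ler_wpM2l ?nr_ge0.
  by rewrite mulr1 lerDl.
have [y ys zy] := sP z z1; exists ((nr B + 1)%:C *: y); first exact: map_f.
have -> : (A * B) x = (nr B + 1)%:C *: A z.
  by rewrite /z linearZ /= scalerA -rmorphM mulfV ?gt_eqF// scale1r.
by rewrite -scalerBr nrZ_ge0 ?ltW// mulrC -ltr_pdivlMr.
Qed.

Lemma totally_bounded_op_closed A :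
  (forall e : R, 0 < e -> exists2 B, totally_bounded_op B & nr (A - B) < e) ->
  totally_bounded_op A.
Proof.
move=> tA e e0; have e20 : 0 < e / 2 by rewrite divr_gt0.
have [B tB AB] := tA _ e20; have [s sP] := tB _ e20.
exists s => x x1; have [y ys Bxy] := sP x x1; exists y => //.
rewrite (le_lt_trans (nr_triangle (B x) _ _))// [ltRHS]splitr ltr_leD//.
  rewrite -[A x - B x]/((A - B) x) (le_lt_trans (ler_nr_bop _ _))//.
  by apply: le_lt_trans AB; rewrite ler_piMr ?nr_ge0.
exact: ltW.
Qed.

Lemma totally_bounded_op0 : totally_bounded_op 0.
Proof.
by move=> e e0; exists [:: 0] => x _; exists 0; rewrite ?inE// subrr nr0.
Qed.

Lemma compact_op_submod : submod_closed (mem [set A : bop E | compact_op A]).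
Proof.
split=> [|a A B]; rewrite -?topredE /= !inE /=.
  exact/compact_opP/totally_bounded_op0.
move=> /compact_opP tA /compact_opP tB; apply/compact_opP.
apply: totally_bounded_opD => //.
have -> : a *: A = (a *: (1 : bop E) : bop E) * (A : bop E) :> bop E.
  exact: bop_eqP.
exact: totally_bounded_opMl.
Qed.

Lemma compact_op_closed : closed [set A : bop E | compact_op A].
Proof.
move=> A /closure_nrP clA; apply/compact_opP/totally_bounded_op_closed.
by move=> e /clA[B /compact_opP tB AB]; exists B.
Qed.

End CompactOperators.

(** * Inequalities for real powers *)

Section PowerInequalities.
Variable R : realType.
Implicit Types (a b c p q r x y : R).

Lemma ler_powRr r a b : 0 <= r -> 0 <= a -> a <= b -> a `^ r <= b `^ r.
Proof.
move=> r0 a0 ab; apply: ge0_ler_powR => //; rewrite nnegrE//.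
exact: le_trans ab.
Qed.

Lemma ler_powR_root p a b : 0 < p -> 0 <= a -> 0 <= b ->
  a <= b `^ p -> a `^ p^-1 <= b.
Proof.
move=> p0 a0 b0 ab; rewrite -[leRHS](@powRr1 _ b)// -(@mulfV _ p) ?gt_eqF//.
by rewrite powRrM ler_powRr// invr_ge0 ltW.
Qed.

Lemma ler_powRV p a b : 0 < p -> 0 <= a -> a `^ p <= b -> a <= b `^ p^-1.
Proof.
move=> p0 a0 ab; rewrite -[leLHS]powRr1// -(@mulfV _ p) ?gt_eqF// powRrM.
by rewrite ler_powRr ?powR_ge0// invr_ge0 ltW.
Qed.

Lemma powR_le_ler p a b : 0 < p -> 0 <= a -> 0 <= b ->
  a `^ p <= b `^ p -> a <= b.
Proof.
move=> p0 a0 b0 /(ler_powR_root p0 (powR_ge0 _ _) b0).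
by rewrite -powRrM mulfV ?gt_eqF// powRr1.
Qed.

Lemma powR_invK p a : 0 < p -> 0 <= a -> (a `^ p^-1) `^ p = a.
Proof. by move=> p0 a0; rewrite -powRrM mulVf ?gt_eqF// powRr1. Qed.

Lemma ler_powR_superadd p a b : 1 <= p -> 0 <= a -> 0 <= b ->
  a `^ p + b `^ p <= (a + b) `^ p.
Proof.
move=> p1 a0 b0; have p0 : 0 < p by exact: lt_le_trans p1.
rewrite -!(@mulr_powRB1 _ _ p) ?addr_ge0// mulrDl.
by apply: lerD; rewrite ler_wpM2l// ler_powRr// ?subr_ge0// ?lerDl ?lerDr.
Qed.

Lemma ler_powRD p a b : 0 <= p -> 0 <= a -> 0 <= b ->
  (a + b) `^ p <= 2 `^ p * (a `^ p + b `^ p).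
Proof.
wlog ab : a b / a <= b => [wl p0 a0 b0|p0 a0 b0].
  have [ab|/ltW ba] := leP a b; first exact: wl.
  by rewrite addrC [X in _ * X]addrC; exact: wl.
rewrite (le_trans (y := (2 * b) `^ p))//.
  by rewrite ler_powRr ?addr_ge0// mulr_natl mulr2n lerD2r.
by rewrite powRM// ler_wpM2l ?powR_ge0// lerDr powR_ge0.
Qed.

(** The [p]-th root is Hoelder continuous of exponent [1/p]: an [l^1] bound on the
    oscillation of a partition becomes an [l^p] bound for the roots of its
    members. *)
Lemma ler_powR_rootB p a b : 1 <= p -> 0 <= a -> 0 <= b ->
  `|a `^ p^-1 - b `^ p^-1| `^ p <= `|a - b|.
Proof.
wlog ab : a b / b <= a => [wl p1 a0 b0|p1 a0 b0].
  have [ba|/ltW ab] := leP b a; first exact: wl.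
  by rewrite distrC [leRHS]distrC; exact: wl.
have p0 : 0 < p by exact: lt_le_trans p1.
have rab : b `^ p^-1 <= a `^ p^-1 by rewrite ler_powRr// invr_ge0 ltW.
rewrite !ger0_norm ?subr_ge0// lerBrDr.
rewrite -{2}(@powR_invK p b)// -{2}(@powR_invK p a)//.
apply: (le_trans (ler_powR_superadd _ _ _)); rewrite ?subr_ge0 ?powR_ge0//.
by rewrite subrK.
Qed.

Lemma cvgn_powR_pos p (u : nat -> R) (l : R) : 0 < l ->
  u @ \oo --> l -> (fun n => u n `^ p) @ \oo --> l `^ p.
Proof.
move=> l0 ul; apply: (@cvg_comp _ _ _ u (@powR R ^~ p) _ _ _ ul).
have /derivable1_diffP/differentiable_continuous : derivable (@powR R ^~ p) l 1.
  by apply: derivable_powR; rewrite in_itv/= l0.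
exact.
Qed.

Lemma cvgn_powR p (u : nat -> R) l : 0 < p -> (forall n, 0 <= u n) ->
  u @ \oo --> l -> (fun n => u n `^ p) @ \oo --> l `^ p.
Proof.
move=> p0 u0 ul.
have : 0 <= l by apply: (cvgr_to_ge ul); exact: nearW.
rewrite le_eqVlt => /predU1P[l0|l0]; last exact: cvgn_powR_pos.
rewrite -l0 powR0 ?gt_eqF//; apply/cvgrPdist_lt => e e0.
have e1 : 0 < e `^ p^-1 by exact: powR_gt0.
move: ul; rewrite -l0 => /cvgrPdist_lt/(_ _ e1); apply: filterS => n /=.
rewrite !sub0r !normrN !ger0_norm ?powR_ge0// => une.
by rewrite -[ltRHS](@powR_invK p)// ?gt0_ltr_powR// ?nnegrE// ltW.
Qed.

Lemma conjugate_exponent p : 1 < p ->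
  {q : R | 0 < q & p^-1 + q^-1 = 1}.
Proof.
move=> p1; have p0 : 0 < p by exact: lt_trans p1.
exists (1 - p^-1)^-1; last by rewrite invrK addrC subrK.
by rewrite invr_gt0 subr_gt0 invf_lt1.
Qed.

Lemma hoelder_sum p q (n : nat) (a b : nat -> R) :
  (forall i, 0 <= a i) -> (forall i, 0 <= b i) ->
  0 < p -> 0 < q -> p^-1 + q^-1 = 1 ->
  \sum_(i < n) a i * b i <=
    (\sum_(i < n) a i `^ p) `^ p^-1 * (\sum_(i < n) b i `^ q) `^ q^-1.
Proof.
move=> a0 b0 p0 q0 pq; elim: n => [|n IH].
  by rewrite big_ord0 mulr_ge0 ?powR_ge0.
have sa m : 0 <= \sum_(i < m) a i `^ p by apply: sumr_ge0 => i _; exact: powR_ge0.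
have sb m : 0 <= \sum_(i < m) b i `^ q by apply: sumr_ge0 => i _; exact: powR_ge0.
rewrite !big_ord_recr /=; move: IH (sa n) (sb n).
move: (\sum_(i < n) a i `^ p) (\sum_(i < n) b i `^ q) => A B IH A0 B0.
have := hoelder2 (powR_ge0 A p^-1) (a0 n) (powR_ge0 B q^-1) (b0 n) p0 q0 pq.
by rewrite !powR_invK//; apply: le_trans; rewrite lerD2r.
Qed.

(** Hoelder's inequality, arranged so that the weights [b] may be multipliers that
    sum pointwise to a bounded function. *)
Lemma powR_sum_le p q c (n : nat) (a b : nat -> R) :
  (forall i, 0 <= a i) -> (forall i, 0 <= b i) ->
  0 < p -> 0 < q -> p^-1 + q^-1 = 1 -> \sum_(i < n) b i `^ q <= c ->
  (\sum_(i < n) b i * a i) `^ p <= c `^ (p - 1) * \sum_(i < n) a i `^ p.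
Proof.
move=> a0 b0 p0 q0 pq bc.
have sa : 0 <= \sum_(i < n) a i `^ p by apply: sumr_ge0 => i _; exact: powR_ge0.
have sb : 0 <= \sum_(i < n) b i `^ q by apply: sumr_ge0 => i _; exact: powR_ge0.
under eq_bigr do rewrite mulrC.
have ab0 : 0 <= \sum_(i < n) a i * b i.
  by apply: sumr_ge0 => i _; exact: mulr_ge0.
apply: le_trans (ler_powRr (ltW p0) ab0 (hoelder_sum n a0 b0 p0 q0 pq)) _.
move: (\sum_(i < n) a i `^ p) (\sum_(i < n) b i `^ q) sa sb bc => A B A0 B0 Bc.
rewrite powRM ?powR_ge0// powR_invK// mulrC ler_wpM2r// -powRrM.
have qE : q^-1 = 1 - p^-1 by rewrite -pq addrC addKr.
rewrite qE mulrBl mul1r mulVf ?gt_eqF// ler_powRr// subr_ge0.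
by rewrite -invf_le1// -pq lerDl invr_ge0 ltW.
Qed.

End PowerInequalities.

(** * Complex-valued measurable functions *)

Section ComplexMeasurable.
Context d (T : measurableType d) (R : realType).

Lemma ReB (a b : R[i]) : complex.Re (a - b) = complex.Re a - complex.Re b.
Proof. by case: a b => ? ? []. Qed.

Lemma ImB (a b : R[i]) : complex.Im (a - b) = complex.Im a - complex.Im b.
Proof. by case: a b => ? ? []. Qed.

Lemma cmeasurableB (f g : T -> R[i]) : cmeasurable f -> cmeasurable g ->
  cmeasurable (fun x => f x - g x).
Proof.
move=> [fr fi] [gr gi]; split.
  by under eq_fun do rewrite ReB; exact: measurable_funB.
by under eq_fun do rewrite ImB; exact: measurable_funB.
Qed.

End ComplexMeasurable.

(** * The p-th power of the norm *)

Section LpNorm.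
Context d (T : measurableType d) (R : realType).
Variables (mu : {measure set T -> \bar R}) (p : R) (p1 : 1 < p).
Local Notation E := (cLspace mu (Lp_ge1 p1)).
Local Notation F := (cLfunType mu (Lp_ge1 p1)).
Implicit Types (f g : T -> R[i]) (u v : E).

Let p0 : 0 < p. Proof. exact: lt_trans p1. Qed.

(** The [p]-th power of the norm, as an integral: it adds up over disjointly
    supported functions and is the quantity to which monotone and dominated
    convergence apply. *)
Definition Lpow f : \bar R := (\int[mu]_x (cmod f x `^ p)%:E)%E.

Lemma measurable_Lpow f : cmeasurable f ->
  measurable_fun setT (fun x => (cmod f x `^ p)%:E).
Proof.
move=> mf; apply/measurable_EFinP.
apply: (measurableT_comp (measurable_powR _)).
exact: measurable_cmod.
Qed.

Lemma LpowE f : Lpow f = ('N[mu]_(p%:E)[EFin \o cmod f] `^ p)%E.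
Proof.
rewrite poweR_Lnorm; last by rewrite gt_eqF.
apply: eq_integral => x _.
by rewrite [(EFin \o _) x]/= abse_EFin ger0_norm ?cmod_ge0.
Qed.

Lemma nr_Lclass (f : F) : nr (Lclass f) = Lnorm_fun f.
Proof. by apply: (@complexI R); rewrite nrK cLspace_normE. Qed.

Lemma nr_Lpow (f : F) : ((nr (Lclass f) `^ p)%:E = Lpow f)%E.
Proof. by rewrite nr_Lclass LpowE -(Lnorm_funK f). Qed.

Lemma cLfun_Lpow f : cmeasurable f -> (Lpow f < +oo)%E ->
  f \in cLfun mu (Lp_ge1 p1).
Proof.
move=> mf ff; apply/cLfunP; split=> //; rewrite /finite_norm.
have := ff; rewrite LpowE; case: ('N[mu]_(p%:E)[_])%E (Lnorm_ge0 mu p%:E (EFin \o cmod f)) => //=.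
  by move=> r _ _; rewrite ltry.
by rewrite gt_eqF.
Qed.

Lemma cLfun_exists f : cmeasurable f -> (Lpow f < +oo)%E ->
  exists f' : F, f' = f :> (T -> R[i]).
Proof. by move=> mf ff; exists (CLfun (cLfun_Lpow mf ff)). Qed.

Lemma Lpow_lty (f : F) : (Lpow f < +oo)%E.
Proof. by rewrite -nr_Lpow ltry. Qed.

Lemma le_Lpow f g : cmeasurable f -> cmeasurable g ->
  (\forall x \ae mu, cmod f x <= cmod g x) -> (Lpow f <= Lpow g)%E.
Proof.
move=> mf mg fg; apply: ae_ge0_le_integral => //.
- by move=> x _; rewrite lee_fin powR_ge0.
- exact: measurable_Lpow.
- by move=> x _; rewrite lee_fin powR_ge0.
- exact: measurable_Lpow.
apply: filterS fg => x fg _; rewrite lee_fin ler_powRr ?cmod_ge0//.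
exact: ltW.
Qed.

Lemma normc_real (a : R) : Normc.normc a%:C = `|a|.
Proof. by rewrite /= expr0n addr0 sqrtr_sqr. Qed.

Lemma cmod_real (h : T -> R) x : cmod (fun x => (h x)%:C) x = `|h x|.
Proof. exact: normc_real. Qed.

End LpNorm.

(** * Multiplication by bounded real functions *)

Section RealMultipliers.
Context d (T : measurableType d) (R : realType).
Variables (mu : {measure set T -> \bar R}) (p : R) (p1 : 1 < p).
Local Notation E := (cLspace mu (Lp_ge1 p1)).
Local Notation F := (cLfunType mu (Lp_ge1 p1)).
Implicit Types (g h : T -> R) (u v : E).

Let p0 : 0 < p. Proof. exact: lt_trans p1. Qed.

(** Bounded everywhere and not only almost everywhere: the multipliers below are
    explicit functions, and pointwise identities between them then hold without
    null sets. *)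
Definition bmfun g := measurable_fun setT g /\ exists C : R, forall x, `|g x| <= C.

Lemma bmfun_cLinfty g : bmfun g -> (fun x => (g x)%:C) \in cLfun mu (leey 1%E).
Proof.
move=> [mg [C gC]].
have cE : cmod (fun x => (g x)%:C) = Num.norm \o g.
  by apply/funext => x; rewrite cmod_real.
apply/cLfunP; split; first by split; [exact: mg|exact: measurable_cst].
rewrite /finite_norm cE.
have N1 : ('N[mu]_+oo[EFin \o (cst C : T -> R)] < +oo)%E.
  rewrite unlock /Lnorm; case: ifPn => [mu0|_]; last exact: ltry.
  rewrite (_ : _ \o _ = cst `|C|%:E) ?ess_sup_cst ?ltry//.
apply: (le_lt_trans _ N1); apply: le_Lnorm; [by rewrite leey| |exact: measurable_cst|].
  exact: measurableT_comp.
by apply/nearW => x; rewrite normr_id (le_trans (gC x))// ler_norm.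
Qed.

(** Total in [g], with value 0 outside the bounded measurable functions, so that
    multipliers can be indexed by functions without carrying proofs. *)
Definition Mr g : bop E :=
  match pselect (bmfun g) with
  | left bg => mulop (Lp_ge1 p1) (CLfun (bmfun_cLinfty bg))
  | right _ => 0
  end.

Lemma Mr_class g (f : F) : bmfun g ->
  exists2 f' : F, Mr g (Lclass f) = Lclass f' & forall x, f' x = (g x)%:C * f x.
Proof.
move=> bg; rewrite /Mr; case: pselect => // {}bg.
by exists (mul_cLfun (CLfun (bmfun_cLinfty bg)) f); rewrite //= mulop_class.
Qed.

Lemma mulop_cindicE (K : set T) (mK : measurable K) :
  mulop (Lp_ge1 p1) (cindic mu mK) = Mr \1_K.
Proof.
apply: bop_eqP => u; rewrite -[u]LclassK.
have bK : bmfun (\1_K : T -> R).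
  split; first exact: measurable_indic.
  by exists 1 => x; rewrite indicE; case: (_ \in _); rewrite ?normr1 ?normr0.
have [f' -> f'E] := Mr_class (Lrepr u) bK.
by rewrite [LHS]mulop_class; congr Lclass; apply/val_inj/funext => x /=; rewrite f'E.
Qed.

Lemma bmfun_indic (K : set T) : measurable K -> bmfun (\1_K : T -> R).
Proof.
split; first exact: measurable_indic.
by exists 1 => x; rewrite indicE; case: (_ \in _); rewrite ?normr1 ?normr0.
Qed.

Lemma bmfun_cst (c : R) : bmfun (cst c : T -> R).
Proof. by split; [exact: measurable_cst|exists `|c|]. Qed.

Lemma bmfunD g h : bmfun g -> bmfun h -> bmfun (g \+ h).
Proof.
move=> [mg [C gC]] [mh [D hD]]; split; first exact: measurable_funD.
by exists (C + D) => x; rewrite (le_trans (ler_normD _ _))// lerD.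
Qed.

Lemma bmfunB g h : bmfun g -> bmfun h -> bmfun (g \- h).
Proof.
move=> [mg [C gC]] [mh [D hD]]; split; first exact: measurable_funB.
by exists (C + D) => x; rewrite (le_trans (ler_normB _ _))// lerD.
Qed.

Lemma bmfunM g h : bmfun g -> bmfun h -> bmfun (g \* h).
Proof.
move=> [mg [C gC]] [mh [D hD]]; split; first exact: measurable_funM.
by exists (C * D) => x; rewrite normrM ler_pM.
Qed.

Lemma bmfun_sum (I : Type) (r : seq I) (G : I -> T -> R) :
  (forall i, bmfun (G i)) -> bmfun (fun x => \sum_(i <- r) G i x).
Proof.
move=> bG; elim: r => [|i r IH].
  by rewrite (_ : (fun x => _) = cst 0); [exact: bmfun_cst|apply/funext => x; rewrite big_nil].
rewrite (_ : (fun x => _) = G i \+ (fun x => \sum_(j <- r) G j x)); last first.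
  by apply/funext => x; rewrite big_cons.
exact: bmfunD.
Qed.

Lemma MrM g h : bmfun g -> bmfun h -> Mr g * Mr h = Mr (g \* h).
Proof.
move=> bg bh; apply: bop_eqP => u; rewrite -[u]LclassK bopME.
have [f1 -> f1E] := Mr_class (Lrepr u) bh; have [f2 -> f2E] := Mr_class f1 bg.
have [f3 -> f3E] := Mr_class (Lrepr u) (bmfunM bg bh).
congr Lclass; apply/val_inj/funext => x.
by rewrite /= f2E f1E f3E mulrA -rmorphM.
Qed.

Lemma MrMC g h : bmfun g -> bmfun h -> Mr g * Mr h = Mr h * Mr g.
Proof.
move=> bg bh; rewrite !MrM//; congr Mr.
by apply/funext => x; rewrite /= mulrC.
Qed.

Lemma MrD g h : bmfun g -> bmfun h -> Mr g + Mr h = Mr (g \+ h).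
Proof.
move=> bg bh; apply: bop_eqP => u; rewrite -[u]LclassK bopDE.
have [f1 -> f1E] := Mr_class (Lrepr u) bh.
have [f2 -> f2E] := Mr_class (Lrepr u) bg.
have [f3 -> f3E] := Mr_class (Lrepr u) (bmfunD bg bh).
rewrite -LclassD; congr Lclass; apply/val_inj/funext => x.
change (f2 x + f1 x = f3 x).
by rewrite f2E f1E f3E -mulrDl -rmorphD.
Qed.

Lemma Mr_cst (c : R) u : Mr (cst c) u = c%:C *: u.
Proof.
rewrite -[u]LclassK.
have [f1 -> f1E] := Mr_class (Lrepr u) (bmfun_cst c).
rewrite -[c%:C *: _]LclassZ; congr Lclass; apply/val_inj/funext => x.
by rewrite /= f1E.
Qed.

Lemma Mr1 : Mr (cst 1) = 1.
Proof. by apply: bop_eqP => u; rewrite Mr_cst scale1r. Qed.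

Lemma Mr0 : Mr (cst 0) = 0.
Proof. by apply: bop_eqP => u; rewrite Mr_cst scale0r. Qed.

Lemma MrB g h : bmfun g -> bmfun h -> Mr g - Mr h = Mr (g \- h).
Proof.
move=> bg bh; apply/eqP; rewrite subr_eq MrD//; last exact: bmfunB.
by apply/eqP; congr Mr; apply/funext => x; rewrite /= subrK.
Qed.

Lemma Mr_sum (I : Type) (r : seq I) (G : I -> T -> R) :
  (forall i, bmfun (G i)) ->
  \sum_(i <- r) Mr (G i) = Mr (fun x => \sum_(i <- r) G i x).
Proof.
move=> bG; elim: r => [|i r IH].
  rewrite big_nil -Mr0; congr Mr.
  by apply/funext => x; rewrite big_nil.
rewrite big_cons IH MrD//; last exact: bmfun_sum.
by congr Mr; apply/funext => x; rewrite big_cons.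
Qed.

End RealMultipliers.
Arguments Mr {d T R mu p p1} g.

(** * Norm estimates for families of multipliers *)

Section MultiplierEstimates.
Context d (T : measurableType d) (R : realType).
Variables (mu : {measure set T -> \bar R}) (p : R) (p1 : 1 < p).
Local Notation E := (cLspace mu (Lp_ge1 p1)).
Local Notation F := (cLfunType mu (Lp_ge1 p1)).
Implicit Types (g h : T -> R) (G : nat -> T -> R) (u v : E).

Let p0 : 0 < p. Proof. exact: lt_trans p1. Qed.

Lemma Lclass_sum (n : nat) (f : nat -> F) :
  \sum_(i < n) Lclass (f i) = Lclass (\sum_(i < n) f i).
Proof.
elim: n => [|n IH]; last by rewrite !big_ord_recr /= IH LclassD.
by rewrite !big_ord0; apply: (addrI (Lclass 0)); rewrite -LclassD !addr0.
Qed.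

Lemma cLfun_sumE (n : nat) (f : nat -> F) x :
  (\sum_(i < n) f i) x = \sum_(i < n) f i x.
Proof.
elim: n => [|n IH]; first by rewrite !big_ord0.
by rewrite !big_ord_recr /= -IH.
Qed.

Lemma ler_cmod_sum (n : nat) (z : nat -> R[i]) :
  Normc.normc (\sum_(i < n) z i) <= \sum_(i < n) Normc.normc (z i).
Proof.
elim: n => [|n IH]; first by rewrite !big_ord0 Normc.normc0.
by rewrite !big_ord_recr /= (le_trans (le_normcD _ _))// lerD2r.
Qed.

Lemma sum_nr_powE (n : nat) (f : nat -> F) :
  ((\sum_(i < n) nr (Lclass (f i)) `^ p)%:E =
   \int[mu]_x (\sum_(i < n) cmod (f i) x `^ p)%:E)%E.
Proof.
under eq_integral do rewrite -sumEFin.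
rewrite ge0_integral_sum//.
- by rewrite -sumEFin; apply: eq_bigr => i _; rewrite nr_Lpow.
- by move=> i; apply: measurable_Lpow; exact: cLfun_measurable.
- by move=> i x _; rewrite lee_fin powR_ge0.
Qed.

(** Integration of the pointwise bound: cutting [u] into pieces costs at most the
    supremum of the sum of the [p]-th powers of the weights. *)
Lemma sum_nr_Mr (n : nat) G u (c : R) : (forall i, bmfun (G i)) ->
  (forall x, \sum_(i < n) `|G i x| `^ p <= c) ->
  \sum_(i < n) nr (Mr (G i) u) `^ p <= c * nr u `^ p.
Proof.
move=> bG Gc; rewrite -[u]LclassK; set f := Lrepr u.
have /choice[f' f'P] : forall i, exists f' : F,
    Mr (G i) (Lclass f) = Lclass f' /\ forall x, f' x = (G i x)%:C * f x.
  by move=> i; have [f' ? ?] := Mr_class f (bG i); exists f'.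
under eq_bigr do rewrite (f'P _).1.
have c0 (x : T) : 0 <= c.
  by apply: le_trans (Gc x); apply: sumr_ge0 => i _; exact: powR_ge0.
have mf : measurable_fun setT (fun x => (cmod f x `^ p)%:E).
  by apply: measurable_Lpow; exact: cLfun_measurable.
rewrite -lee_fin sum_nr_powE EFinM nr_Lpow.
have [T0|[t0 _]] : [set: T] = set0 \/ [set: T] !=set0.
  by have [->|/set0P] := eqVneq [set: T] set0; [left|right].
  by rewrite /Lpow T0 !integral_set0 mule0.
rewrite -ge0_integralZl_EFin//; last 2 first.
- by move=> x _; rewrite lee_fin powR_ge0.
- exact: c0 t0.
apply: ge0_le_integral => //.
- by move=> x _; rewrite lee_fin sumr_ge0// => i _; exact: powR_ge0.
- apply/measurable_EFinP/measurable_sum => i.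
  by apply/measurable_EFinP/measurable_Lpow/cLfun_measurable.
- apply/measurable_EFinP/measurable_funM; first exact: measurable_cst.
  exact/measurable_EFinP.
move=> x _; rewrite lee_fin.
rewrite (eq_bigr (fun i : 'I_n => `|G i x| `^ p * cmod f x `^ p)); last first.
  move=> i _; rewrite -powRM ?cmod_ge0// /cmod (f'P i).2 Normc.normcM.
  by rewrite normc_real.
by rewrite -mulr_suml ler_wpM2r ?powR_ge0.
Qed.

Lemma nr_Mr g u (c : R) : bmfun g -> 0 <= c -> (forall x, `|g x| <= c) ->
  nr (Mr g u) <= c * nr u.
Proof.
move=> bg c0 gc.
have := @sum_nr_Mr 1 (fun=> g) u (c `^ p) (fun=> bg).
rewrite big_ord_recr big_ord0 /= add0r -powRM ?nr_ge0// => h.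
apply: (powR_le_ler p0); rewrite ?mulr_ge0 ?nr_ge0//.
by apply: h => x; rewrite big_ord_recr big_ord0 /= add0r ler_powRr// ltW.
Qed.

(** The dual estimate, for gluing pieces together; pointwise it is
    [powR_sum_le]. *)
Lemma nr_sum_Mr (q : R) (n : nat) G (v : nat -> E) (c : R) :
  0 < q -> p^-1 + q^-1 = 1 ->
  (forall i, bmfun (G i)) -> (forall i x, 0 <= G i x) ->
  (forall x, \sum_(i < n) G i x `^ q <= c) ->
  nr (\sum_(i < n) Mr (G i) (v i)) `^ p <=
    c `^ (p - 1) * \sum_(i < n) nr (v i) `^ p.
Proof.
move=> q0 pq bG G0 Gc; pose f i := Lrepr (v i).
have /choice[f' f'P] : forall i, exists f' : F,
    Mr (G i) (v i) = Lclass f' /\ forall x, f' x = (G i x)%:C * f i x.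
  by move=> i; have [f'] := Mr_class (f i) (bG i); rewrite LclassK; exists f'.
under eq_bigr do rewrite (f'P _).1.
have mf i : measurable_fun setT (fun x => cmod (f i) x `^ p).
  by apply/measurable_EFinP/measurable_Lpow/cLfun_measurable.
have vE : \sum_(i < n) nr (v i) `^ p = \sum_(i < n) nr (Lclass (f i)) `^ p.
  by apply: eq_bigr => i _; rewrite LclassK.
rewrite Lclass_sum vE -lee_fin nr_Lpow EFinM sum_nr_powE.
rewrite -ge0_integralZl_EFin//; last 3 first.
- by move=> x _; rewrite lee_fin sumr_ge0// => i _; exact: powR_ge0.
- exact/measurable_EFinP/measurable_sum.
- exact: powR_ge0.
apply: ge0_le_integral => //.
- by move=> x _; rewrite lee_fin powR_ge0.
- exact/measurable_Lpow/cLfun_measurable.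
- apply/measurable_EFinP/measurable_funM; first exact: measurable_cst.
  exact/measurable_sum.
move=> x _; rewrite lee_fin /cmod cLfun_sumE.
have -> : \sum_(i < n) f' i x = \sum_(i < n) (G i x)%:C * f i x.
  by apply: eq_bigr => i _; rewrite (f'P i).2.
have h := @powR_sum_le R p q c n (fun i => cmod (f i) x) (fun i => G i x)
  (fun i => cmod_ge0 (f i) x) (fun i => G0 i x) p0 q0 pq (Gc x).
apply: le_trans h; apply: ler_powRr; [exact: ltW|exact: (cmod_ge0 (fun=> _) x)|].
rewrite (le_trans (ler_cmod_sum _ (fun i => (G i x)%:C * f i x)))//.
apply: ler_sum => i _; rewrite Normc.normcM.
by rewrite normc_real ger0_norm.
Qed.

(** Dominated convergence. The convergence is only strong: the multipliers need not
    tend to 0 uniformly. *)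
Lemma Mr_nrcvg0 G u (c : R) : (forall n, bmfun (G n)) ->
  (forall n x, `|G n x| <= c) -> (forall x, G n x @[n --> \oo] --> (0 : R)) ->
  nrcvg (fun n => Mr (G n) u) 0.
Proof.
move=> bG Gc G0; rewrite -[u]LclassK; set f := Lrepr u.
have /choice[f' f'P] : forall i, exists f' : F,
    Mr (G i) (Lclass f) = Lclass f' /\ forall x, f' x = (G i x)%:C * f x.
  by move=> i; have [f' ? ?] := Mr_class f (bG i); exists f'.
have f'E n x : cmod (f' n) x = `|G n x| * cmod f x.
  rewrite /cmod (f'P n).2 Normc.normcM.
  by rewrite normc_real.
have mf : measurable_fun setT (fun x => (cmod f x `^ p)%:E).
  by apply: measurable_Lpow; exact: cLfun_measurable.
have cn0 (x : T) : 0 <= c by exact: le_trans (Gc 0%N x).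
have ig : mu.-integrable setT (fun x => (c `^ p * cmod f x `^ p)%:E).
  have : mu.-integrable setT (fun x => (cmod f x `^ p)%:E).
    apply/integrableP; split => //.
    under eq_integral do rewrite gee0_abs ?lee_fin ?powR_ge0//.
    exact: (Lpow_lty f).
  by move=> /(integrableZl measurableT (c `^ p)).
have mf_ n : measurable_fun setT (fun x => (cmod (f' n) x `^ p)%:E).
  exact/measurable_Lpow/cLfun_measurable.
have m0 : measurable_fun setT (fun _ : T => 0%E : \bar R) by exact: measurable_cst.
have fcv : {ae mu, forall x, setT x ->
    (cmod (f' n) x `^ p)%:E @[n --> \oo] --> (0%E : \bar R)}.
  apply/nearW => x _; apply/cvg_EFin; first exact: nearW.
  rewrite -(@powR0 R p) ?gt_eqF//; apply: cvgn_powR => //.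
    by move=> n; exact: cmod_ge0.
  under eq_fun do rewrite f'E.
  rewrite -(mul0r (cmod f x)); apply: cvgMl.
  by rewrite -(normr0 R); apply: cvg_norm.
have fdom : {ae mu, forall x n, setT x ->
    (`|(cmod (f' n) x `^ p)%:E| <= (c `^ p * cmod f x `^ p)%:E)%E}.
  apply/nearW => x n _.
  rewrite gee0_abs ?lee_fin ?powR_ge0// f'E powRM ?cmod_ge0//.
  by rewrite ler_wpM2r ?powR_ge0// ler_powRr// ltW.
have [_ _] := dominated_convergence measurableT mf_ m0 fcv ig fdom.
rewrite integral0 => h e e0.
have {}h : (nr (Mr (G n) (Lclass f)) `^ p)%:E @[n --> \oo] --> (0%E : \bar R).
  by under eq_fun do rewrite (f'P _).1 nr_Lpow; exact: h.
have {}h : nr (Mr (G n) (Lclass f)) `^ p @[n --> \oo] --> (0 : R).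
  exact: fine_cvg h.
have [n0 _ n0P] := (cvgrPdist_lt _ _).1 h (e `^ p) (powR_gt0 _ e0).
exists n0 => n /n0P /=; rewrite sub0r normrN ger0_norm ?powR_ge0// subr0.
by move=> lte; rewrite ltNge; apply/negP => /(ler_powRr (ltW p0) (ltW e0)); rewrite leNgt lte.
Qed.

Lemma Mr_nrcvg1 G u (c : R) : (forall n, bmfun (G n)) ->
  (forall n x, `|1 - G n x| <= c) -> (forall x, G n x @[n --> \oo] --> (1 : R)) ->
  nrcvg (fun n => Mr (G n) u) u.
Proof.
move=> bG Gc G1.
have b1 : bmfun (cst 1 : T -> R) by exact: bmfun_cst.
have G1' x : (cst 1 \- G n) x @[n --> \oo] --> (0 : R).
  by rewrite -[X in _ --> X](subrr 1); apply: cvgB; [exact: cvg_cst|exact: G1].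
have h := @Mr_nrcvg0 (fun n => cst 1 \- G n) u c (fun n => bmfunB b1 (bG n)) Gc G1'.
move=> e /h[n0 n0P]; exists n0 => n /n0P.
by rewrite subr0 -MrB// Mr1 nrBC.
Qed.

Lemma bop_sumE (I : Type) (r : seq I) (A : I -> bop E) u :
  (\sum_(i <- r) A i) u = \sum_(i <- r) A i u.
Proof.
elim: r => [|i r IH]; first by rewrite !big_nil.
by rewrite !big_cons -IH.
Qed.

End MultiplierEstimates.

(** * Completeness of the L^p spaces *)

Section Completeness.
Context d (T : measurableType d) (R : realType).
Variables (mu : {measure set T -> \bar R}) (p : R) (p1 : 1 < p).
Local Notation E := (cLspace mu (Lp_ge1 p1)).
Local Notation F := (cLfunType mu (Lp_ge1 p1)).
Implicit Types (u v : E).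

Let p0 : 0 < p. Proof. exact: lt_trans p1. Qed.

Lemma LclassB (f g : F) : Lclass (f - g) = Lclass f - Lclass g.
Proof. by apply/eqP; rewrite eq_sym subr_eq -LclassD subrK. Qed.

Lemma sum_half_le (n : nat) : \sum_(k < n) (2^-1 : R) ^+ k <= 2.
Proof.
rewrite (@le_trans _ _ (2 - 2 * 2^-1 ^+ n))//.
  elim: n => [|n IH]; first by rewrite big_ord0 expr0; lra.
  rewrite big_ord_recr /= exprS mulrA divff// mul1r.
  by move: (_ ^+ n) IH => y; lra.
by rewrite gerBl mulr_ge0// exprn_ge0// invr_ge0.
Qed.

(** A real sequence of bounded variation converges, its telescoping series being
    absolutely convergent. *)
Lemma cvgn_of_summable_steps (z s : nat -> R) (M : R) :
  (forall k, `|z k.+1 - z k| <= s k) -> (forall n, \sum_(k < n) s k <= M) ->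
  cvgn z.
Proof.
move=> zs sM; have s0 k : 0 <= s k by exact: le_trans (zs k).
have cs : cvgn (series s).
  apply: nondecreasing_is_cvgn.
    by apply/nondecreasing_seqP => n; rewrite seriesSr lerDl.
  by exists M => _ [n _ <-]; rewrite seriesEord; exact: sM.
have ct : cvgn (series (telescope z)).
  apply: normed_cvg; apply: series_le_cvg cs => // n; exact: normr_ge0.
rewrite (_ : z = cst (z 0%N) \+ series (telescope z)).
  by apply: is_cvgD => //; exact: is_cvg_cst.
by rewrite telescopeK; apply/funext => n /=; rewrite addrC subrK.
Qed.

Lemma normc_Re (z : R[i]) : `|complex.Re z| <= Normc.normc z.
Proof.
by case: z => a b /=; rewrite -sqrtr_sqr ler_wsqrtr// lerDl sqr_ge0.
Qed.

Lemma normc_Im (z : R[i]) : `|complex.Im z| <= Normc.normc z.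
Proof.
by case: z => a b /=; rewrite -sqrtr_sqr ler_wsqrtr// lerDr sqr_ge0.
Qed.

Lemma normc_le_ReIm (z : R[i]) :
  Normc.normc z <= `|complex.Re z| + `|complex.Im z|.
Proof.
case: z => a b /=; rewrite -[leRHS]ger0_norm ?addr_ge0// -sqrtr_sqr.
rewrite ler_wsqrtr// sqrrD !real_normK ?num_real// addrAC lerDl.
by rewrite mulrn_wge0// mulr_ge0.
Qed.

Lemma cvg_normc (z : nat -> R[i]) (w : R[i]) :
  complex.Re (z n) @[n --> \oo] --> complex.Re w ->
  complex.Im (z n) @[n --> \oo] --> complex.Im w ->
  Normc.normc (z n) @[n --> \oo] --> Normc.normc w.
Proof.
case: w => a b /= za zb.
rewrite (_ : (fun n => _) =
    (fun n => Num.sqrt (complex.Re (z n) ^+ 2 + complex.Im (z n) ^+ 2))); last first.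
  by apply/funext => n; case: (z n).
have zab : complex.Re (z n) ^+ 2 + complex.Im (z n) ^+ 2 @[n --> \oo] -->
    a ^+ 2 + b ^+ 2.
  by apply: cvgD; apply: cvgM.
exact: (cvg_comp _ _ zab (@sqrt_continuous R _)).
Qed.

(** The sums of the increments are bounded in norm by the geometric series, so by
    monotone convergence the sum of their moduli is finite almost everywhere. *)
Lemma Lp_rapid_cvg_ae (f : nat -> F) :
  (forall k, nr (Lclass (f k.+1) - Lclass (f k)) <= 2^-1 ^+ k) ->
  exists2 N, measurable N & mu N = 0%E /\ forall x, ~ N x ->
    cvgn (fun n => complex.Re (f n x)) /\ cvgn (fun n => complex.Im (f n x)).
Proof.
move=> fC; pose s k x := cmod (f k.+1 - f k) x.
have ms k : measurable_fun setT (s k).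
  exact/measurable_cmod/cLfun_measurable.
have /choice[a aE] : forall k, exists a : F, forall x, a x = (s k x)%:C.
  move=> k; have [||a aE] := @cLfun_exists _ _ _ mu _ p1 (fun x => (s k x)%:C).
  - by split => /=; [exact: ms|exact: measurable_cst].
  - apply: le_lt_trans (Lpow_lty (f k.+1 - f k)); rewrite le_eqVlt; apply/orP; left.
    apply/eqP/eq_integral => x _; congr (_ `^ _)%:E.
    by rewrite cmod_real ger0_norm// cmod_ge0.
  by exists a => x; rewrite aE.
pose S n x := \sum_(k < n) s k x.
have SE n x : cmod (\sum_(k < n) a k) x = S n x.
  rewrite /cmod cLfun_sumE (eq_bigr (fun k : 'I_n => (s k x)%:C)) => [|i _//].
  rewrite -rmorph_sum normc_real ger0_norm//.
  by apply: sumr_ge0 => i _; exact: cmod_ge0.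
have S0 n x : 0 <= S n x by rewrite -SE cmod_ge0.
pose h n x : \bar R := (S n x `^ p)%:E.
have mh n : measurable_fun setT (h n).
  apply/measurable_EFinP/(measurableT_comp (measurable_powR _)).
  exact: measurable_sum.
have h0 n x : (0 <= h n x)%E by rewrite lee_fin powR_ge0.
have ndh x : {homo h ^~ x : m n / (m <= n)%N >-> (m <= n)%E}.
  apply/nondecreasing_seqP => n; rewrite lee_fin ler_powRr//; first exact: ltW.
  by rewrite /S big_ord_recr /= lerDl cmod_ge0.
have ih n : (\int[mu]_x h n x <= (2 `^ p)%:E)%E.
  have -> : (\int[mu]_x h n x = Lpow mu p (\sum_(k < n) a k)%R)%E.
    by apply: eq_integral => x _; rewrite SE.
  rewrite -nr_Lpow lee_fin ler_powRr ?nr_ge0//; first exact: ltW.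
  rewrite -Lclass_sum (le_trans (ler_nr_sum _ _ _))//.
  apply: le_trans (sum_half_le n); apply: ler_sum => k _.
  apply: le_trans (fC k); rewrite -LclassB.
  apply: (powR_le_ler p0); rewrite ?nr_ge0//.
  rewrite -lee_fin !nr_Lpow; apply: le_Lpow; [exact: p1|exact: cLfun_measurable|exact: cLfun_measurable|].
  apply/nearW => x; rewrite [leLHS](_ : _ = s k x)//.
  by rewrite /cmod aE normc_real ger0_norm// cmod_ge0.
have mc := monotone_convergence mu measurableT mh (fun n x _ => h0 n x)
  (fun x _ => @ndh x).
have ch x : cvgn (h ^~ x) by exact: ereal_nondecreasing_is_cvgn.
have lim0 x : (0 <= limn (h ^~ x))%E by apply: lime_ge => //; exact: nearW.
have ilim : mu.-integrable setT (fun x => limn (h ^~ x)).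
  apply/integrableP; split.
    apply: (emeasurable_fun_cvg h); first exact: mh.
    by move=> x _; exact: ch.
  under eq_integral do rewrite gee0_abs//.
  rewrite mc; apply: (@le_lt_trans _ _ (2 `^ p)%:E); last exact: ltry.
  apply: lime_le; last exact: nearW.
  apply: ereal_nondecreasing_is_cvgn => m n mn.
  by apply: ge0_le_integral => // x _; exact: ndh.
have [N [mN N0 NP]] := integrable_ae measurableT ilim.
exists N => //; split => // x Nx.
have {Nx} : limn (h ^~ x) \is a fin_num.
  by apply: contrapT => hx; apply: Nx; apply: NP => /= /(_ I).
have hl n : (h n x <= limn (h ^~ x))%E.
  by apply: lime_ge => //; exists n => // m /= nm; exact: ndh.
case: (limn _) hl => // l hl _.
have Sl n : S n x <= l `^ p^-1.
  by apply: ler_powRV => //; have := hl n; rewrite lee_fin.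
split; apply: (@cvgn_of_summable_steps _ (s ^~ x) _ _ Sl) => k.
  apply: le_trans (normc_Re _); rewrite (_ : (f k.+1 - f k) x = f k.+1 x - f k x)//.
  by case: (f k.+1 x) (f k x) => ? ? [].
apply: le_trans (normc_Im _); rewrite (_ : (f k.+1 - f k) x = f k.+1 x - f k x)//.
by case: (f k.+1 x) (f k x) => ? ? [].
Qed.

(** Riesz-Fischer: a rapidly Cauchy subsequence converges almost everywhere, and
    Fatou's lemma bounds the distance from [u n] to the limit. *)
Theorem Lp_complete : nrcomplete E.
Proof.
move=> u cu.
have /choice[N0 N0P] : forall k : nat, exists n0, forall n m,
    (n0 <= n)%N -> (n0 <= m)%N -> nr (u n - u m) < (2^-1 : R) ^+ k.
  by move=> k; apply: cu; rewrite exprn_gt0 ?invr_gt0.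
pose phi k := \max_(i < k.+1) maxn (N0 i) i.
have phiN k i : (i <= k)%N -> (maxn (N0 i) i <= phi k)%N.
  by move=> ik; exact: (leq_bigmax (Ordinal (ik : (i < k.+1)%N))).
have phik k : (k <= phi k)%N by rewrite (leq_trans _ (phiN k k _))// leq_maxr.
pose f n := Lrepr (u n).
have [|N mN [muN0 NP]] := @Lp_rapid_cvg_ae (f \o phi).
  move=> k /=; rewrite !LclassK; apply/ltW/N0P.
    by rewrite (leq_trans _ (phiN _ k _))// leq_maxl.
  by rewrite (leq_trans _ (phiN _ k _))// leq_maxl.
have mNc : measurable (~` N) by exact: measurableC.
pose hR n : T -> R := (fun x => complex.Re (f (phi n) x)) \_ (~` N).
pose hI n : T -> R := (fun x => complex.Im (f (phi n) x)) \_ (~` N).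
have mR n : measurable_fun setT (hR n).
  apply/(measurable_restrictT _ _).1 => //.
  by apply: measurable_funTS; exact: (cLfun_measurable (f (phi n))).1.
have mI n : measurable_fun setT (hI n).
  apply/(measurable_restrictT _ _).1 => //.
  by apply: measurable_funTS; exact: (cLfun_measurable (f (phi n))).2.
have cR x : cvgn (hR ^~ x).
  have -> : hR ^~ x = if x \in ~` N then fun n => complex.Re (f (phi n) x)
      else cst 0.
    by apply/funext => n; rewrite /hR /patch; case: ifP.
  case: ifPn => [/set_mem xN|_]; last exact: is_cvg_cst.
  exact: (NP x xN).1.
have cI x : cvgn (hI ^~ x).
  have -> : hI ^~ x = if x \in ~` N then fun n => complex.Im (f (phi n) x)
      else cst 0.
    by apply/funext => n; rewrite /hI /patch; case: ifP.
  case: ifPn => [/set_mem xN|_]; last exact: is_cvg_cst.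
  exact: (NP x xN).2.
pose g x : R[i] := limn (hR ^~ x) +i* limn (hI ^~ x).
have mg : cmeasurable g.
  split; first by apply: (measurable_fun_cvg mR) => x _; exact: cR.
  by apply: (measurable_fun_cvg mI) => x _; exact: cI.
have mfg n : cmeasurable (fun x => f n x - g x).
  by apply: cmeasurableB => //; exact: cLfun_measurable.
have key n (e : R) l0 : 0 <= e -> (forall l, (l0 <= l)%N -> nr (u n - u l) <= e) ->
    (Lpow mu p (fun x => f n x - g x)%R <= (e `^ p)%:E)%E.
  move=> e0 ne.
  pose H l x : \bar R := (cmod (fun x => f n x - (hR l x +i* hI l x)) x `^ p)%:E.
  have mH l : measurable_fun setT (H l).
    apply: measurable_Lpow; apply: cmeasurableB; first exact: cLfun_measurable.
    by split; [exact: mR|exact: mI].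
  have H0 l x : setT x -> (0 <= H l x)%E by move=> _; rewrite lee_fin powR_ge0.
  have Hlim x : limn_einf (H ^~ x) = (cmod (fun x => f n x - g x) x `^ p)%:E.
    apply: (cvg_limn_einf_sup _).1; apply/cvg_EFin; first exact: nearW.
    apply: cvgn_powR => //; first by move=> l; exact: cmod_ge0.
    apply: cvg_normc.
      under eq_fun do rewrite ReB; rewrite ReB.
      by apply: cvgB; [exact: cvg_cst|exact: cR].
    under eq_fun do rewrite ImB; rewrite ImB.
    by apply: cvgB; [exact: cvg_cst|exact: cI].
  have := fatou mu measurableT mH H0.
  rewrite /Lpow; under eq_integral do rewrite Hlim.
  move=> /le_trans; apply.
  have Hn l : (\int[mu]_x H l x = (nr (u n - u (phi l)) `^ p)%:E)%E.
    rewrite -[u n]LclassK -[u (phi l)]LclassK -LclassB nr_Lpow.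
    apply: ae_eq_integral; [exact: measurableT|exact: mH| |].
      exact/measurable_Lpow/cLfun_measurable.
    exists N; split => // x /= Hx; apply: contrapT => xN; apply: Hx => _.
    rewrite /H /cmod /hR /hI /patch mem_set//; congr (Normc.normc _ `^ _)%:E.
    by transitivity (f n x - f (phi l) x); first by case: (f (phi l) x).
  rewrite limn_einf_lim; apply: lime_le.
    exact: is_cvg_einfs.
  exists l0 => // l /= l0l; apply: (@le_trans _ _ (\int[mu]_x H l x)%E).
    by apply: ereal_inf_lbound; exists l => /=.
  rewrite Hn lee_fin ler_powRr ?nr_ge0//; first exact: ltW.
  by apply: ne; exact: leq_trans (phik l).
have [n1 n1P] := cu 1 ltr01.
have [b bE] : exists b : F, b = (fun x => f n1 x - g x) :> (T -> R[i]).
  apply: (cLfun_exists p1 (mfg n1)).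
  apply: (@le_lt_trans _ _ (1 `^ p)%:E); last exact: ltry.
  by apply: (key n1 1 n1) => // l /(n1P _ _ (leqnn _))/ltW.
pose w : F := f n1 - b.
have wE x : w x = g x.
  rewrite (_ : w x = f n1 x - b x)// bE.
  by rewrite opprB addrC subrK.
exists (Lclass w) => e e0; have e20 : 0 < e / 2 by rewrite divr_gt0.
have [n0 n0P] := cu _ e20; exists n0 => n n0n.
apply: (@le_lt_trans _ _ (e / 2)); last by lra.
rewrite -[u n]LclassK -LclassB; apply: (powR_le_ler p0); [exact: nr_ge0|exact: ltW|].
rewrite -lee_fin nr_Lpow.
have -> : Lpow mu p (Lrepr (u n) - w) = Lpow mu p (fun x => f n x - g x).
  apply: eq_integral => x _; congr (_ `^ _)%:E.
  by rewrite /cmod (_ : (Lrepr _ - w) x = f n x - w x)// wE.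
by apply: (key n _ n0) => [|l n0l]; [exact: ltW|exact/ltW/n0P].
Qed.

End Completeness.

(** * Closures of operator algebras *)

Section ClosureAlgebra.
Variables (R : realType) (E : normedModType R[i]).
Implicit Types (S : set (bop E)) (A B : bop E).

Lemma subalgebraP S : subalgebra S <->
  [/\ S 0, forall a A B, S A -> S B -> S (a *: A + B) &
      forall A B, S A -> S B -> S (A * B)].
Proof.
split=> [[[/set_mem S0 SD] SM]|[S0 SD SM]]; split=> //.
- by move=> a A B AS BS; apply/set_mem/SD; exact/mem_set.
- by move=> A B AS BS; apply/set_mem/SM; exact/mem_set.
- split; first exact/mem_set.
  by move=> a A B /set_mem AS /set_mem BS; apply/mem_set/SD.
- by move=> A B /set_mem AS /set_mem BS; apply/mem_set/SM.
Qed.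

Lemma closure_subalgebra S : subalgebra S -> subalgebra (closure S).
Proof.
move=> /subalgebraP[S0 SD SM]; apply/subalgebraP; split.
- exact: subset_closure.
- move=> a A B /closure_nrP clA /closure_nrP clB; apply/closure_nrP => e e0.
  set c := Normc.normc a.
  have c0 : 0 <= c by case: (a) @c => ? ?; exact: sqrtr_ge0.
  have c10 : 0 < c + 1 by rewrite ltr_wpDl.
  have e20 : 0 < e / 2 by rewrite divr_gt0.
  have [A' SA' AA'] := clA _ (divr_gt0 e20 c10).
  have [B' SB' BB'] := clB _ e20.
  exists (a *: A' + B'); first exact: SD.
  rewrite opprD addrACA -scalerBr (le_lt_trans (ler_nrD _ _))//.
  rewrite [ltRHS]splitr ler_ltD// nrZ -/c.
  rewrite (@le_trans _ _ ((c + 1) * nr (A - A')))//.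
    by rewrite ler_wpM2r ?nr_ge0// lerDl.
  by rewrite mulrC -ler_pdivlMr// ltW.
- move=> A B /closure_nrP clA /closure_nrP clB; apply/closure_nrP => e e0.
  have e20 : 0 < e / 2 by rewrite divr_gt0.
  have B10 : 0 < nr B + 1 by rewrite ltr_wpDl ?nr_ge0.
  have [A' SA' AA'] := clA _ (divr_gt0 e20 B10).
  have A10 : 0 < nr A' + 1 by rewrite ltr_wpDl ?nr_ge0.
  have [B' SB' BB'] := clB _ (divr_gt0 e20 A10).
  exists (A' * B'); first exact: SM.
  have -> : A * B - A' * B' = (A - A') * B + A' * (B - B').
    by rewrite mulrBl mulrBr addrA subrK.
  rewrite (le_lt_trans (ler_nrD _ _))// [ltRHS]splitr ler_ltD//.
    rewrite (le_trans (nr_bopM _ _))// (@le_trans _ _ (nr (A - A') * (nr B + 1)))//.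
      by rewrite ler_wpM2l ?nr_ge0// lerDl.
    by rewrite -ler_pdivlMr// ltW.
  rewrite (le_lt_trans (nr_bopM _ _))// (@le_lt_trans _ _ ((nr A' + 1) * nr (B - B')))//.
    by rewrite ler_wpM2r ?nr_ge0// lerDl.
  by rewrite mulrC -ltr_pdivlMr.
Qed.

End ClosureAlgebra.

(** * Band operators *)

Section BandOperators.
Context {R : realType} (X : pmetricType R).
Variables (mu : {measure set (borel X) -> \bar R}) (p : R) (p1 : 1 < p).
Local Notation E := (cLspace mu (Lp_ge1 p1)).
Implicit Types (A B : bop E) (K : set (borel X)) (r s : R) (x y z : X).

Definition Mi K : bop E := Mr \1_K.

Definition band r A := forall K K', measurable K -> measurable K' ->
  (forall x y, K x -> K' y -> r <= mdist x y) -> Mi K' * A * Mi K = 0.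

(** Finite propagation, with the distance between the supports replaced by a uniform
    lower bound for the distances of their points. *)
Lemma BOP A : BO mu (Lp_ge1 p1) A <-> exists r, band r A.
Proof.
split=> [|[r rA]].
  have P0 : (0 <= propagation A)%E by rewrite /propagation le_max lexx.
  rewrite /BO /=; case PA : (propagation A) P0 => [r| |]// _ _.
  exists (r + 1) => K K' mK mK' KK'.
  apply: contrapT => /eqP nz.
  suff : (set_dist K K' <= r%:E)%E.
    apply/negP; rewrite -ltNge (@lt_le_trans _ _ (r + 1)%:E)//.
      by rewrite lte_fin ltrDl.
    by apply: le_ereal_inf_tmp => _ [x Kx [y K'y <-]]; rewrite lee_fin KK'.
  rewrite -PA /propagation le_max; apply/orP; right.
  apply: ereal_sup_ubound; exists K, K', mK, mK'; split => //.
  by rewrite !mulop_cindicE.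
rewrite /BO /= /propagation gt_max ltry /=.
apply: (@le_lt_trans _ _ r%:E); last exact: ltry.
apply: ge_ereal_sup => _ [K [K' [mK [mK' [-> nz]]]]].
apply: contrapT => /negP; rewrite -ltNge => rd.
move/eqP: nz; apply; rewrite !mulop_cindicE; apply: rA => // x y Kx K'y.
rewrite -lee_fin (le_trans (ltW rd))//.
by apply: ereal_inf_lbound; exists x => //; exists y.
Qed.

Lemma band_le r s A : r <= s -> band r A -> band s A.
Proof.
move=> rs rA K K' mK mK' KK'; apply: rA => // x y Kx K'y.
by rewrite (le_trans rs)// KK'.
Qed.

Lemma open_mball x r : open (ball x r).
Proof.
rewrite openE => y; rewrite ballEmdist /= => xy; apply/nbhs_ballP.
exists (r - mdist x y); first by rewrite /= subr_gt0.
move=> z; rewrite !ballEmdist /= ltrBrDl; apply: le_lt_trans.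
exact: metric_triangle.
Qed.

Lemma measurable_open (U : set X) : open U -> measurable (U : set (borel X)).
Proof. by move=> oU; exact: sub_sigma_algebra. Qed.

Lemma measurable_mball x r : measurable (ball x r : set (borel X)).
Proof. by apply: measurable_open; exact: open_mball. Qed.

Lemma MiC K : measurable K -> Mi K + Mi (~` K) = 1.
Proof.
move=> mK; rewrite /Mi MrD; last 2 first.
- exact: bmfun_indic.
- by apply: bmfun_indic; exact: measurableC.
rewrite -Mr1; congr Mr; apply/funext => x /=.
by rewrite !indicE in_setC; case: (x \in K); rewrite ?addr0 ?add0r.
Qed.

Lemma MiM K K' : measurable K -> measurable K' -> Mi K * Mi K' = Mi (K `&` K').
Proof.
move=> mK mK'; rewrite /Mi MrM; [|exact: bmfun_indic..].
by congr Mr; apply/funext => x /=; rewrite indicI.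
Qed.

Lemma Mi_disj K K' : measurable K -> measurable K' -> K `&` K' = set0 ->
  Mi K * Mi K' = 0.
Proof.
move=> mK mK' KK'; rewrite MiM// KK' /Mi -Mr0; congr Mr.
by rewrite indic0.
Qed.

Lemma Mi_id K : measurable K -> Mi K * Mi K = Mi K.
Proof. by move=> mK; rewrite MiM// setIid. Qed.

Lemma band0 r : band r 0.
Proof. by move=> K K' _ _ _; rewrite mulr0 mul0r. Qed.

Lemma bandD r A B : band r A -> band r B -> band r (A + B).
Proof.
move=> rA rB K K' mK mK' KK'.
by rewrite mulrDr mulrDl rA// rB// addr0.
Qed.

Lemma bopAl (a : R[i]) A B : a *: (A * B) = (a *: A : bop E) * B :> bop E.
Proof. exact: bop_eqP. Qed.

Lemma bopAr (a : R[i]) A B : a *: (A * B) = A * (a *: B : bop E) :> bop E.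
Proof.
by apply: bop_eqP => u; rewrite bopZE !bopME bopZE linearZ.
Qed.

Lemma bandZ r (a : R[i]) A : band r A -> band r (a *: A).
Proof.
move=> rA K K' mK mK' KK'.
by rewrite -bopAr -bopAl rA// scaler0.
Qed.

(** With [C] the open [s]-neighbourhood of [K], the operator [B] maps functions
    supported in [K] to functions supported in [C], and [A] does not reach from [C]
    to a set at distance [r + s] from [K]. The neighbourhood is open, hence
    measurable. *)
Lemma bandM r s A B : band r A -> band s B -> band (r + s) (A * B).
Proof.
move=> rA sB K K' mK mK' KK'.
pose C : set X := \bigcup_(x in K) ball x s.
have mC : measurable (C : set (borel X)).
  by apply: measurable_open; apply: bigcup_open => x _; exact: open_mball.
have -> : Mi K' * (A * B) * Mi K =
    (Mi K' * A * Mi C) * B * Mi K + Mi K' * A * (Mi (~` C) * B * Mi K).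
  rewrite -{1}[B]mul1r -(MiC mC) (mulrDl _ _ B) (mulrDr A).
  by rewrite (mulrDr (Mi K')) mulrDl !mulrA.
rewrite rA// => [|z y [x Kx]]; last first.
  rewrite ballEmdist /= => xz K'y.
  have := KK' x y Kx K'y; have := metric_triangle x z y; lra.
rewrite sB ?mul0r ?mulr0 ?addr0//; first exact: measurableC.
move=> x y Kx nCy; rewrite leNgt; apply/negP => xy; apply: nCy.
by exists x => //; rewrite ballEmdist.
Qed.

Lemma BO_subalgebra : subalgebra (BO mu (Lp_ge1 p1)).
Proof.
apply/subalgebraP; split.
- by apply/BOP; exists 0; exact: band0.
- move=> a A B /BOP[r rA] /BOP[s sB]; apply/BOP; exists (Num.max r s).
  apply: bandD; first by apply: bandZ; apply: band_le rA; rewrite le_max lexx.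
  by apply: band_le sB; rewrite le_max lexx orbT.
- by move=> A B /BOP[r rA] /BOP[s sB]; apply/BOP; exists (r + s); exact: bandM.
Qed.

Lemma BDO_subalgebra : subalgebra (BDO mu (Lp_ge1 p1)).
Proof. exact/closure_subalgebra/BO_subalgebra. Qed.

Lemma mulop_BO (f : cLinfty mu) : BO mu (Lp_ge1 p1) (mulop (Lp_ge1 p1) f).
Proof.
apply/BOP; exists 1 => K K' mK mK' KK'; apply: bop_eqP => u.
rewrite !bopME -[u]LclassK /Mi.
have [g1 -> g1E] := Mr_class (Lrepr u) (bmfun_indic R mK).
rewrite [mulop _ _ _]mulop_class.
have [g2 -> g2E] := Mr_class (mul_cLfun f g1) (bmfun_indic R mK').
rewrite -(Mr0 mu p1).
have [g3 E3 g3E] := Mr_class (Lrepr u) (bmfun_cst _ 0).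
rewrite [RHS](_ : _ = Lclass g3); last by rewrite -E3 LclassK.
congr Lclass; apply/val_inj/funext => x; rewrite /= g2E g3E /= g1E.
have [xK|xK] := boolP (x \in K); last first.
  by rewrite [\1_K x]indicE (negbTE xK) !(mul0r, mulr0).
have [xK'|xK'] := boolP (x \in K'); last first.
  by rewrite [\1_K' x]indicE (negbTE xK') !(mul0r, mulr0).
have := KK' x x (set_mem xK) (set_mem xK').
by rewrite mdistxx ler10.
Qed.

End BandOperators.

(** * Compact operators are band-dominated *)

Section CompactAreBandDominated.
Context {R : realType} (X : pmetricType R).
Variables (mu : {measure set (borel X) -> \bar R}) (p : R) (p1 : 1 < p).
Local Notation E := (cLspace mu (Lp_ge1 p1)).
Implicit Types (A B K : bop E) (u v w : E) (x y : X).

Let p0 : 0 < p. Proof. exact: lt_trans p1. Qed.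

(** A sequence that stays close to a finite set stays close to one of its points
    infinitely often. *)
Lemma infinite_pigeonhole (T : eqType) (s : seq T) (P : nat -> T -> Prop) :
  (forall n, exists2 y, y \in s & P n y) ->
  exists y : T, forall m, exists2 n, (m <= n)%N & P n y.
Proof.
move=> sP.
suff : forall n0, (forall n, (n0 <= n)%N -> exists2 y, y \in s & P n y) ->
    exists y : T, forall m, exists2 n, (m <= n)%N & P n y.
  by move=> /(_ 0%N); apply => n _; exact: sP.
elim: s {sP} => [|y s IH] n0 sP; first by have [] := sP n0 (leqnn _).
have [Py|] := pselect (forall m, exists2 n, (m <= n)%N & P n y).
  by exists y.
move=> /existsNP[m /forall2NP mP]; apply: (IH (maxn m n0)) => n.
rewrite geq_max => /andP[mn /sP[z]]; rewrite inE => /predU1P[->|zs] Pz.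
  by have [|] := mP n.
by exists z.
Qed.

Let Bn (n : nat) : set (borel X) := ball (point : X) n%:R.
Let mB n : measurable (Bn n). Proof. exact: measurable_mball. Qed.
Let mBC n : measurable (~` Bn n). Proof. exact: measurableC. Qed.
Let P n : bop E := Mi mu p1 (Bn n).
Let Q n : bop E := Mi mu p1 (~` Bn n).

Let PQ1 n : P n + Q n = 1. Proof. exact: MiC. Qed.

Let Bn_le m n : (m <= n)%N -> Bn m `<=` Bn n.
Proof. by move=> mn; apply: le_ball; rewrite ler_nat. Qed.

Let PP m n : (m <= n)%N -> P n * P m = P m.
Proof. by move=> mn; rewrite /P MiM// setIidr//; exact: Bn_le. Qed.

Let QQ m n : (m <= n)%N -> Q m * Q n = Q n.
Proof.
by move=> mn; rewrite /Q MiM// setIidr//; apply: subsetC; exact: Bn_le.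
Qed.

Let PQC m n : P m * Q n = Q n * P m.
Proof. by rewrite /P /Q /Mi MrMC//; exact: bmfun_indic. Qed.

Let Q_cvg0 u : nrcvg (fun n => Q n u) 0.
Proof.
apply: (@Mr_nrcvg0 _ _ _ mu p p1 _ _ 1) => [n|n x|x].
- exact: bmfun_indic.
- by rewrite indicE; case: (_ \in _); rewrite ?normr1 ?normr0.
apply: cvg_near_cst.
exists (Num.truncn (mdist (point : X) x)).+1 => // n /= xn.
rewrite indicE memNset//= => -[]; rewrite /Bn ballEmdist /=.
apply: lt_le_trans (truncnS_gt _) _; by rewrite ler_nat.
Qed.

Let nrMi S u : measurable S -> nr (Mi mu p1 S u) <= nr u.
Proof.
move=> mS; rewrite -[leRHS]mul1r; apply: nr_Mr => //; first exact: bmfun_indic.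
by move=> x; rewrite indicE; case: (_ \in _); rewrite ?normr1 ?normr0.
Qed.

(** A case of [nr_sum_Mr] in which the weights are indicator functions of disjoint
    sets, so that the constant is 1. *)
Lemma nr_disjoint_add n v w : P n v = v -> Q n w = w ->
  nr (v + w) `^ p <= nr v `^ p + nr w `^ p.
Proof.
move=> Pv Qw; have [q q0 pq] := conjugate_exponent p1.
pose G (i : nat) : borel X -> R := if i == 0%N then \1_(Bn n) else \1_(~` Bn n).
pose V (i : nat) := if i == 0%N then v else w.
have := @nr_sum_Mr _ _ _ mu p p1 q 2 G V 1 q0 pq.
rewrite powR1 mul1r !big_ord_recr !big_ord0 /= !add0r /G /V /=.
rewrite -[Mr _ v]/(P n v) -[Mr _ w]/(Q n w) Pv Qw; apply.
- by move=> i; case: ifP => _; exact: bmfun_indic.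
- by move=> i x; case: ifP => _; rewrite indicE.
move=> x; rewrite !big_ord_recr !big_ord0 /= !add0r !indicE in_setC.
by case: (x \in Bn n); rewrite /= powR1 powR0 ?addr0 ?add0r// gt_eqF.
Qed.

(** Gliding hump. If no [K * Q n] is small, there are unit vectors supported ever
    farther away whose images under [K] accumulate at a single [y] of norm not
    much below [e]. A sum [v] of [N] of them with disjoint supports has norm at most
    [N^(1/p)], while [K v] is close to [N y]; as [p > 1], this is absurd for large
    [N]. *)
Lemma compact_mul_tail K (e : R) : totally_bounded_op K -> 0 < e ->
  exists n, nr (K * Q n) <= e.
Proof.
move=> tK e0; apply: contrapT => /forallNP KQ.
have /choice[u uP] : forall n, exists u, nr u <= 1 /\ e < nr (K (Q n u)).
  move=> n; apply: contrapT => /forallNP nu; apply: (KQ n).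
  apply: nr_bop_le_ball (ltW e0) _ => u u1; rewrite leNgt; apply/negP => eu.
  by apply: (nu u).
have k20 : 0 < nr K + 2 by rewrite ltr_wpDl ?nr_ge0.
(* [eta (nr K + 2) = e / 2]: each summand of the hump contributes an error of at
   most [eta (1 + nr K)], and [nr y >= e - eta], which leaves [e / 2]. *)
pose eta := e / (2 * (nr K + 2)).
have eta0 : 0 < eta by rewrite divr_gt0// mulr_gt0.
have [s sP] := tK _ eta0.
have [|y yP] := @infinite_pigeonhole _ s (fun n (y : E) => nr (K (Q n (u n)) - y) < eta).
  by move=> n; apply: sP; rewrite (le_trans (nrMi _ _))//; exact: (uP n).1.
have ye : e - eta <= nr y.
  have [n _ Kny] := yP 0%N; have [_ eK] := uP n.
  have := ler_nrB (K (Q n (u n))) y; lra.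
pose c := eta * (1 + nr K).
have step N : exists m v, [/\ P m v = v, nr v `^ p <= N%:R &
    nr (K v - N%:R%:C *: y) <= N%:R * c].
  elim: N => [|N [m [v [Pv vN Kv]]]].
    exists 0%N, 0; split; first by rewrite linear0.
      by rewrite nr0 powR0// gt_eqF.
    by rewrite linear0 scale0r subrr nr0 mul0r.
  have [n mn Kny] := yP m; set w := Q n (u n).
  have [m1 /(_ (maxn m m1) (leq_maxr _ _))] := Q_cvg0 w eta0.
  set m' := maxn m m1; rewrite subr0 => Qw.
  pose w' := P m' w.
  have mm' : (m <= m')%N by exact: leq_maxl.
  have Qw' : Q m w' = w'.
    by rewrite /w' /w -!bopME -PQC -mulrA QQ.
  have w'1 : nr w' <= 1.
    rewrite (le_trans (nrMi _ _))// (le_trans (nrMi _ _))//.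
    exact: (uP n).1.
  have ww' : w - w' = Q m' w.
    by rewrite -{1}[w]bop1E -(PQ1 m') bopDE addrC addKr.
  exists m', (v + w'); split.
  - rewrite linearD /= -{1}Pv -!bopME PP// bopME Pv; congr (_ + _).
    by rewrite /w' -bopME PP.
  - rewrite (le_trans (nr_disjoint_add Pv Qw'))// -natr1 lerD//.
    by apply: le_trans (ler_powRr (ltW p0) (nr_ge0 _) w'1) _; rewrite powR1.
  have -> : K (v + w') - N.+1%:R%:C *: y =
      (K v - N%:R%:C *: y) + ((K w - y) - K (w - w')).
    rewrite [K (w - w')]linearB opprB [K w - y + _]addrC subrKA.
    by rewrite linearD -natr1 rmorphD scalerDl scale1r opprD addrACA.
  rewrite -natr1 mulrDl mul1r (le_trans (ler_nrD _ _))// lerD//.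
  rewrite (le_trans (ler_nrD _ _))// nrN /c mulrDr mulr1 lerD//; first exact: ltW.
  rewrite ww' (le_trans (ler_nr_bop _ _))// mulrC ler_wpM2r ?nr_ge0//.
  exact: ltW.
have key N : (0 < N)%N -> N%:R `^ (p - 1) <= (2 * nr K / e) `^ p.
  move=> N0; have N0' : 0 < N%:R :> R by rewrite ltr0n.
  have [m [v [_ vN Kv]]] := step N.
  have vN' : nr v <= N%:R `^ p^-1 by apply: ler_powRV => //; exact: nr_ge0.
  have h1 : N%:R * (e / 2) <= nr K * N%:R `^ p^-1.
    apply: le_trans (ler_wpM2l (nr_ge0 _) vN').
    apply: le_trans (ler_nr_bop K v).
    have h2 : N%:R * nr y - N%:R * c <= nr (K v).
      have := ler_nrB (N%:R%:C *: y) (K v).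
      rewrite nrZ_ge0// nrBC; lra.
    apply: le_trans h2; rewrite -mulrBr ler_wpM2l//.
    have : eta * (nr K + 2) = e / 2 by rewrite /eta; field; rewrite gt_eqF.
    by rewrite /c; lra.
  have h2 : N%:R `^ (1 - p^-1) <= 2 * nr K / e.
    have -> : N%:R `^ (1 - p^-1) = N%:R / N%:R `^ p^-1 :> R.
      rewrite powRB; first by rewrite powRr1// ltW.
      by rewrite (gt_eqF N0') implybT.
    rewrite ler_pdivrMr ?powR_gt0//.
    by rewrite mulrAC ler_pdivlMr//; lra.
  have := ler_powRr (ltW p0) (powR_ge0 _ _) h2.
  by rewrite -powRrM mulrBl mul1r mulVf ?gt_eqF.
have p10 : 0 < p - 1 by rewrite subr_gt0.
set L := (2 * nr K / e) `^ p in key.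
pose N := (Num.truncn (L `^ (p - 1)^-1)).+1.
have := key N isT; rewrite leNgt => /negP; apply.
rewrite -[ltLHS](@powR_invK _ (p - 1)) ?powR_ge0//.
by rewrite gt0_ltr_powR// ?nnegrE ?powR_ge0 ?ler0n// truncnS_gt.
Qed.

(** Strong convergence [Q n -> 0] is uniform on the totally bounded image of the
    unit ball. *)
Lemma tail_mul_compact K (e : R) : totally_bounded_op K -> 0 < e ->
  exists n0, forall n, (n0 <= n)%N -> nr (Q n * K) <= e.
Proof.
move=> tK e0; have e20 : 0 < e / 2 by rewrite divr_gt0.
have [s sP] := tK _ e20.
have [n0 n0P] : exists n0, forall n (y : E), (n0 <= n)%N -> y \in s -> nr (Q n y) <= e / 2.
  elim: s {sP} => [|y s [n0 n0P]]; first by exists 0%N.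
  have [n1 n1P] := Q_cvg0 y e20.
  exists (maxn n0 n1) => n z; rewrite geq_max => /andP[h0 h1].
  rewrite inE => /predU1P[->|]; last exact: n0P.
  by have := n1P n h1; rewrite subr0 => /ltW.
exists n0 => n n0n; apply: nr_bop_le_ball (ltW e0) _ => u /sP[y ys Ky].
rewrite bopME -[K u](subrK y) linearD /= (le_trans (ler_nrD _ _))//.
rewrite [leRHS]splitr; apply: lerD; last exact: n0P.
by rewrite (le_trans (nrMi _ _))// ltW.
Qed.

Lemma truncation_band n K : band n.*2.+1%:R (P n * K * P n).
Proof.
move=> S S' mS mS' SS'.
have [SB|/set0P[x [Sx Bx]]] := eqVneq (S `&` Bn n) set0.
  rewrite -!mulrA (_ : P n * Mi _ _ S = 0) ?mulr0//.
  by rewrite /P Mi_disj// setIC.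
have [SB|/set0P[y [Sy By]]] := eqVneq (S' `&` Bn n) set0.
  rewrite !mulrA (_ : Mi _ _ S' * P n = 0) ?mul0r//.
  by rewrite /P Mi_disj.
have := SS' x y Sx Sy; move: Bx By; rewrite /Bn !ballEmdist /= => xn yn.
have := metric_triangle x (point : X) y; rewrite (metric_sym x point).
move=> h1 h2; exfalso; move: h1 h2; rewrite -addn1 -addnn !natrD; lra.
Qed.

(** Compressing [K] to a large ball gives an operator of finite propagation, and
    what is cut off on either side is small in norm. *)
Theorem compact_BDO K : compact_op K -> BDO mu (Lp_ge1 p1) K.
Proof.
move=> /(compact_opP (@Lp_complete _ _ _ mu p p1)) tK; apply/closure_nrP => e e0.
have e30 : 0 < e / 3 by rewrite divr_gt0.
have [n1 n1P] := compact_mul_tail tK e30.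
have [n2 n2P] := tail_mul_compact tK e30.
pose n := maxn n1 n2; exists (P n * K * P n).
  by apply/BOP; exists n.*2.+1%:R; exact: truncation_band.
have -> : K - P n * K * P n = Q n * K + P n * (K * Q n).
  rewrite -{1}[K]mul1r -(PQ1 n) mulrDl addrAC addrC; congr (_ + _).
  rewrite -{1}[P n * K]mulr1 -[X in _ * X](PQ1 n) mulrDr addrAC subrr add0r.
  by rewrite mulrA.
have h1 : nr (Q n * K) <= e / 3 by apply: n2P; exact: leq_maxr.
have h2 : nr (P n * (K * Q n)) <= e / 3.
  apply: le_trans n1P; apply: nr_bop_le => [|u]; first exact: nr_ge0.
  rewrite bopME (le_trans (nrMi _ _))// -(@QQ n1 n) ?leq_maxl// mulrA bopME.
  rewrite (le_trans (ler_nr_bop _ _))// ler_wpM2l ?nr_ge0//.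
  exact: nrMi.
have := ler_nrD (Q n * K) (P n * (K * Q n)); lra.
Qed.

End CompactAreBandDominated.

(** * Partitions of spaces of bounded geometry *)

Section BoundedGeometryPartition.
Context {R : realType} (X : pmetricType R).
Hypothesis Xbounded : bounded_geometry X.
Implicit Types (x y : X).

Section Selection.
Variables (eps : R) (y : nat -> X).

(** Greedy selection of a [2 eps]-separated subsequence. A ball of radius [eps]
    contains at most one selected point, so bounded geometry bounds the number of
    them in any ball; maximality makes the balls of radius [3 eps] a cover. *)
Fixpoint selected (n : nat) : seq nat :=
  if n is m.+1 then
    if all (fun l => 2 * eps <= mdist (y l) (y m)) (selected m)
    then m :: selected m else selected m
  else [::].

Let sel n := n \in selected n.+1.

Lemma mem_selected l n : (l \in selected n) = (l < n)%N && sel l.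
Proof.
elim: n => [|n IH]; first by rewrite ltn0.
have lt_sel m k : m \in selected k -> (m < k)%N.
  elim: k => //= k IHk; case: ifP => _ => [|/IHk/leqW//].
  by rewrite inE => /predU1P[->//|/IHk/leqW].
have [ln|nl|->] := ltngtP l n.
- have IH' : (l \in selected n) = sel l by rewrite IH ln.
  rewrite ltnS (ltnW ln) andTb -IH' [selected n.+1]/=.
  by case: (all _ _); rewrite // in_cons (ltn_eqF ln).
- rewrite ltnS leqNgt nl andFb; apply/negbTE/negP => /lt_sel.
  by rewrite ltnS leqNgt nl.
- by rewrite ltnSn.
Qed.

Lemma sel_separated l n : sel l -> sel n -> l != n ->
  2 * eps <= mdist (y l) (y n).
Proof.
wlog ln : l n / (l < n)%N => [wl sl sn|sl sn _].
  rewrite neq_ltn => /orP[ln|nl]; first by apply: wl => //; rewrite ltn_eqF.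
  by rewrite metric_sym; apply: wl => //; rewrite ltn_eqF.
move: sn; rewrite /sel /=; case: ifP => [/allP + _|_].
  by apply; rewrite mem_selected ln.
by rewrite mem_selected ltnn.
Qed.

Lemma sel_maximal n : 0 < eps ->
  exists2 l, sel l & mdist (y l) (y n) < 2 * eps.
Proof.
move=> e0; have [sn|] := boolP (sel n).
  by exists n => //; rewrite mdistxx mulr_gt0.
rewrite /sel /=; case: ifPn => [_|/allPn[l + nl _]]; first by rewrite mem_head.
by rewrite mem_selected => /andP[_ sl]; exists l => //; rewrite ltNge.
Qed.

(** Distinct selected points lie in distinct [eps]-balls of the cover [s]. *)
Lemma sel_count (M : nat) (x : X) (c : R) (s : seq X) (n : nat) :
  (size s <= M)%N -> ball x c `<=` \bigcup_(w in [set` s]) ball w eps ->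
  \sum_(k < n) (sel k && (mdist (y k) x < c))%:R <= M%:R :> R.
Proof.
move=> sM xs; pose b k := sel k && (mdist (y k) x < c).
have -> : \sum_(k < n) (b k)%:R = (count b (iota 0 n))%:R :> R.
  have -> : iota 0 n = index_iota 0 n by rewrite /index_iota subn0.
  rewrite -sum1_count natr_sum big_mkord.
  by rewrite [RHS]big_mkcond; apply: eq_bigr => k _; case: (b k).
rewrite ler_nat (leq_trans _ sM)// -size_filter.
have /choice[f fP] : forall k, exists w, b k -> w \in s /\ mdist w (y k) < eps.
  move=> k; have [|_] := boolP (b k); last by exists point.
  move=> /andP[_ xk]; have [|w ws wk] := xs (y k).
    by rewrite ballEmdist /= metric_sym.
  by exists w => _; move: wk; rewrite ballEmdist.
rewrite -(size_map f); apply: uniq_leq_size.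
  rewrite map_inj_in_uniq ?filter_uniq ?iota_uniq// => k l.
  rewrite !mem_filter => /andP[bk _] /andP[bl _] fkl.
  apply/eqP; apply: contraT => kl.
  have /andP[sk _] := bk; have /andP[sl _] := bl.
  have := sel_separated sk sl kl.
  have [_ h1] := fP k bk; have [_ h2] := fP l bl.
  have := metric_triangle (y k) (f k) (y l).
  rewrite (metric_sym (y k) (f k)) {2}fkl; lra.
move=> w /mapP[k]; rewrite mem_filter => /andP[bk _] ->.
exact: (fP k bk).1.
Qed.

End Selection.

(** Bounded geometry at all integer radii makes the space separable at the scale
    [eps]. *)
Lemma covering_sequence : exists2 eps : R, 0 < eps &
  exists2 y : nat -> X, (forall x, exists m, mdist (y m) x < eps) &
  forall r : R, 0 < r -> exists N : nat, forall x : X,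
    exists2 s : seq X, (size s <= N)%N &
      ball x r `<=` \bigcup_(w in [set` s]) ball w eps.
Proof.
have [eps e0 bg] := Xbounded; exists eps => //.
have /choice[s sP] : forall n : nat, exists s : seq X,
    ball (point : X) n.+1%:R `<=` \bigcup_(w in [set` s]) ball w eps.
  by move=> n; have [|N /(_ point)[s _ sP]] := bg n.+1%:R; [|exists s].
pose y m := if unpickle m is Some (n, k) then nth point (s n) k else point.
exists y => // x.
pose n := Num.truncn (mdist (point : X) x).
have [|w /= ws] := sP n x; first by rewrite ballEmdist /= truncnS_gt.
rewrite ballEmdist /= => wx.
by exists (pickle (n, index w (s n))); rewrite /y pickleK nth_index.
Qed.

(** Disjoint pieces [Q k] exhausting the space, of bounded diameter, together with
    neighbourhoods [N k] that contain everything at distance less than [r] from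
    [Q k] and overlap at most [M] times. An operator of propagation below [r] maps
    functions supported in [Q k] to functions supported in [N k], and the images of
    the different pieces can be added up at a cost depending only on [M]. *)
Lemma bounded_geometry_partition (r : R) : exists (c : R) (z : nat -> X)
    (Q N : nat -> set (borel X)) (M : nat),
  [/\ (forall k, measurable (Q k) /\ measurable (N k)),
      (forall k, Q k `<=` N k) /\ (forall k, N k `<=` ball (z k) c),
      forall k (x y : X), Q k x -> ~ N k y -> r <= mdist x y,
      (forall x n, \sum_(k < n) (\1_(Q k) x : R) <= 1) /\
      (forall x, (fun n => \sum_(k < n) (\1_(Q k) x : R)) @ \oo --> (1 : R)) &
      forall x n, \sum_(k < n) (\1_(N k) x : R) <= M%:R].
Proof.
have [eps e0 [y yP bg]] := covering_sequence.
pose sel n := n \in selected eps y n.+1.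
pose r' := Num.max r 0; have r'0 : 0 <= r' by rewrite le_max lexx orbT.
pose c := 3 * eps + r'; have c0 : 0 < c by rewrite ltr_wpDr// mulr_gt0.
have [M MP] := bg c c0.
pose B (e : R) k : set X := [set x | sel k /\ ball (y k) e x].
have mB e k : measurable (B e k : set (borel X)).
  rewrite /B; case: (sel k); last first.
    rewrite (_ : [set _ | _] = set0); first exact: measurable0.
    by apply/seteqP; split => // x [].
  rewrite (_ : [set _ | _] = ball (y k) e); first exact: measurable_mball.
  by apply/seteqP; split => x // [].
pose Q := seqDU (fun k => B (3 * eps) k : set (borel X)).
have mQ k : measurable (Q k) by apply: seqDU_measurable => i; exact: mB.
have QB k : Q k `<=` B (3 * eps) k by exact: subset_seqDU.
have tQ : trivIset setT Q by exact: trivIset_seqDU.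
have sumQ x n : \sum_(k < n) (\1_(Q k) x : R) =
    (\1_(\big[setU/set0]_(k < n) Q k) x).
  elim: n => [|n IH]; first by rewrite !big_ord0 indic0.
  rewrite !big_ord_recr /= IH !indicE in_setU.
  have [xn|xn] := boolP (x \in \big[setU/set0]_(k < n) Q k); last by rewrite add0r.
  have [xQ|] := boolP (x \in Q n); last by rewrite addr0.
  move: xn; rewrite inE -bigcup_mkord => -[k /= kn xk].
  have := tQ k n I I; rewrite (_ : (k = n) = False) => [|]; last first.
    by apply/propext; split => // kn'; move: kn; rewrite kn' ltnn.
  by case; exists x; split => //; exact: set_mem.
exists c, y, Q, (B c), M; split.
- by move=> k; split; [exact: mQ|exact: mB].
- split=> k x; last by case.
  by move=> /QB[sk xk]; split => //; apply: le_ball xk; rewrite lerDl.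
- move=> k x z /QB[sk]; rewrite ballEmdist /= => yx nz.
  rewrite leNgt; apply/negP => xz; apply: nz; split => //.
  rewrite ballEmdist /=; have rr' : r <= r' by rewrite le_max lexx.
  have := metric_triangle (y k) x z; rewrite /c; lra.
- split => x => [n|]; first by rewrite sumQ indicE; case: (_ \in _).
  have [m ym] := yP x.
  have [l sl lm] := sel_maximal y m e0.
  have xB : (\bigcup_k B (3 * eps) k) x.
    exists l => //; split => //; rewrite ballEmdist /=.
    have := metric_triangle (y l) (y m) x; lra.
  move: xB; rewrite seqDU_bigcup_eq => -[k _ xk].
  apply: cvg_near_cst; exists k.+1 => // n /= kn.
  rewrite sumQ indicE mem_set// -bigcup_mkord.
  by exists k.
- move=> x n; have [s sM xs] := MP x.
  have := @sel_count eps y M x c s n sM xs.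
  apply: le_trans; apply: ler_sum => k _.
  rewrite indicE; have [|//] := boolP (x \in _).
  by rewrite inE => -[]; rewrite ballEmdist /= -/(sel k) => -> ->.
Qed.

End BoundedGeometryPartition.

(** * Band-dominated operators through commutators *)

Section Commutators.
Context {R : realType} (X : pmetricType R).
Variables (mu : {measure set (borel X) -> \bar R}) (p : R) (p1 : 1 < p).
Local Notation E := (cLspace mu (Lp_ge1 p1)).
Implicit Types (A B C : bop E) (u v : E) (rho : nat -> borel X -> R).

Let p0 : 0 < p. Proof. exact: lt_trans p1. Qed.

(** The pointwise conditions of property A' at parameter [t], in terms of partial
    sums. *)
Definition slow_partition (t : R) rho :=
  [/\ forall j, measurable_fun setT (rho j),
      forall j x, 0 <= rho j x,
      forall J x, \sum_(j < J) rho j x <= 1,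
      forall x, (fun J => \sum_(j < J) rho j x) @ \oo --> (1 : R) &
      forall J (x y : X), mdist x y <= t^-1 ->
        \sum_(j < J) `|rho j x - rho j y| <= t].

Definition rootp (a : R) rho (j : nat) : borel X -> R := fun x => rho j x `^ a^-1.

Lemma slow_partition_le1 t rho j x : slow_partition t rho -> rho j x <= 1.
Proof.
case=> _ rho0 rho1 _ _; apply: le_trans (rho1 j.+1 x).
by rewrite big_ord_recr /= lerDr; apply: sumr_ge0 => i _; exact: rho0.
Qed.

Lemma bmfun_rootp t rho (a : R) j : 0 < a -> slow_partition t rho ->
  bmfun (rootp a rho j).
Proof.
move=> a0 srho; split.
  by apply: (measurableT_comp (measurable_powR _)); case: srho.
exists 1 => x; rewrite ger0_norm ?powR_ge0// /rootp.
have -> : 1 = 1 `^ a^-1 :> R by rewrite powR1.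
rewrite ler_powRr ?invr_ge0//; first exact: ltW.
  by case: srho.
exact: slow_partition_le1 srho.
Qed.

Lemma sum_rootp t rho (a : R) J x : 0 < a -> slow_partition t rho ->
  \sum_(j < J) rootp a rho j x `^ a <= 1.
Proof.
move=> a0 [_ rho0 rho1 _ _]; apply: le_trans (rho1 J x).
by apply: ler_sum => j _; rewrite /rootp powR_invK.
Qed.

Lemma sum_nr_rootp t rho J u : slow_partition t rho ->
  \sum_(j < J) nr (Mr (rootp p rho j) u) `^ p <= nr u `^ p.
Proof.
move=> srho; rewrite -[leRHS]mul1r; apply: sum_nr_Mr => [j|x].
  exact: bmfun_rootp srho.
apply: le_trans (sum_rootp J x p0 srho); apply: ler_sum => j _.
by rewrite ger0_norm ?powR_ge0.
Qed.

Definition comm A C : bop E := A * C - C * A.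

(** The families of operators [D M_j], indexed by the multipliers
    [M_j = rho_j^(1/p)] of a partition, that are small in the sense of [l^p]. *)
Definition small (D : bop E -> bop E) := forall e : R, 0 < e ->
  exists2 t0 : R, 0 < t0 & forall t rho, 0 < t -> t <= t0 ->
    slow_partition t rho -> forall J u,
    \sum_(j < J) nr (D (Mr (rootp p rho j)) u) `^ p <= e * nr u `^ p.

Lemma small_eq D D' : D =1 D' -> small D -> small D'.
Proof. by move=> /funext ->. Qed.

Lemma powp_gt0 : 0 < 2 `^ p :> R.
Proof. exact: powR_gt0. Qed.

Lemma nr_powD u v : nr (u + v) `^ p <= 2 `^ p * (nr u `^ p + nr v `^ p).
Proof.
apply: le_trans (ler_powRD (ltW p0) (nr_ge0 u) (nr_ge0 v)).
by rewrite ler_powRr ?nr_ge0 ?ler_nrD//; exact: ltW.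
Qed.

Lemma nr_pow_bop A u : nr (A u) `^ p <= nr A `^ p * nr u `^ p.
Proof.
by rewrite -powRM ?nr_ge0// ler_powRr ?nr_ge0 ?ler_nr_bop//; exact: ltW.
Qed.

Lemma smallD D D' : small D -> small D' -> small (fun C => D C + D' C).
Proof.
move=> sD sD' e e0; pose e' := e / (2 * 2 `^ p).
have e'0 : 0 < e' by rewrite divr_gt0// mulr_gt0// powp_gt0.
have [t1 t10 t1P] := sD _ e'0; have [t2 t20 t2P] := sD' _ e'0.
exists (Num.min t1 t2) => [|t rho t0]; first by rewrite lt_min t10.
rewrite le_min => /andP[tt1 tt2] srho J u.
have h1 := t1P t rho t0 tt1 srho J u; have h2 := t2P t rho t0 tt2 srho J u.
apply: (@le_trans _ _ (2 `^ p * (e' * nr u `^ p + e' * nr u `^ p))); last first.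
  rewrite -mulrDl mulrA ler_wpM2r ?powR_ge0// /e'.
  by rewrite le_eqVlt; apply/orP; left; apply/eqP; field; rewrite gt_eqF ?powp_gt0.
apply: le_trans (ler_wpM2l (ltW powp_gt0) (lerD h1 h2)).
rewrite -big_split /= mulr_sumr; apply: ler_sum => j _.
exact: nr_powD.
Qed.

Lemma smallN D : small D -> small (fun C => - D C).
Proof.
move=> sD e /sD[t0 t00 t0P]; exists t0 => // t rho t1 t2 srho J u.
apply: le_trans (t0P t rho t1 t2 srho J u); apply: ler_sum => j _.
by move: (D _) => C; rewrite -(nrN (C u)).
Qed.

Lemma smallMl A D : small D -> small (fun C => A * D C).
Proof.
move=> sD e e0; pose a := nr A `^ p + 1.
have a0 : 0 < a by rewrite ltr_wpDl// powR_ge0.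
have [t0 t00 t0P] := sD _ (divr_gt0 e0 a0).
exists t0 => // t rho t1 t2 srho J u.
apply: (@le_trans _ _ (a * (e / a * nr u `^ p))); last first.
  by rewrite mulrA [a * _]mulrC divfK ?gt_eqF.
apply: le_trans (ler_wpM2l (ltW a0) (t0P t rho t1 t2 srho J u)).
rewrite mulr_sumr; apply: ler_sum => j _; rewrite bopME.
apply: le_trans (nr_pow_bop _ _) _.
by rewrite ler_wpM2r ?powR_ge0// lerDl.
Qed.

Lemma smallMr A D : small D -> small (fun C => D C * A).
Proof.
move=> sD e e0; pose a := nr A `^ p + 1.
have a0 : 0 < a by rewrite ltr_wpDl// powR_ge0.
have [t0 t00 t0P] := sD _ (divr_gt0 e0 a0).
exists t0 => // t rho t1 t2 srho J u.
apply: le_trans (t0P t rho t1 t2 srho J (A u)) _.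
rewrite -mulrA ler_wpM2l//; first exact: ltW.
rewrite ler_pdivrMl// (le_trans (nr_pow_bop _ _))//.
by rewrite ler_wpM2r ?powR_ge0// lerDl.
Qed.

Lemma commE A C u : comm A C u = A (C u) - C (A u).
Proof. by []. Qed.

Lemma commD A B C : comm (A + B) C = comm A C + comm B C.
Proof. by rewrite /comm mulrDl mulrDr opprD addrACA. Qed.

Lemma commDr A B C : comm A (B + C) = comm A B + comm A C.
Proof. by rewrite /comm mulrDl mulrDr opprD addrACA. Qed.

(** The bound depends on [A] only through its norm, so smallness of the commutators
    survives norm limits. *)
Lemma sum_comm_le A t rho J u : slow_partition t rho ->
  \sum_(j < J) nr (comm A (Mr (rootp p rho j)) u) `^ p <=
    2 `^ p * (2 * (nr A `^ p * nr u `^ p)).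
Proof.
move=> srho.
have h1 := ler_wpM2l (powR_ge0 (nr A) p) (sum_nr_rootp J u srho).
have h2 := le_trans (sum_nr_rootp J (A u) srho) (nr_pow_bop A u).
rewrite mulr_natl mulr2n; apply: le_trans (ler_wpM2l (ltW powp_gt0) (lerD h1 h2)).
rewrite mulr_sumr -big_split /= mulr_sumr; apply: ler_sum => j _.
set M := Mr _; apply: le_trans (_ : _ <= nr (A (M u) + - M (A u)) `^ p) _ => //.
apply: le_trans (nr_powD _ _) _; rewrite nrN ler_wpM2l ?powR_ge0// lerD2r.
exact: nr_pow_bop.
Qed.

Lemma small_comm_closed A :
  (forall e : R, 0 < e -> exists2 B, small (comm B) & nr (A - B) < e) ->
  small (comm A).
Proof.
move=> clA e e0.
pose c : R := 4 * (2 `^ p * 2 `^ p).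
have c0 : 0 < c by rewrite mulr_gt0// mulr_gt0// powp_gt0.
have d0 : 0 < (e / c) `^ p^-1 by rewrite powR_gt0// divr_gt0.
have [B sB AB] := clA _ d0.
have ABp : nr (A - B) `^ p <= e / c.
  rewrite -[leRHS](@powR_invK _ p)//; last by rewrite divr_ge0// ltW.
  by rewrite ler_powRr ?nr_ge0//; exact: ltW.
have e'0 : 0 < e / (2 * 2 `^ p) by rewrite divr_gt0// mulr_gt0// powp_gt0.
have [t0 t00 t0P] := sB _ e'0.
exists t0 => // t rho t1 t2 srho J u.
have h1 := t0P t rho t1 t2 srho J u.
have h2 := sum_comm_le (A - B) J u srho.
set U := nr u `^ p in h1 h2 *; have U0 : 0 <= U by exact: powR_ge0.
have h3 : 2 `^ p * (2 * (nr (A - B) `^ p * U)) <= 2 `^ p * (2 * (e / c * U)).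
  by rewrite ler_wpM2l ?powR_ge0// ler_wpM2l// ler_wpM2r.
have -> : e * U = 2 `^ p * (e / (2 * 2 `^ p) * U + 2 `^ p * (2 * (e / c * U))).
  by rewrite /c; field; rewrite gt_eqF ?powp_gt0.
apply: le_trans (ler_wpM2l (ltW powp_gt0) (lerD h1 (le_trans h2 h3))).
have AE : A = B + (A - B) by rewrite addrC subrK.
rewrite -big_split mulr_sumr; apply: ler_sum => j _.
rewrite [X in comm X _]AE commD.
move: (comm B _) (comm (A - B) _) => C1 C2; exact: (nr_powD (C1 u) (C2 u)).
Qed.

Lemma nrcvg_sum_pow (J : nat) (D : nat -> bop E) (w : nat -> E) u (c : R) :
  nrcvg w u -> (forall n, \sum_(j < J) nr (D j (w n)) `^ p <= c) ->
  \sum_(j < J) nr (D j u) `^ p <= c.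
Proof.
move=> wu wc.
have h : (fun n => \sum_(j < J) nr (D j (w n)) `^ p) @ \oo -->
    \sum_(j < J) nr (D j u) `^ p.
  elim: (J) => [|k IH].
    by under eq_fun do rewrite big_ord0; rewrite big_ord0; exact: cvg_cst.
  under eq_fun do rewrite big_ord_recr /=; rewrite big_ord_recr /=.
  apply: cvgD => //; apply: cvgn_powR => //; first by move=> n; exact: nr_ge0.
  by apply: nrcvg_nr; exact: (nrcvg_bop (D k) wu).
by apply: (cvgr_to_le h); exact: nearW.
Qed.

Lemma comm_cst A (c : R) : comm A (Mr (cst c)) = 0.
Proof.
apply: bop_eqP => u; rewrite [LHS](_ : _ = A (Mr (cst c) u) - Mr (cst c) (A u))//.
by rewrite !Mr_cst linearZ subrr.
Qed.

(** Scalars commute with [A], so on the piece [Q] the multiplier [f] may be replaced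
    by its deviation from the constant [c], which is small on both [Q] and [N]. *)
Lemma comm_localize A (f : borel X -> R) (c : R) (Q N : set (borel X)) :
  bmfun f -> measurable Q -> measurable N ->
  Mi mu p1 N * A * Mi mu p1 Q = A * Mi mu p1 Q ->
  comm A (Mr f) * Mi mu p1 Q =
  Mi mu p1 N * (A * Mr ((f \- cst c) \* \1_Q) * Mi mu p1 Q -
                Mr ((f \- cst c) \* \1_N) * (A * Mi mu p1 Q)).
Proof.
move=> bf mQ mN NAQ.
have bc : bmfun (cst c : borel X -> R) by exact: bmfun_cst.
have bD := bmfunB bf bc.
have bQ := @bmfun_indic _ _ R _ mQ; have bN := @bmfun_indic _ _ R _ mN.
rewrite -!MrM//; set D : bop E := Mr (f \- cst c).
have fD : Mr f = D + Mr (cst c) :> bop E.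
  rewrite /D MrD//; congr Mr; apply/funext => x /=; by rewrite subrK.
have -> : comm A (Mr f) = comm A D.
  by rewrite fD commDr comm_cst addr0.
have DQ : D * Mi mu p1 Q = Mi mu p1 Q * D by rewrite /D /Mi MrMC.
have DN : D * Mi mu p1 N = Mi mu p1 N * D by rewrite /D /Mi MrMC.
rewrite -/(Mi mu p1 Q) -/(Mi mu p1 N) mulrBr /comm mulrBl; congr (_ - _).
  rewrite -!mulrA Mi_id// DQ !mulrA; congr (_ * D).
  by rewrite NAQ.
rewrite !mulrA -DN -(mulrA D (Mi mu p1 N) (Mi mu p1 N)) Mi_id//.
by rewrite -!mulrA [Mi mu p1 N * _]mulrA NAQ.
Qed.

Lemma sum_nr_oscillation t rho J (S : set (borel X)) (z : X) v :
  0 < t -> slow_partition t rho -> measurable S ->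
  (forall x : X, S x -> mdist x z <= t^-1) ->
  \sum_(j < J) nr (Mr ((rootp p rho j \- cst (rootp p rho j z)) \* \1_S) v) `^ p
    <= t * nr v `^ p.
Proof.
move=> t0 srho mS Sz.
apply: (@sum_nr_Mr _ _ _ mu p p1 J
  (fun j => (rootp p rho j \- cst (rootp p rho j z)) \* \1_S)) => [j|x].
  apply: bmfunM; last exact: bmfun_indic.
  by apply: bmfunB; [exact: bmfun_rootp srho|exact: bmfun_cst].
have [mrho rho0 rho1 rhoS rhot] := srho.
have [xS|xS] := boolP (x \in S); last first.
  rewrite big1 => [|j _]; last first.
    by rewrite /= indicE (negbTE xS) mulr0 normr0 powR0// gt_eqF.
  exact: ltW.
apply: le_trans (rhot J x z (Sz x (set_mem xS))); apply: ler_sum => j _.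
rewrite /= indicE xS mulr1; apply: ler_powR_rootB => //; exact: ltW.
Qed.

(** On each piece [Q k] the commutator is controlled by the oscillation of the
    partition functions on the bounded set [N k], which is at most [t] once [1/t]
    exceeds the size of [N k]; the pieces are then summed using the bounded overlap
    of the sets [N k]. *)
Theorem band_small r A : bounded_geometry X -> band r A -> small (comm A).
Proof.
move=> Xbg rA e e0.
have [c [z [Q [N [M [mQN [QN Nz] QNr [Q1 Qcvg] N_M]]]]]] :=
  bounded_geometry_partition Xbg r.
have mQ k := (mQN k).1; have mN k := (mQN k).2.
have [q q0 pq] := conjugate_exponent p1.
pose K : R := M%:R `^ (p - 1) * (2 `^ p * (2 * nr A `^ p)).
have K0 : 0 <= K by rewrite mulr_ge0 ?powR_ge0// !mulr_ge0 ?powR_ge0.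
pose c1 := Num.max c 1; have c10 : 0 < c1 by rewrite lt_max ltr01 orbT.
have K10 : 0 < K + 1 by rewrite ltr_wpDl.
exists (Num.min c1^-1 (e / (K + 1))).
  by rewrite lt_min invr_gt0 c10 divr_gt0.
move=> t rho t0; rewrite le_min => /andP[tc te] srho J u.
have ct : c <= t^-1.
  apply: (@le_trans _ _ c1); first by rewrite le_max lexx.
  by rewrite -[leLHS]invrK lef_pV2 ?posrE ?invr_gt0.
have NAQ k : Mi mu p1 (N k) * A * Mi mu p1 (Q k) = A * Mi mu p1 (Q k).
  rewrite -[RHS]mul1r -(MiC mu p1 (mN k)) mulrDl mulrA [X in _ + X]mulrA.
  rewrite (rA (Q k) (~` N k)) ?addr0//; first exact: measurableC.
  exact: QNr.
have bQ k := @bmfun_indic _ _ R _ (mQ k); have bN k := @bmfun_indic _ _ R _ (mN k).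
pose phi := rootp p rho; pose M_ j : bop E := Mr (phi j).
pose S k : bop E := Mi mu p1 (Q k).
pose h k j : borel X -> R := (phi j \- cst (phi j (z k))) \* \1_(Q k).
pose h' k j : borel X -> R := (phi j \- cst (phi j (z k))) \* \1_(N k).
pose g j k : E := A (Mr (h k j) (S k u)) - Mr (h' k j) (A (S k u)).
pose w n : E := Mr (fun x => \sum_(k < n) \1_(Q k) x) u.
have wE n : w n = \sum_(k < n) S k u.
  by rewrite /w -(Mr_sum mu p1 (index_enum _) (fun k : 'I_n => bQ k)) bop_sumE.
have wu : nrcvg w u.
  apply: (@Mr_nrcvg1 _ _ _ mu p p1 _ u 1) => [n|n x|x]; last exact: Qcvg.
    by apply: (@bmfun_sum _ _ R _ (index_enum _) (fun k : 'I_n => \1_(Q k))) => k.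
  have S0 : 0 <= \sum_(k < n) (\1_(Q k) x : R).
    by apply: sumr_ge0 => k _; rewrite indicE.
  by rewrite ger0_norm ?subr_ge0 ?Q1// gerBl.
apply: (@nrcvg_sum_pow J (fun j => comm A (M_ j)) w) => // n.
have step j : nr (comm A (M_ j) (w n)) `^ p <=
    M%:R `^ (p - 1) * \sum_(k < n) nr (g j k) `^ p.
  have -> : comm A (M_ j) (w n) = \sum_(k < n) Mr \1_(N k) (g j k).
    rewrite wE linear_sum /=; apply: eq_bigr => k _.
    have loc := comm_localize (phi j (z k)) (bmfun_rootp j p0 srho) (mQ k) (mN k) (NAQ k).
    by rewrite -[LHS]/((comm A (Mr (phi j)) * Mi mu p1 (Q k)) u) loc.
  apply: (@nr_sum_Mr _ _ _ mu p p1 q n (fun k => \1_(N k)) (g j)) => //.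
  move=> x; apply: le_trans (N_M x n); apply: ler_sum => k _.
  by rewrite indicE; case: (_ \in _); rewrite /= ?powR1 ?powR0// gt_eqF.
apply: (@le_trans _ _ (\sum_(j < J) M%:R `^ (p - 1) *
    \sum_(k < n) nr (g j k) `^ p)); first by apply: ler_sum => j _; exact: step.
rewrite -mulr_sumr exchange_big /=.
have gk k : \sum_(j < J) nr (g j k) `^ p <=
    2 `^ p * (2 * nr A `^ p) * (t * nr (S k u) `^ p).
  have Nt (x : X) : N k x -> mdist x (z k) <= t^-1.
    move=> /Nz; rewrite ballEmdist /= metric_sym => /ltW xz.
    exact: le_trans ct.
  have Qt (x : X) : Q k x -> mdist x (z k) <= t^-1 by move=> /QN; exact: Nt.
  have o1 := sum_nr_oscillation J (S k u) t0 srho (mQ k) Qt.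
  have o2 := sum_nr_oscillation J (A (S k u)) t0 srho (mN k) Nt.
  have o2' : t * nr (A (S k u)) `^ p <= nr A `^ p * (t * nr (S k u) `^ p).
    by rewrite mulrCA ler_wpM2l ?(ltW t0)// nr_pow_bop.
  have o1' := ler_wpM2l (powR_ge0 (nr A) p) o1.
  rewrite -mulrA -mulrA mulr_natl mulr2n.
  apply: le_trans (ler_wpM2l (ltW powp_gt0) (lerD o1' (le_trans o2 o2'))).
  rewrite mulr_sumr -big_split /= mulr_sumr; apply: ler_sum => j _.
  apply: le_trans (nr_powD _ _) _; rewrite nrN ler_wpM2l ?powR_ge0// lerD2r.
  exact: nr_pow_bop.
have gs : \sum_(k < n) \sum_(j < J) nr (g j k) `^ p <=
    2 `^ p * (2 * nr A `^ p) * (t * nr u `^ p).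
  apply: (@le_trans _ _ (\sum_(k < n) 2 `^ p * (2 * nr A `^ p) *
    (t * nr (S k u) `^ p))); first by apply: ler_sum => k _; exact: gk.
  rewrite -!mulr_sumr ler_wpM2l ?mulr_ge0 ?powR_ge0// ler_wpM2l ?(ltW t0)//.
  rewrite -[leRHS]mul1r.
  apply: (@sum_nr_Mr _ _ _ mu p p1 n (fun k => \1_(Q k))) => // x.
  apply: le_trans (Q1 x n); apply: ler_sum => k _.
  by rewrite indicE; case: (_ \in _); rewrite /= ?normr1 ?normr0 ?powR1 ?powR0// gt_eqF.
apply: le_trans (ler_wpM2l (powR_ge0 _ _) gs) _.
rewrite [leLHS](_ : _ = K * t * nr u `^ p); last by rewrite /K !mulrA.
rewrite ler_wpM2r ?powR_ge0//.
apply: (@le_trans _ _ ((K + 1) * t)); first by rewrite ler_wpM2r ?(ltW t0)// lerDl.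
by rewrite mulrC -ler_pdivlMr.
Qed.

Lemma nneseries_EFin_partial (a : nat -> R) (l : R) : (forall j, 0 <= a j) ->
  (\sum_(0 <= j <oo) (a j)%:E = l%:E)%E ->
  (forall J, \sum_(j < J) a j <= l) /\
  (fun J => \sum_(j < J) a j) @ \oo --> l.
Proof.
move=> a0 al.
have c : (fun J => (\sum_(j < J) a j)%:E) @ \oo --> l%:E.
  rewrite -al; under eq_fun do rewrite -sumEFin -(big_mkord xpredT (fun j => (a j)%:E)).
  by apply: is_cvg_nneseries => j _ _; rewrite lee_fin.
split; last exact: fine_cvg c.
move=> J; rewrite -lee_fin -al -sumEFin -(big_mkord xpredT (fun j => (a j)%:E)).
by apply: nneseries_lim_ge => j _ _; rewrite lee_fin.
Qed.

Lemma propertyA'_partition t : propertyA' X -> 0 < t -> exists rho (S : R),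
  slow_partition t rho /\
  forall j (x y : X), rho j x != 0 -> rho j y != 0 -> mdist x y <= S.
Proof.
move=> XA t0; have [rho [rhoP rho1 rhoD rhot _]] := XA t t0.
have rho0 j x : 0 <= rho j x by have [_ /(_ x)/andP[]] := rhoP j.
set D := ereal_sup _ in rhoD.
have diamD j (x y : X) : rho j x != 0 -> rho j y != 0 -> ((mdist x y)%:E <= D)%E.
  move=> xj yj; apply: (@le_trans _ _ (diam (spt (rho j)))).
    apply: ereal_sup_ubound; exists x; first exact: subset_closure.
    by exists y => //; exact: subset_closure.
  by apply: ereal_sup_ubound; exists j.
exists rho, (fine D); split; last first.
  by move=> j x y xj yj; have := diamD j x y xj yj; move: rhoD; clear diamD; case: D.
split => //.
- by move=> j; have [] := rhoP j.
- by move=> J x; exact: (nneseries_EFin_partial (rho0^~ x) (rho1 x)).1.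
- by move=> x; exact: (nneseries_EFin_partial (rho0^~ x) (rho1 x)).2.
move=> J x y xy; rewrite -lee_fin (le_trans _ (ltW (rhot x y xy)))//.
rewrite -sumEFin -(big_mkord xpredT (fun j => `|rho j x - rho j y|%:E)).
by apply: nneseries_lim_ge => j _ _; rewrite lee_fin.
Qed.

Section Averaging.
Variables (A : bop E) (t : R) (rho : nat -> borel X -> R) (q : R).
Hypotheses (srho : slow_partition t rho) (q0 : 0 < q) (pq : p^-1 + q^-1 = 1).

(** In the limit [J -> oo] this is an operator of finite propagation, as both
    factors around [A] live on the support of [rho j]. The exponents [1/q] and [1/p]
    add up to 1, and each is the one for which the corresponding estimate
    ([nr_sum_Mr], [sum_nr_Mr]) has constant 1. *)
Definition averaged (J : nat) : bop E :=
  \sum_(j < J) Mr (rootp q rho j) * A * Mr (rootp p rho j).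

Lemma averagedE J u :
  averaged J u = \sum_(j < J) Mr (rootp q rho j) (A (Mr (rootp p rho j) u)).
Proof. by rewrite /averaged bop_sumE. Qed.

Lemma nr_sum_rootq J (v : nat -> E) :
  nr (\sum_(j < J) Mr (rootp q rho j) (v j)) `^ p <= \sum_(j < J) nr (v j) `^ p.
Proof.
have := @nr_sum_Mr _ _ _ mu p p1 q J (rootp q rho) v 1 q0 pq.
rewrite powR1 mul1r; apply => [j|j x|x].
- exact: bmfun_rootp srho.
- exact: powR_ge0.
- exact: sum_rootp srho.
Qed.

Let s u J := \sum_(j < J) nr (Mr (rootp p rho j) u) `^ p.

Lemma averaged_tail u m n : (m <= n)%N ->
  nr (averaged n u - averaged m u) `^ p <= nr A `^ p * (s u n - s u m).
Proof.
move=> mn; rewrite !averagedE /s.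
pose f j := Mr (rootp q rho j) (A (Mr (rootp p rho j) u)).
pose v j := if (j < m)%N then 0 else A (Mr (rootp p rho j) u).
have split_sum (V : zmodType) (F G : nat -> V) :
    (forall j, (j < m)%N -> G j = 0) -> (forall j, (m <= j)%N -> G j = F j) ->
    \sum_(j < n) F j - \sum_(j < m) F j = \sum_(j < n) G j.
  move=> G0 GF; rewrite -!(big_mkord xpredT) (big_cat_nat _ mn)//=.
  rewrite [RHS](big_cat_nat _ mn)//= [LHS]addrC addKr.
  have -> : \sum_(0 <= j < m) G j = 0.
    by rewrite big_nat_cond big1// => j /andP[/andP[_ jm] _]; exact: G0.
  by rewrite add0r; apply: eq_big_nat => j /andP[mj _]; rewrite GF.
rewrite (split_sum _ f (fun j => Mr (rootp q rho j) (v j))); last 2 first.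
- by move=> j jm; rewrite /v jm linear0.
- by move=> j mj; rewrite /v ltnNge mj.
apply: le_trans (nr_sum_rootq n v) _.
rewrite (split_sum _ (fun j => nr (Mr (rootp p rho j) u) `^ p)
  (fun j => if (j < m)%N then 0 else nr (Mr (rootp p rho j) u) `^ p)).
- rewrite mulr_sumr; apply: ler_sum => j _; rewrite /v; case: ifP => _.
    by rewrite nr0 powR0 ?mulr0// gt_eqF.
  exact: nr_pow_bop.
- by move=> j ->.
- by move=> j mj; rewrite ltnNge mj.
Qed.

Lemma nr_averaged J u : nr (averaged J u) <= nr A * nr u.
Proof.
apply: (powR_le_ler p0); rewrite ?mulr_ge0 ?nr_ge0//.
have := averaged_tail u (leq0n J).
rewrite /averaged /s !big_ord0 /= !subr0 => /le_trans; apply.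
rewrite powRM ?nr_ge0// ler_wpM2l ?powR_ge0//.
exact: sum_nr_rootp srho.
Qed.

Lemma averaged_cauchy u : nrcauchy (averaged^~ u).
Proof.
have nds : nondecreasing_seq (s u).
  apply/nondecreasing_seqP => n.
  by rewrite /s big_ord_recr /= lerDl powR_ge0.
have cs : cvgn (s u).
  apply: nondecreasing_is_cvgn nds _.
  by exists (nr u `^ p) => _ [n _ <-]; exact: sum_nr_rootp srho.
move=> e e0; pose a := nr A `^ p + 1.
have a0 : 0 < a by rewrite ltr_wpDl// powR_ge0.
have d0 : 0 < e `^ p / (2 * a) by rewrite divr_gt0 ?powR_gt0// mulr_gt0.
have [n0 _ n0P] := (cvgrPdist_lt _ _).1 cs _ d0.
have aux n m : (n0 <= n)%N -> (n0 <= m)%N -> (m <= n)%N ->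
    nr (averaged n u - averaged m u) < e.
  move=> /n0P /= hn /n0P /= hm mn.
  rewrite ltNge; apply/negP => /(ler_powRr (ltW p0) (ltW e0)); apply/negP.
  rewrite -ltNge; apply: le_lt_trans (averaged_tail u mn) _.
  have snm : s u n - s u m < e `^ p / a.
    have -> : e `^ p / a = e `^ p / (2 * a) + e `^ p / (2 * a).
      by field; rewrite gt_eqF.
    rewrite -(subrKA (lim (s u @ \oo))); apply: ltrD.
      by apply: le_lt_trans hn; rewrite -normrN opprB ler_norm.
    by apply: le_lt_trans hm; exact: ler_norm.
  have s0 : 0 <= s u n - s u m by rewrite subr_ge0; exact: nds.
  rewrite ltr_pdivlMr// mulrC in snm; apply: le_lt_trans snm.
  by rewrite ler_wpM2r// lerDl.
exists n0 => n m hn hm; have [mn|/ltnW nm] := leqP m n; first exact: aux.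
by rewrite nrBC; exact: aux.
Qed.

(** Moving the factor [rho j ^ (1/p)] across [A] turns the average into [A], up to
    commutators. *)
Lemma averaged_defect J u : averaged J u =
  Mr (fun x => \sum_(j < J) rho j x) (A u) +
  \sum_(j < J) Mr (rootp q rho j) (comm A (Mr (rootp p rho j)) u).
Proof.
have brho j : bmfun (rho j).
  split; first by case: srho.
  exists 1 => x; rewrite ger0_norm; last by case: srho.
  exact: slow_partition_le1 srho.
rewrite averagedE -(Mr_sum mu p1 (index_enum _) (fun j : 'I_J => brho j)).
rewrite bop_sumE -big_split; apply: eq_bigr => j _.
rewrite commE linearB.
have -> : Mr (rho j) = Mr (rootp q rho j) * Mr (rootp p rho j) :> bop E.
  rewrite MrM; [|exact: bmfun_rootp srho|exact: bmfun_rootp srho].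
  congr Mr; apply/funext => x; rewrite /= /rootp -powRD; last first.
    by rewrite addrC pq oner_eq0.
  by rewrite addrC pq powRr1//; case: srho.
by rewrite bopME; exact/esym/subrKC.
Qed.

End Averaging.

(** The averages of [A] over a slow partition have finite propagation, since the
    members of the partition have uniformly bounded diameter, and
    [averaged_defect] bounds their distance to [A]. *)
Theorem small_BDO A : propertyA' X -> small (comm A) -> BDO mu (Lp_ge1 p1) A.
Proof.
move=> XA sA; apply/closure_nrP => e e0.
have [q q0 pq] := conjugate_exponent p1.
have ep0 : 0 < (e / 2) `^ p by rewrite powR_gt0// divr_gt0.
have [t t0 /(_ t)] := sA _ ep0.
have [rho [S [srho rhoS]]] := propertyA'_partition XA t0.
move=> /(_ rho t0 (lexx _) srho) At.
have [B BP] := bop_strong_limit (@Lp_complete _ _ _ mu p p1)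
  (nr_averaged A srho q0 pq) (averaged_cauchy A srho q0 pq).
exists B.
  apply/BOP; exists (S + 1) => K K' mK mK' KK'; apply: bop_eqP => u.
  rewrite bop0E; apply: (nrcvg_unique (nrcvg_bop (Mi mu p1 K') (BP (Mi mu p1 K u)))).
  move=> d d0; exists 0%N => n _ /=; rewrite subr0.
  rewrite averagedE linear_sum big1 ?nr0// => j _ /=.
  have [Kj|/existsNP[x /not_implyP[Kx /eqP xj]]] :=
      pselect (forall x, K x -> rho j x = 0).
    rewrite [Mr (rootp p rho j) _](_ : _ = 0) ?linear0//.
    rewrite -bopME /Mi MrM; [|exact: bmfun_rootp srho|exact: bmfun_indic].
    rewrite (_ : _ \* _ = cst 0) ?Mr0//; apply/funext => x /=.
    rewrite indicE; have [xK|] := boolP (x \in K); last by rewrite mulr0.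
    by rewrite /rootp Kj ?powR0 ?mul0r ?invr_neq0 ?gt_eqF//; exact: set_mem.
  suff Z : Mi mu p1 K' * Mr (rootp q rho j) = 0 :> bop E.
    by rewrite -[LHS]/((Mi mu p1 K' * Mr (rootp q rho j)) _) Z.
  rewrite /Mi MrM; [|exact: bmfun_indic|exact: bmfun_rootp srho].
  rewrite (_ : _ \* _ = cst 0) ?Mr0//; apply/funext => y /=.
  rewrite indicE; have [yK|] := boolP (y \in K'); last by rewrite mul0r.
  have [yj|yj] := eqVneq (rho j y) 0.
    by rewrite /rootp yj powR0 ?mulr0// invr_neq0// gt_eqF.
  have := KK' x y Kx (set_mem yK); have := rhoS j x y xj yj.
  move=> h1 h2; exfalso; lra.
apply: (@le_lt_trans _ _ (e / 2)); last by lra.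
apply: nr_bop_le => [|u]; first by rewrite divr_ge0// ltW.
rewrite [nr _]nrBC.
have rhocvg : nrcvg (fun J => Mr (fun x => \sum_(j < J) rho j x) (A u)) (A u).
  have [mrho rho0 rho1 rhoS' _] := srho.
  apply: (@Mr_nrcvg1 _ _ _ mu p p1 _ (A u) 1) => [J|J x|//].
    apply: (@bmfun_sum _ _ R _ (index_enum _) (fun j : 'I_J => rho j)) => j.
    split => //; exists 1 => x; rewrite ger0_norm//.
    exact: slow_partition_le1 srho.
  have S0 : 0 <= \sum_(j < J) rho j x by exact: sumr_ge0.
  by rewrite ger0_norm ?subr_ge0 ?rho1// gerBl.
have dcvg : nrcvg (fun J => averaged A rho q J u +
    (-1 : R[i]) *: Mr (fun x => \sum_(j < J) rho j x) (A u)) (B u + (-1 : R[i]) *: A u).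
  by apply: nrcvgD; [exact: BP|exact: nrcvgZ].
rewrite -scaleN1r; apply: (nrcvg_le0 dcvg) => J.
rewrite scaleN1r (averaged_defect A srho q0 pq) addrAC subrr add0r.
apply: (powR_le_ler p0); rewrite ?mulr_ge0 ?nr_ge0 ?divr_ge0 ?(ltW e0)//.
apply: le_trans (nr_sum_rootq srho q0 pq J
  (fun j => comm A (Mr (rootp p rho j)) u)) _.
by rewrite powRM ?nr_ge0 ?divr_ge0 ?(ltW e0).
Qed.

Lemma BDO_small A : bounded_geometry X -> BDO mu (Lp_ge1 p1) A -> small (comm A).
Proof.
move=> Xbg /closure_nrP clA; apply: small_comm_closed => e /clA[B].
by move=> /BOP[r rB] AB; exists B => //; exact: band_small rB.
Qed.

(** A commutator identity expresses [[B, C]] through [B [A, C] B] and commutators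
    with compact operators. All of these are small: [A] is band-dominated, and so
    are the compact operators. *)
Theorem regulariser_BDO A B : bounded_geometry X -> propertyA' X ->
  BDO mu (Lp_ge1 p1) A -> regulariser A B -> BDO mu (Lp_ge1 p1) B.
Proof.
move=> Xbg XA bA [cK cL].
have cE := @Lp_complete _ _ _ mu p p1.
set K := A * B - 1 in cK; set L := B * A - 1 in cL.
have sA := BDO_small Xbg bA.
have sK := BDO_small Xbg (compact_BDO cK).
have sL := BDO_small Xbg (compact_BDO cL).
have sLB : small (comm (L * B)).
  apply: BDO_small Xbg (compact_BDO _); apply/compact_opP => //.
  by apply: totally_bounded_opMr; exact/compact_opP.
apply: (small_BDO XA).
have := smallD (smallD (smallN (smallMl B (smallMr B sA)))
  (smallD (smallMr B sL) (smallMl B sK))) (smallN sLB).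
apply: small_eq => C.
have AB : A * B = 1 + K by rewrite /K addrC subrK.
have BA : B * A = 1 + L by rewrite /L addrC subrK.
have LB : L * B = B * K by rewrite /L /K mulrBl mulrBr mul1r mulr1 mulrA.
have h1 : B * (comm A C * B) = C * B + L * C * B - (B * C + B * C * K).
  rewrite /comm mulrBl mulrBr !mulrA BA -[B * C * A * B]mulrA AB.
  by rewrite !mulrDl mul1r mulrDr mulr1.
have h2 : comm L C * B = L * C * B - C * L * B by rewrite /comm mulrBl.
have h3 : B * comm K C = B * K * C - B * C * K by rewrite /comm mulrBr !mulrA.
have h4 : comm (L * B) C = B * K * C - C * L * B.
  by rewrite /comm {1}LB mulrA.
have cancel6 (V : zmodType) (a b x y z w : V) :
    - ((b + y) - (a + x)) + ((y - z) + (w - x)) + - (w - z) = a - b.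
  have -> : - ((b + y) - (a + x)) = (a - b) + (x - y) by rewrite opprB opprD addrACA.
  have -> : (y - z) + (w - x) = (y - x) + (w - z).
    by rewrite addrACA [RHS]addrACA; congr (_ + _); exact: addrC.
  by rewrite addrA addrK -addrA subrKA subrr addr0.
by rewrite h1 h2 h3 h4; exact: cancel6.
Qed.

End Commutators.

(** * Convexity of the p-th power of the modulus *)

Section UniformConvexity.
Variables (R : realType) (p : R) (p1 : 1 < p).
Implicit Types (x y m d k : R) (a b : R[i]).

Let p0 : 0 < p. Proof. exact: lt_trans p1. Qed.

Lemma bernoulli_powR x : -1 <= x -> 1 + p * x <= (1 + x) `^ p.
Proof.
move=> x1; have [q q0 pq] := conjugate_exponent p1.
have h := @conjugate_powR R (1 + x) 1 p q.
have {h} : (1 + x) * 1 <= (1 + x) `^ p / p + 1 `^ q / q.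
  by apply: h => //; lra.
have -> : q^-1 = 1 - p^-1 by rewrite -pq; lra.
rewrite powR1 mulr1 mul1r => h.
have : p * (1 + x) <= p * ((1 + x) `^ p / p + (1 - p^-1)).
  by rewrite ler_wpM2l// ltW.
have -> : p * ((1 + x) `^ p / p + (1 - p^-1)) = (1 + x) `^ p + p - 1.
  by field; rewrite gt_eqF.
lra.
Qed.

(** Bernoulli's inequality for [sqrt (1 + x)], squared, gains a quadratic term. *)
Lemma bernoulli_powR_strict x : 0 <= x <= 1 ->
  1 + p * x + p * (p - 1) / 9 * x ^+ 2 <= (1 + x) `^ p.
Proof.
move=> /andP[x0 x1]; set y := Num.sqrt (1 + x) - 1.
have s0 : 0 <= Num.sqrt (1 + x) by exact: sqrtr_ge0.
have s2 : Num.sqrt (1 + x) ^+ 2 = 1 + x by rewrite sqr_sqrtr//; lra.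
have y0 : 0 <= y by rewrite subr_ge0 -[leLHS]sqrtr1 ler_wsqrtr// lerDl.
have yE : 1 + y = Num.sqrt (1 + x) by rewrite /y; lra.
have xE : x = 2 * y + y ^+ 2.
  by have := s2; rewrite -yE => h; rewrite -[LHS](addKr 1) -h; ring.
have hy := @bernoulli_powR y (ltac:(lra)).
have -> : (1 + x) `^ p = ((1 + y) `^ p) ^+ 2.
  have y10 : 0 <= 1 + y by rewrite yE.
  by rewrite -s2 -yE !expr2 (powRM p y10 y10).
have h2 : (1 + p * y) ^+ 2 <= ((1 + y) `^ p) ^+ 2.
  rewrite ler_sqr ?nnegrE ?powR_ge0// addr_ge0// mulr_ge0//; exact: ltW.
apply: le_trans h2.
have xy : x <= 3 * y.
  have : y <= 1 by nra.
  rewrite xE; nra.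
have : x ^+ 2 <= 9 * y ^+ 2 by nra.
have pp : 0 <= p * (p - 1) by apply: mulr_ge0; rewrite ?subr_ge0 ltW.
move=> hx; have : p * (p - 1) / 9 * x ^+ 2 <= p * (p - 1) * y ^+ 2.
  rewrite -mulrA ler_wpM2l//; lra.
rewrite {2}xE; nra.
Qed.

(** Write [x] and [y] as [s (1 + t)] and [s (1 - t)]: the strict Bernoulli inequality
    for the first and the usual one for the second. *)
Lemma powR_midpoint x y : 0 <= y -> y <= x ->
  2 * ((x + y) / 2) `^ p + p * (p - 1) / 9 * ((x + y) / 2) `^ p *
    ((x - y) / (x + y)) ^+ 2 <= x `^ p + y `^ p.
Proof.
move=> y0 yx; set s := (x + y) / 2.
have [s0|s0] := eqVneq s 0.
  have [-> ->] : x = 0 /\ y = 0 by move: s0; rewrite /s; split; lra.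
  by rewrite s0 powR0 ?gt_eqF// !(mulr0, mul0r) addr0.
have {}s0 : 0 < s by rewrite lt_neqAle eq_sym s0 /s; lra.
set t := (x - y) / (x + y).
have xy0 : 0 < x + y by move: s0; rewrite /s; lra.
have t01 : 0 <= t <= 1.
  rewrite /t divr_ge0 ?subr_ge0 ?(ltW xy0)//= ler_pdivrMr//; lra.
have xE : x = s * (1 + t) by rewrite /s /t; field; rewrite gt_eqF.
have yE : y = s * (1 - t) by rewrite /s /t; field; rewrite gt_eqF.
case/andP: t01 => t0 t1.
have t10 : 0 <= 1 + t by lra.
have t10' : 0 <= 1 - t by lra.
have -> : x `^ p = s `^ p * (1 + t) `^ p by rewrite {1}xE (powRM p (ltW s0) t10).
have -> : y `^ p = s `^ p * (1 - t) `^ p by rewrite {1}yE (powRM p (ltW s0) t10').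
have h1 := @bernoulli_powR_strict t (ltac:(rewrite t0 t1; done)).
have h2 := @bernoulli_powR (- t) (ltac:(lra)).
have sp : 0 <= s `^ p by exact: powR_ge0.
have := ler_wpM2l sp (lerD h1 h2); lra.
Qed.

Lemma powR_midpoint_le x y : 0 <= y -> y <= x ->
  2 * ((x + y) / 2) `^ p <= x `^ p + y `^ p.
Proof.
move=> y0 yx; apply: le_trans (powR_midpoint y0 yx); rewrite lerDl.
apply: mulr_ge0; last exact: sqr_ge0.
apply: mulr_ge0; last exact: powR_ge0.
apply: divr_ge0 => //; apply: mulr_ge0; rewrite ?subr_ge0 ltW//.
Qed.

(** For complex numbers of modulus [x] and [y], the modulus [m] of the midpoint and
    half the distance [d] satisfy the parallelogram law. If [d] is comparable to the
    mean of the moduli, then either the moduli differ, and [powR_midpoint] gives a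
    loss, or the directions do, and [m] is at most a fixed fraction [th] of the
    mean. *)
Lemma powR_midpoint_defect k : 0 < k -> k <= 1 -> exists2 c : R, 0 < c &
  forall x y m d, 0 <= y -> y <= x -> 0 <= m -> 0 <= d -> m <= (x + y) / 2 ->
    m ^+ 2 + d ^+ 2 = (x ^+ 2 + y ^+ 2) / 2 -> k * ((x + y) / 2) <= d ->
    c * ((x + y) / 2) `^ p <= x `^ p + y `^ p - 2 * m `^ p.
Proof.
move=> k0 k1; set c1 : R := 3 / 4; set c2 : R := p * (p - 1) / 36.
have pp : 0 < p * (p - 1) by rewrite mulr_gt0// subr_gt0.
have c20 : 0 < c2 by rewrite divr_gt0.
have c10 : 0 < c1 by rewrite divr_gt0.
exists (k ^+ 2 * Num.min c1 c2).
  by rewrite mulr_gt0 ?exprn_gt0// lt_min c10 c20.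
move=> x y m d y0 yx m0 d0 ms pyth ksd; set s := (x + y) / 2 in ms ksd *.
have sp : 0 <= s `^ p by exact: powR_ge0.
have s0 : 0 <= s by exact: le_trans ms.
have mp : m `^ p <= s `^ p by rewrite ler_powRr// ltW.
have mid := powR_midpoint y0 yx; rewrite -/s in mid.
have [s00|s00] := eqVneq s 0.
  move: mid mp; rewrite s00 powR0 ?gt_eqF// !(mulr0, mul0r) => h1 h2.
  have := powR_ge0 m p; lra.
have {}s00 : 0 < s by rewrite lt_neqAle eq_sym s00.
have k20 : 0 <= k ^+ 2 by exact: sqr_ge0.
(* If [x - y < d], then [m^2 = s^2 + ((x - y) / 2)^2 - d^2 <= s^2 - 3/4 d^2], and
   [th = 1 - 3/8 k^2] satisfies [th^2 >= 1 - 3/4 k^2]. *)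
have [rd|dr] := leP (d / 2) ((x - y) / 2).
  set t := (x - y) / (x + y) in mid.
  have tk : k / 2 <= t.
    rewrite /t ler_pdivlMr; last by move: s00; rewrite /s; lra.
    apply: (@le_trans _ _ d); last by lra.
    by apply: le_trans ksd; rewrite /s; lra.
  have tk2 : k ^+ 2 / 4 <= t ^+ 2.
    have : (k / 2) ^+ 2 <= t ^+ 2 by rewrite ler_sqr ?nnegrE//; lra.
    by rewrite expr_div_n; apply: le_trans; rewrite expr2; lra.
  have : p * (p - 1) / 9 * s `^ p * (k ^+ 2 / 4) <= p * (p - 1) / 9 * s `^ p * t ^+ 2.
    by rewrite ler_wpM2l// mulr_ge0// divr_ge0// ltW.
  have -> : p * (p - 1) / 9 * s `^ p * (k ^+ 2 / 4) = k ^+ 2 * c2 * s `^ p.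
    by rewrite /c2; field.
  have : k ^+ 2 * Num.min c1 c2 * s `^ p <= k ^+ 2 * c2 * s `^ p.
    by rewrite ler_wpM2r// ler_wpM2l// ge_min lexx orbT.
  move: mid mp; lra.
pose th := 1 - 3 / 8 * k ^+ 2.
have k21 : k ^+ 2 <= 1 by rewrite expr_le1// ltW.
have th0 : 0 < th by rewrite /th; lra.
have th1 : th <= 1 by rewrite /th; lra.
have mth : m <= th * s.
  have d2 : (k * s) ^+ 2 <= d ^+ 2 by rewrite ler_sqr ?nnegrE// mulr_ge0// ltW.
  have r2 : ((x - y) / 2) ^+ 2 <= (d / 2) ^+ 2.
    by rewrite ler_sqr ?nnegrE ?divr_ge0 ?subr_ge0// ltW.
  have ths : 0 <= th * s by apply: mulr_ge0 => //; exact: ltW.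
  rewrite -ler_sqr ?nnegrE//.
  have : m ^+ 2 = s ^+ 2 + ((x - y) / 2) ^+ 2 - d ^+ 2.
    by move: pyth; rewrite /s; lra.
  have : (d / 2) ^+ 2 = d ^+ 2 / 4 by rewrite expr_div_n; congr (_ / _); ring.
  have : (k * s) ^+ 2 = k ^+ 2 * s ^+ 2 by rewrite exprMn.
  have : (th * s) ^+ 2 = th ^+ 2 * s ^+ 2 by rewrite exprMn.
  have : (1 - 3 / 4 * k ^+ 2) * s ^+ 2 <= th ^+ 2 * s ^+ 2.
    rewrite ler_wpM2r ?sqr_ge0// /th; have := sqr_ge0 (3 / 8 * k ^+ 2); lra.
  lra.
have mp' : m `^ p <= th * s `^ p.
  apply: le_trans (ler_powRr (ltW p0) m0 mth) _.
  rewrite powRM ?(ltW th0)// ler_wpM2r// ge1r_powR ?th0//; exact: ltW.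
have : k ^+ 2 * Num.min c1 c2 * s `^ p <= k ^+ 2 * c1 * s `^ p.
  by rewrite ler_wpM2r// ler_wpM2l// ge_min lexx.
have : 0 <= p * (p - 1) / 9 * s `^ p * ((x - y) / (x + y)) ^+ 2.
  by rewrite mulr_ge0 ?sqr_ge0// mulr_ge0// divr_ge0// ltW.
have : 2 * (th * s `^ p) = 2 * s `^ p - k ^+ 2 * c1 * s `^ p.
  by rewrite /th /c1; field.
move: mid mp'; lra.
Qed.

Lemma normc_parallelogram a b : Normc.normc (a + b) ^+ 2 +
  Normc.normc (a - b) ^+ 2 = 2 * (Normc.normc a ^+ 2 + Normc.normc b ^+ 2).
Proof.
case: a b => a1 a2 [b1 b2] /=.
by rewrite !sqr_sqrtr ?addr_ge0 ?sqr_ge0//; ring.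
Qed.

Lemma normc_ge0 a : 0 <= Normc.normc a.
Proof. by case: a => ? ?; exact: sqrtr_ge0. Qed.

Lemma normc_half a b :
  Normc.normc ((2^-1)%:C * (a + b)) = Normc.normc (a + b) / 2.
Proof.
by rewrite Normc.normcM normc_real ger0_norm ?invr_ge0// mulrC.
Qed.

Lemma powR_normc_convex a b :
  2 * Normc.normc ((2^-1)%:C * (a + b)) `^ p <=
    Normc.normc a `^ p + Normc.normc b `^ p.
Proof.
wlog ba : a b / Normc.normc b <= Normc.normc a => [wl|].
  have [|/ltW] := leP (Normc.normc b) (Normc.normc a); first exact: wl.
  by move=> /wl; rewrite [b + a]addrC [leRHS]addrC.
have h := powR_midpoint_le (normc_ge0 b) ba; set s := (_ + _) / 2 in h.
have h3 : Normc.normc ((2^-1)%:C * (a + b)) `^ p <= s `^ p.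
  rewrite ler_powRr ?normc_ge0 ?(ltW p0)// normc_half ler_pM2r ?invr_gt0//.
  exact: le_normcD.
move: h h3; lra.
Qed.

(** Uniform convexity in a form that integrates: where [a] and [b] are far apart
    relative to their size, the midpoint loses a fixed fraction. *)
Lemma powR_normc_uniform_convexity (e : R) : 0 < e -> exists2 C : R, 0 <= C &
  forall a b, Normc.normc (a - b) `^ p <=
    e * (Normc.normc a `^ p + Normc.normc b `^ p) +
    C * (Normc.normc a `^ p + Normc.normc b `^ p -
         2 * Normc.normc ((2^-1)%:C * (a + b)) `^ p).
Proof.
move=> e0; set k := Num.min 1 ((2 * e) `^ p^-1 / 2).
have k0 : 0 < k by rewrite lt_min ltr01 divr_gt0// powR_gt0// mulr_gt0.
have k1 : k <= 1 by rewrite ge_min lexx.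
have [c c0 cP] := powR_midpoint_defect k0 k1.
have p2 : 0 < 2 `^ p :> R by rewrite powR_gt0.
exists (2 `^ p / c) => [|a b]; first by rewrite divr_ge0 ?ltW.
wlog ba : a b / Normc.normc b <= Normc.normc a => [wl|].
  have [|/ltW ab] := leP (Normc.normc b) (Normc.normc a); first exact: wl.
  have := wl b a ab.
  by rewrite [b + a]addrC [Normc.normc b `^ p + _]addrC -opprB normcN.
set x := Normc.normc a in ba *; set y := Normc.normc b in ba *.
set m := Normc.normc ((2^-1)%:C * (a + b)).
have F0 : 0 <= x `^ p + y `^ p - 2 * m `^ p by rewrite subr_ge0 powR_normc_convex.
have y0 : 0 <= y by exact: normc_ge0.
have C0 : 0 <= 2 `^ p / c by rewrite divr_ge0 ?ltW.
have [small|large] := leP (Normc.normc (a - b) `^ p) (e * (x `^ p + y `^ p)).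
  by rewrite (le_trans small)// lerDl mulr_ge0.
set d := Normc.normc (a - b) / 2; set s := (x + y) / 2.
have d0 : 0 <= d by rewrite divr_ge0 ?normc_ge0.
have s0 : 0 <= s by rewrite divr_ge0 ?addr_ge0 ?normc_ge0.
have ms : m <= s by rewrite /m normc_half ler_pM2r ?invr_gt0// le_normcD.
have dE : Normc.normc (a - b) = 2 * d by rewrite /d; lra.
have mid : 2 * s `^ p <= x `^ p + y `^ p.
  exact: powR_midpoint_le.
have ksd : k * s <= d.
  apply: (@le_trans _ _ ((2 * e) `^ p^-1 / 2 * s)).
    by rewrite ler_wpM2r// ge_min lexx orbT.
  have : (2 * e) `^ p^-1 * s <= 2 * d; last by lra.
  apply: (powR_le_ler p0).
  - exact: mulr_ge0 (powR_ge0 _ _) s0.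
  - exact: mulr_ge0.
  have e20 : 0 <= 2 * e by rewrite mulr_ge0// ltW.
  rewrite (powRM p (powR_ge0 _ _) s0) (powR_invK p0 e20) -dE.
  apply: le_trans (ltW large); rewrite [2 * e]mulrC -mulrA.
  by rewrite ler_wpM2l// ltW.
have pyth : m ^+ 2 + d ^+ 2 = (x ^+ 2 + y ^+ 2) / 2.
  rewrite /m normc_half /d !expr_div_n -mulrDl normc_parallelogram -/x -/y.
  by field.
have key := cP x y m d y0 ba (normc_ge0 _) d0 ms pyth ksd.
apply: (@le_trans _ _ (2 `^ p / c * (c * s `^ p))); last first.
  apply: le_trans (ler_wpM2l C0 key) _; rewrite lerDr.
  by rewrite mulr_ge0 ?(ltW e0)// addr_ge0 ?powR_ge0.
rewrite mulrA divfK ?gt_eqF// -powRM// ler_powRr ?normc_ge0 ?(ltW p0)//.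
by rewrite /s mulrC divfK// (le_trans (le_normcD _ _))// normcN.
Qed.

(** The duality map [|z|^(p-2) conj z]. *)
Definition cdual (z : R[i]) : R[i] := (Normc.normc z `^ (p - 2))%:C * z^*%C.

Lemma normc_conj (z : R[i]) : Normc.normc (z^*%C) = Normc.normc z.
Proof. by case: z => a b /=; rewrite sqrrN. Qed.

Lemma normc_cdual z : Normc.normc (cdual z) = Normc.normc z `^ (p - 1).
Proof.
rewrite /cdual Normc.normcM normc_real ger0_norm ?powR_ge0// normc_conj.
have -> : p - 2 = p - 1 - 1 by lra.
by rewrite mulrC mulr_powRB1 ?normc_ge0// subr_gt0.
Qed.

Lemma mulr_cdual z : z * cdual z = (Normc.normc z `^ p)%:C.
Proof.
rewrite /cdual mulrCA.
have -> : z * z^*%C = (Normc.normc z ^+ 2)%:C.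
  by case: z => a b /=; rewrite sqr_sqrtr ?addr_ge0 ?sqr_ge0//; simpc;
     congr (_ +i* _); ring.
rewrite -rmorphM; congr _%:C; set x := Normc.normc z.
have x0 : 0 <= x by exact: normc_ge0.
have -> : p - 2 = p - 1 - 1 by lra.
rewrite mulrC expr2 -mulrA (mulr_powRB1 x0) ?subr_gt0//.
by rewrite mulr_powRB1.
Qed.

(** [p * cdual a] is the gradient of the convex function [|.|^p] at [a]. *)
Lemma powR_normc_tangent a b : Normc.normc a `^ p +
  p * complex.Re ((b - a) * cdual a) <= Normc.normc b `^ p.
Proof.
have [q q0 pq] := conjugate_exponent p1.
rewrite mulrBl ReB mulr_cdual /=.
set x := Normc.normc a; set y := Normc.normc b.
have x0 : 0 <= x by exact: normc_ge0.
have y0 : 0 <= y by exact: normc_ge0.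
have h1 : complex.Re (b * cdual a) <= y * x `^ (p - 1).
  apply: le_trans (ler_norm _) _; apply: le_trans (normc_Re _) _.
  by rewrite Normc.normcM normc_cdual.
have h2 : y * x `^ (p - 1) <= y `^ p / p + (x `^ (p - 1)) `^ q / q.
  by apply: conjugate_powR => //; exact: powR_ge0.
have qp : (p - 1) * q = p.
  have qE : q^-1 = 1 - p^-1 by rewrite -pq; lra.
  rewrite -[q]invrK qE; field; rewrite gt_eqF//= subr_eq0 gt_eqF//.
have qE : q^-1 = 1 - p^-1 by rewrite -pq; lra.
rewrite -powRrM qp qE in h2.
have h3 : p * complex.Re (b * cdual a) <= p * (y `^ p / p + x `^ p * (1 - p^-1)).
  by rewrite ler_wpM2l ?(ltW p0)// (le_trans h1).
have : p * (y `^ p / p + x `^ p * (1 - p^-1)) = y `^ p + p * x `^ p - x `^ p.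
  by field; rewrite gt_eqF.
move: h3; lra.
Qed.

End UniformConvexity.

(** * Integration of complex functions *)

Section ComplexIntegral.
Context d (T : measurableType d) (R : realType).
Variable mu : {measure set T -> \bar R}.
Implicit Types (h g : T -> R[i]) (k : T -> R).

Definition cintegrable h :=
  mu.-integrable setT (EFin \o (fun x => complex.Re (h x))) /\
  mu.-integrable setT (EFin \o (fun x => complex.Im (h x))).

Lemma ReN (a : R[i]) : complex.Re (- a) = - complex.Re a.
Proof. by case: a. Qed.

Lemma ReD (a b : R[i]) : complex.Re (a + b) = complex.Re a + complex.Re b.
Proof. by case: a b => ? ? []. Qed.

Lemma ImD (a b : R[i]) : complex.Im (a + b) = complex.Im a + complex.Im b.
Proof. by case: a b => ? ? []. Qed.

Lemma ReM (a b : R[i]) : complex.Re (a * b) =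
  complex.Re a * complex.Re b - complex.Im a * complex.Im b.
Proof. by case: a b => ? ? []. Qed.

Lemma ImM (a b : R[i]) : complex.Im (a * b) =
  complex.Re a * complex.Im b + complex.Im a * complex.Re b.
Proof. by case: a b => ? ? []. Qed.

Lemma cintegrable_dominated h k : cmeasurable h ->
  mu.-integrable setT (EFin \o k) -> (forall x, Normc.normc (h x) <= k x) ->
  cintegrable h.
Proof.
move=> [mr mi] ik hk.
split; apply: (le_integrable measurableT _ _ ik).
- exact/measurable_EFinP.
- move=> x _; rewrite lee_fin (le_trans (normc_Re _))// (le_trans (hk x))//.
  exact: ler_norm.
- exact/measurable_EFinP.
- move=> x _; rewrite lee_fin (le_trans (normc_Im _))// (le_trans (hk x))//.
  exact: ler_norm.
Qed.

(** The factor 2 comes from treating real and imaginary part separately; a sharp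
    constant would require a rotation argument. *)
Lemma normc_cintegral_le h k : cmeasurable h ->
  mu.-integrable setT (EFin \o k) -> (forall x, Normc.normc (h x) <= k x) ->
  Normc.normc (cintegral mu h) <= 2 * \int[mu]_x k x.
Proof.
move=> mh ik hk; have [ir ii] := cintegrable_dominated mh ik hk.
have abs_int (a : T -> R) : mu.-integrable setT (EFin \o a) ->
    mu.-integrable setT (EFin \o (fun x => `|a x|)).
  by move=> /integrable_abse; apply: eq_integrable.
apply: le_trans (normc_le_ReIm _) _; rewrite mulr_natl mulr2n; apply: lerD.
  apply: le_trans (le_normr_Rintegral measurableT ir) _.
  apply: le_Rintegral => //; first exact: abs_int.
  by move=> x _; exact: le_trans (normc_Re _) (hk x).
apply: le_trans (le_normr_Rintegral measurableT ii) _.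
apply: le_Rintegral => //; first exact: abs_int.
by move=> x _; exact: le_trans (normc_Im _) (hk x).
Qed.

Lemma ae_eq_cintegral h g : cmeasurable h -> cmeasurable g ->
  (\forall x \ae mu, h x = g x) -> cintegral mu h = cintegral mu g.
Proof.
move=> [hr hi] [gr gi] hg; rewrite /cintegral; congr (_ +i* _);
  congr fine; apply: ae_eq_integral; try exact: measurableT.
- exact/measurable_EFinP.
- exact/measurable_EFinP.
- by apply: filterS hg => x -> _.
- exact/measurable_EFinP.
- exact/measurable_EFinP.
- by apply: filterS hg => x -> _.
Qed.

Lemma cintegralD h g : cintegrable h -> cintegrable g ->
  cintegral mu (fun x => h x + g x) = cintegral mu h + cintegral mu g.
Proof.
move=> [hr hi] [gr gi]; rewrite /cintegral.
under eq_Rintegral do rewrite ReD.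
under [X in _ +i* X]eq_Rintegral do rewrite ImD.
by rewrite !RintegralD.
Qed.

Lemma cintegralZ (c : R[i]) h : cintegrable h ->
  cintegral mu (fun x => c * h x) = c * cintegral mu h.
Proof.
move=> [hr hi]; rewrite /cintegral.
under eq_Rintegral do rewrite ReM.
under [X in _ +i* X]eq_Rintegral do rewrite ImM.
have iZ (a : R) (f : T -> R) : mu.-integrable setT (EFin \o f) ->
    mu.-integrable setT (EFin \o (fun x => a * f x)).
  by move=> /(integrableZl measurableT a).
rewrite RintegralB//; [|exact: iZ|exact: iZ].
rewrite RintegralD//; [|exact: iZ|exact: iZ].
rewrite !RintegralZl//.
by case: c.
Qed.

End ComplexIntegral.

(** * The pairing between L^p and L^q *)

Section Pairing.
Context d (T : measurableType d) (R : realType).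
Variable mu : {measure set T -> \bar R}.
Variables (p q : R) (p1 : 1 < p) (q1 : 1 < q) (pq : p^-1 + q^-1 = 1).
Local Notation Ep := (cLspace mu (Lp_ge1 p1)).
Local Notation Eq := (cLspace mu (Lp_ge1 q1)).
Local Notation Fp := (cLfunType mu (Lp_ge1 p1)).
Local Notation Fq := (cLfunType mu (Lp_ge1 q1)).

Let p0 : 0 < p. Proof. exact: lt_trans p1. Qed.
Let q0 : 0 < q. Proof. exact: lt_trans q1. Qed.

Lemma hoelder_cmod (f : Fp) (g : Fq) :
  mu.-integrable setT (EFin \o (fun x => cmod f x * cmod g x)) /\
  \int[mu]_x (cmod f x * cmod g x) <= nr (Lclass f) * nr (Lclass g).
Proof.
have mf : measurable_fun setT (cmod f) by exact/measurable_cmod/cLfun_measurable.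
have mg : measurable_fun setT (cmod g) by exact/measurable_cmod/cLfun_measurable.
have := hoelder mu mf mg p0 q0 pq.
rewrite Lnorm1 -(Lnorm_funK f) -(Lnorm_funK g) -EFinM !nr_Lclass.
have E : (\int[mu]_x `|(EFin \o (cmod f \* cmod g)%R) x| =
    \int[mu]_x (cmod f x * cmod g x)%:E)%E.
  apply: eq_integral => x _ /=.
  by rewrite ger0_norm// mulr_ge0 ?cmod_ge0.
move=> h; have ip : mu.-integrable setT (EFin \o (fun x => cmod f x * cmod g x)).
  apply/integrableP; split; first exact/measurable_EFinP/measurable_funM.
  exact: le_lt_trans h (ltry _).
split=> //; rewrite -lee_fin /Rintegral fineK; first by rewrite -E.
exact: integrable_fin_num ip.
Qed.

Lemma normc_prod (f : Fp) (g : Fq) x :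
  Normc.normc (f x * g x) <= cmod f x * cmod g x.
Proof. by rewrite Normc.normcM. Qed.

Lemma cmeasurable_prod (f : Fp) (g : Fq) : cmeasurable (fun x => f x * g x).
Proof. by apply: cmeasurableM; exact: cLfun_measurable. Qed.

Lemma cintegrable_prod (f : Fp) (g : Fq) : cintegrable mu (fun x => f x * g x).
Proof.
exact: cintegrable_dominated (cmeasurable_prod f g) (hoelder_cmod f g).1
  (normc_prod f g).
Qed.

Lemma pairing_class (f : Fp) (g : Fq) :
  pairing (Lclass f) (Lclass g) = cintegral mu (fun x => f x * g x).
Proof.
apply: ae_eq_cintegral; [exact: cmeasurable_prod|exact: cmeasurable_prod|].
by apply: filterS2 (LreprK f) (LreprK g) => x -> ->.
Qed.

Lemma normc_pairing (u : Ep) (v : Eq) :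
  Normc.normc (pairing u v) <= 2 * (nr u * nr v).
Proof.
have [ifg le_fg] := hoelder_cmod (Lrepr u) (Lrepr v).
apply: le_trans (normc_cintegral_le (cmeasurable_prod (Lrepr u) (Lrepr v)) ifg
  (normc_prod (Lrepr u) (Lrepr v))) _.
by rewrite ler_wpM2l//; rewrite !LclassK in le_fg.
Qed.

Lemma pairingDl (u u' : Ep) (v : Eq) :
  pairing (u + u') v = pairing u v + pairing u' v.
Proof.
rewrite -[u]LclassK -[u']LclassK -[v]LclassK -LclassD !pairing_class.
rewrite -cintegralD; [|exact: cintegrable_prod|exact: cintegrable_prod].
by congr cintegral; apply/funext => x; rewrite -mulrDl.
Qed.

Lemma pairingZl (c : R[i]) (u : Ep) (v : Eq) :
  pairing (c *: u) v = c * pairing u v.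
Proof.
rewrite -[u]LclassK -[v]LclassK -[c *: Lclass _]LclassZ !pairing_class.
rewrite -cintegralZ; last exact: cintegrable_prod.
by congr cintegral; apply/funext => x; rewrite mulrA.
Qed.

Lemma pairingDr (u : Ep) (v v' : Eq) :
  pairing u (v + v') = pairing u v + pairing u v'.
Proof.
rewrite -[u]LclassK -[v]LclassK -[v']LclassK -LclassD !pairing_class.
rewrite -cintegralD; [|exact: cintegrable_prod|exact: cintegrable_prod].
by congr cintegral; apply/funext => x; rewrite -mulrDr.
Qed.

Lemma pairingZr (c : R[i]) (u : Ep) (v : Eq) :
  pairing u (c *: v) = c * pairing u v.
Proof.
rewrite -[u]LclassK -[v]LclassK -[c *: Lclass _]LclassZ !pairing_class.
rewrite -cintegralZ; last exact: cintegrable_prod.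
by congr cintegral; apply/funext => x; rewrite mulrCA.
Qed.

Lemma pairing_Mr (h : T -> R) (u : Ep) (v : Eq) : bmfun h ->
  pairing (Mr h u) v = pairing u (Mr h v).
Proof.
move=> bh; rewrite -[u]LclassK -[v]LclassK.
have [f -> fE] := Mr_class (Lrepr u) bh.
have [g -> gE] := Mr_class (Lrepr v) bh.
rewrite !pairing_class; congr cintegral; apply/funext => x.
by rewrite fE gE mulrCA mulrA.
Qed.

End Pairing.

(** * The duality map *)

Section DualityMap.
Context d (T : measurableType d) (R : realType).
Variable mu : {measure set T -> \bar R}.
Variables (p q : R) (p1 : 1 < p) (q1 : 1 < q) (pq : p^-1 + q^-1 = 1).
Local Notation Ep := (cLspace mu (Lp_ge1 p1)).
Local Notation Eq := (cLspace mu (Lp_ge1 q1)).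
Local Notation Fp := (cLfunType mu (Lp_ge1 p1)).
Local Notation Fq := (cLfunType mu (Lp_ge1 q1)).
Implicit Types (f g : Fp) (u v : Ep).

Let p0 : 0 < p. Proof. exact: lt_trans p1. Qed.
Let q0 : 0 < q. Proof. exact: lt_trans q1. Qed.

Lemma conjugate_mul : (p - 1) * q = p.
Proof.
have qE : q^-1 = 1 - p^-1 by rewrite -pq addrC addKr.
have : (p - 1) * q * q^-1 = p * q^-1.
  by rewrite mulfK ?gt_eqF// qE mulrBr mulr1 mulfV ?gt_eqF.
by move/mulIf; apply; rewrite invr_neq0// gt_eqF.
Qed.

Lemma cmeasurable_cdual (f : T -> R[i]) : cmeasurable f ->
  cmeasurable (fun x => cdual p (f x)).
Proof.
move=> mf; apply: cmeasurableM.
  split => /=; last exact: measurable_cst.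
  by apply: (measurableT_comp (measurable_powR _)); exact: measurable_cmod.
have [mr mi] := mf; split.
  by apply: eq_measurable_fun mr => x _; case: (f x).
by apply: eq_measurable_fun (measurable_funN mi) => x _ /=; case: (f x).
Qed.

(** [|cdual z|^q = |z|^((p-1)q) = |z|^p], so the duality map sends [L^p] to
    [L^q]. *)
Lemma cdual_exists f : exists2 g : Fq,
  (forall x, g x = cdual p (f x)) & nr (Lclass g) `^ q = nr (Lclass f) `^ p.
Proof.
have LE : Lpow mu q (fun x => cdual p (f x)) = Lpow mu p f.
  apply: eq_integral => x _; congr _%:E.
  by rewrite /cmod normc_cdual// -powRrM conjugate_mul.
have [||g gE] := @cLfun_exists _ _ _ mu q q1 (fun x => cdual p (f x)).
- exact/cmeasurable_cdual/cLfun_measurable.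
- by rewrite LE; exact: Lpow_lty.
exists g; first by move=> x; rewrite gE.
by apply: EFin_inj; rewrite !nr_Lpow -LE gE.
Qed.

Lemma integrable_pow f :
  mu.-integrable setT (EFin \o (fun x => cmod f x `^ p)) /\
  \int[mu]_x (cmod f x `^ p) = nr (Lclass f) `^ p.
Proof.
have E : (\int[mu]_x (cmod f x `^ p)%:E = (nr (Lclass f) `^ p)%:E)%E.
  by rewrite nr_Lpow.
split; last by rewrite /Rintegral E.
apply/integrableP; split; first exact/measurable_Lpow/cLfun_measurable.
under eq_integral do rewrite gee0_abs ?lee_fin ?powR_ge0//.
by rewrite E ltry.
Qed.

Lemma nr_pow_tangent f g (h : Fq) : (forall x, h x = cdual p (f x)) ->
  nr (Lclass f) `^ p +
    p * complex.Re (pairing (Lclass g - Lclass f) (Lclass h)) <=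
  nr (Lclass g) `^ p.
Proof.
move=> hE; have [if_ <-] := integrable_pow f; have [ig <-] := integrable_pow g.
rewrite -LclassB pairing_class//.
have [ir _] := cintegrable_prod pq (g - f) h.
have irp : mu.-integrable setT (EFin \o (fun x => p * complex.Re ((g - f) x * h x))).
  by move: ir => /(integrableZl measurableT p).
rewrite /= -(RintegralZl p measurableT ir) -RintegralD//.
apply: le_Rintegral => //.
  by have := integrableD measurableT if_ irp.
move=> x _; rewrite hE; exact: powR_normc_tangent.
Qed.

(** Uniform convexity of [L^p] for all [p] at once, by integrating the pointwise
    inequality; it is used only to show that minimising sequences are Cauchy. *)
Lemma nr_uniform_convexity (e : R) : 0 < e -> exists2 C : R, 0 <= C &
  forall u v, nr (u - v) `^ p <= e * (nr u `^ p + nr v `^ p) +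
    C * (nr u `^ p + nr v `^ p - 2 * nr ((2^-1)%:C *: (u + v)) `^ p).
Proof.
move=> e0; have [C C0 CP] := powR_normc_uniform_convexity p1 e0.
exists C => // u v; rewrite -[u]LclassK -[v]LclassK.
move: (Lrepr u) (Lrepr v) => f g.
rewrite -LclassB -LclassD -[_ *: Lclass _]LclassZ.
have [if_ <-] := integrable_pow f; have [ig <-] := integrable_pow g.
have [ifg <-] := integrable_pow (f - g).
have [im <-] := integrable_pow ((2^-1)%:C *: (f + g)).
have iZ (a : R) (k : T -> R) : mu.-integrable setT (EFin \o k) ->
    mu.-integrable setT (EFin \o (fun x => a * k x)).
  by move=> /(integrableZl measurableT a).
have iD (k l : T -> R) : mu.-integrable setT (EFin \o k) ->
    mu.-integrable setT (EFin \o l) ->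
    mu.-integrable setT (EFin \o (fun x => k x + l x)).
  by move=> h1 h2; have := integrableD measurableT h1 h2.
have iB (k l : T -> R) : mu.-integrable setT (EFin \o k) ->
    mu.-integrable setT (EFin \o l) ->
    mu.-integrable setT (EFin \o (fun x => k x - l x)).
  by move=> h1 h2; have := integrableB measurableT h1 h2.
have i1 := iD _ _ if_ ig; have i2 := iB _ _ i1 (iZ 2 _ im).
rewrite -(RintegralD measurableT if_ ig) -(RintegralZl 2 measurableT im).
rewrite -(RintegralB measurableT i1 (iZ 2 _ im)).
rewrite -(RintegralZl e measurableT i1) -(RintegralZl C measurableT i2).
rewrite -(RintegralD measurableT (iZ e _ i1) (iZ C _ i2)).
apply: le_Rintegral => //.
  exact: (iD _ _ (iZ e _ i1) (iZ C _ i2)).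
by move=> x _; exact: CP.
Qed.

(** At 0, continuity follows from [|cdual z| = |z|^(p-1)] and [p > 1]; the factor
    [|z|^(p-2)] alone may blow up there. *)
Lemma cvg_cdual (z : nat -> R[i]) (w : R[i]) :
  complex.Re (z n) @[n --> \oo] --> complex.Re w ->
  complex.Im (z n) @[n --> \oo] --> complex.Im w ->
  complex.Re (cdual p (z n)) @[n --> \oo] --> complex.Re (cdual p w) /\
  complex.Im (cdual p (z n)) @[n --> \oo] --> complex.Im (cdual p w).
Proof.
move=> zr zi; have zn := cvg_normc zr zi.
have [w0|w0] := eqVneq (Normc.normc w) 0.
  have cd0 : cdual p w = 0.
    by rewrite /cdual (Normc.eq0_normc w0) /= oppr0 mulr0.
  have n0 : Normc.normc (cdual p (z n)) @[n --> \oo] --> (0 : R).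
    under eq_fun do rewrite normc_cdual//.
    have p10 : 0 < p - 1 by rewrite subr_gt0.
    rewrite -(@powR0 R (p - 1)) ?gt_eqF// -w0.
    by apply: cvgn_powR => // n; exact: normc_ge0.
  rewrite cd0 /=; split; apply/norm_cvg0P; apply: squeeze_cvgr n0;
    try exact: cvg_cst; apply: nearW => n; rewrite normr_ge0 /=.
    exact: normc_Re.
  exact: normc_Im.
have {}w0 : 0 < Normc.normc w by rewrite lt_neqAle eq_sym w0 normc_ge0.
have zp := @cvgn_powR_pos R (p - 2) _ _ w0 zn.
have ReE a : complex.Re (cdual p a) = Normc.normc a `^ (p - 2) * complex.Re a.
  by rewrite /cdual ReM /= mul0r subr0; case: a.
have ImE a : complex.Im (cdual p a) = - (Normc.normc a `^ (p - 2) * complex.Im a).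
  by rewrite /cdual ImM /= mul0r addr0; case: a => ? ? /=; rewrite mulrN.
split.
  by rewrite ReE; under eq_fun do rewrite ReE; exact: cvgM.
by rewrite ImE; under eq_fun do rewrite ImE; apply: cvgN; exact: cvgM.
Qed.

End DualityMap.

(** * Norming elements *)

Section DualNorm.
Context d (T : measurableType d) (R : realType).
Variable mu : {measure set T -> \bar R}.
Variables (p q : R) (p1 : 1 < p) (q1 : 1 < q) (pq : p^-1 + q^-1 = 1).
Local Notation Ep := (cLspace mu (Lp_ge1 p1)).
Local Notation Eq := (cLspace mu (Lp_ge1 q1)).
Local Notation Fp := (cLfunType mu (Lp_ge1 p1)).
Local Notation Fq := (cLfunType mu (Lp_ge1 q1)).
Implicit Types (u : Ep) (v w : Eq).

Let p0 : 0 < p. Proof. exact: lt_trans p1. Qed.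
Let q0 : 0 < q. Proof. exact: lt_trans q1. Qed.
Let qp : q^-1 + p^-1 = 1. Proof. by rewrite addrC. Qed.

(** The duality map of [L^q], applied to [v]. *)
Lemma norming_element v :
  exists2 u : Ep, pairing u v = (nr v `^ q)%:C & nr u `^ p = nr v `^ q.
Proof.
have [f fE fv] := @cdual_exists _ _ _ mu q p q1 p1 qp (Lrepr v).
exists (Lclass f); last by rewrite fv LclassK.
have [_ iv] := @integrable_pow _ _ _ mu q q1 (Lrepr v).
rewrite LclassK in iv.
rewrite -{1}[v]LclassK pairing_class -iv.
transitivity (cintegral mu (fun x => (cmod (Lrepr v) x `^ q)%:C)).
  by congr cintegral; apply/funext => x; rewrite fE mulrC mulr_cdual.
rewrite /cintegral; congr (_ +i* _).
by rewrite /Rintegral integral0.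
Qed.

(** The norm is computed by duality; this gives uniqueness and boundedness of
    adjoints. *)
Lemma nr_le_pairing w (c : R) : 0 <= c ->
  (forall u : Ep, Normc.normc (pairing u w) <= c * nr u) -> nr w <= c.
Proof.
move=> c0 wc; have [u uw un] := norming_element w.
have [->|w0] := eqVneq (nr w) 0; first by [].
have {}w0 : 0 < nr w by rewrite lt_neqAle eq_sym w0 nr_ge0.
have h := wc u; rewrite uw normc_real ger0_norm ?powR_ge0// in h.
have uE : nr u = nr w `^ (q - 1).
  have e : nr u `^ p = (nr w `^ (q - 1)) `^ p.
    by rewrite un -powRrM (conjugate_mul q1 p1 qp).
  apply/eqP; rewrite eq_le; apply/andP; split;
    by apply: (powR_le_ler p0); rewrite ?nr_ge0 ?powR_ge0// e.
move: h; rewrite uE -(mulr_powRB1 (nr_ge0 w) q0) ler_pM2r//.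
exact: powR_gt0.
Qed.

Lemma pairing_inj v w : (forall u : Ep, pairing u v = pairing u w) -> v = w.
Proof.
move=> vw; apply/eqP; rewrite -subr_eq0; apply/eqP/nr_eq0/eqP.
rewrite eq_le nr_ge0 andbT; apply: nr_le_pairing => // u.
rewrite -scaleN1r pairingDr// pairingZr// vw mulN1r subrr mul0r.
by rewrite Normc.normc0.
Qed.

End DualNorm.

(** * Representation of bounded functionals *)

Section Riesz.
Context d (T : measurableType d) (R : realType).
Variable mu : {measure set T -> \bar R}.
Variables (p q : R) (p1 : 1 < p) (q1 : 1 < q) (pq : p^-1 + q^-1 = 1).
Local Notation Ep := (cLspace mu (Lp_ge1 p1)).
Local Notation Eq := (cLspace mu (Lp_ge1 q1)).
Local Notation Fp := (cLfunType mu (Lp_ge1 p1)).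
Local Notation Fq := (cLfunType mu (Lp_ge1 q1)).
Implicit Types (u v w : Ep).

Let p0 : 0 < p. Proof. exact: lt_trans p1. Qed.
Let q0 : 0 < q. Proof. exact: lt_trans q1. Qed.

Variables (phi : Ep -> R[i]) (c : R).
Hypothesis phiD : forall u v, phi (u + v) = phi u + phi v.
Hypothesis phiZ : forall (a : R[i]) u, phi (a *: u) = a * phi u.
Hypothesis phi_le : forall u, Normc.normc (phi u) <= c * nr u.

(** The strictly convex functional whose critical points represent [phi]: its
    derivative at [u] is the pairing with the duality map of [u], minus [Re phi]. *)
Definition energy u : R := nr u `^ p / p - complex.Re (phi u).

Lemma Re_phi_le u : complex.Re (phi u) <= c * nr u.
Proof.
by apply: le_trans (phi_le u); exact: le_trans (ler_norm _) (normc_Re _).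
Qed.

(** Young's inequality absorbs the linear term. *)
Lemma energy_coercive :
  exists2 K : R, 0 <= K & forall u, nr u `^ p <= 2 * p * (energy u + K).
Proof.
(* Young's inequality for [(s / r) (r |c|)] with [r^p = 2] uses up only half of
   [s^p / p]. *)
pose r : R := 2 `^ p^-1; have r0 : 0 < r by exact: powR_gt0.
have rp : r `^ p = 2 by exact: powR_invK.
have c0 : 0 <= `|c| by [].
exists ((r * `|c|) `^ q / q) => [|u].
  by rewrite divr_ge0 ?powR_ge0// ltW.
have s0 := nr_ge0 u; move: (Re_phi_le u); rewrite /energy.
move: (complex.Re (phi u)) => z zc; set s := nr u in s0 zc *.
have sr0 : 0 <= s / r by rewrite divr_ge0// ltW.
have srp : (s / r) `^ p = s `^ p / 2.
  by rewrite powRM ?invr_ge0 ?(ltW r0)// -powR_inv1 ?(ltW r0)// powRAC rp powR_inv1.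
have rc0 : 0 <= r * `|c| by rewrite mulr_ge0// ltW.
have := @conjugate_powR R (s / r) (r * `|c|) p q sr0 rc0 p0 q0 pq.
rewrite srp.
have -> : s / r * (r * `|c|) = s * `|c| by rewrite mulrA divfK// gt_eqF.
move: (_ `^ q / q) (s `^ p) => K t.
have : c * s <= s * `|c| by rewrite mulrC ler_wpM2l// ler_norm.
move=> h1 h2; have h3 : z <= t / 2 / p + K by lra.
have : 2 * p * z <= 2 * p * (t / 2 / p + K) by rewrite ler_wpM2l// mulr_ge0// ltW.
have -> : 2 * p * (t / 2 / p + K) = t + 2 * p * K by field; rewrite gt_eqF.
have -> : 2 * p * (t / p - z + K) = 2 * t - 2 * p * z + 2 * p * K.
  by field; rewrite gt_eqF.
lra.
Qed.

(** The linear part of the energy does not contribute to the midpoint defect. *)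
Lemma energy_midpoint u v :
  nr u `^ p + nr v `^ p - 2 * nr ((2^-1)%:C *: (u + v)) `^ p =
  p * (energy u + energy v - 2 * energy ((2^-1)%:C *: (u + v))).
Proof.
rewrite /energy phiZ phiD ReM ReD /= mul0r subr0.
by field; rewrite gt_eqF.
Qed.

Lemma energy_cvg (w : nat -> Ep) u : nrcvg w u ->
  energy (w n) @[n --> \oo] --> energy u.
Proof.
move=> wu; apply: cvgB.
  apply: cvgMl; apply: cvgn_powR => //; first by move=> n; exact: nr_ge0.
  exact: nrcvg_nr.
apply/cvgrPdist_lt => e e0.
have c10 : 0 < `|c| + 1 by rewrite ltr_wpDl.
have [n0 n0P] := wu _ (divr_gt0 e0 c10).
exists n0 => // n /= /n0P; rewrite ltr_pdivlMr// mulrC -nrBC; apply: le_lt_trans.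
rewrite -ReB (le_trans (normc_Re _))//.
have -> : phi u - phi (w n) = phi (u - w n).
  by rewrite -[- w n]scaleN1r phiD phiZ mulN1r.
rewrite (le_trans (phi_le _))// ler_wpM2r ?nr_ge0//.
by rewrite (le_trans (ler_norm c))// lerDl.
Qed.

(** The midpoint of two almost minimising vectors has energy at least the infimum,
    so their midpoint defect is small, and by uniform convexity they are close. *)
Lemma energy_minimizer : exists u, forall v, energy u <= energy v.
Proof.
have [K K0 coer] := energy_coercive.
have lbE u : - K <= energy u.
  have := le_trans (powR_ge0 _ _) (coer u); rewrite pmulr_rge0 ?mulr_gt0//.
  by rewrite -lerBlDr sub0r.
pose S := range energy.
have hS : has_inf S.
  by split; [exists (energy 0), 0|exists (- K) => _ [u _ <-]].
set m := inf S.
have mE u : m <= energy u by apply: (ge_inf hS.2); exists u.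
have /choice[w wP] (n : nat) : exists u, energy u < m + n.+1%:R^-1.
  have [//|_ [u _ <-] um] := @inf_adherent R S (n.+1%:R^-1) _ hS.
  by exists u.
pose M := 2 * p * (m + 1 + K).
have wM n : nr (w n) `^ p <= M.
  apply: le_trans (coer _) _; rewrite ler_pM2l ?mulr_gt0// lerD2r.
  by rewrite (le_trans (ltW (wP n)))// lerD2l invf_le1// ler1n.
have M0 : 0 <= M by exact: le_trans (powR_ge0 _ _) (wM 0%N).
have wc : nrcauchy w.
  move=> e e0; have ep0 : 0 < e `^ p by exact: powR_gt0.
  have d0 : 0 < e `^ p / (4 * (M + 1)).
    by rewrite divr_gt0// mulr_gt0// ltr_wpDl.
  have [C C0 CP] := nr_uniform_convexity mu p1 d0.
  pose A := C * (p * 2); have A0 : 0 <= A by rewrite !mulr_ge0// ltW.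
  have [N NP] : exists N : nat, A * N.+1%:R^-1 < e `^ p / 2.
    exists (Num.truncn (A / (e `^ p / 2))).
    rewrite ltr_pdivrMr// mulrC -ltr_pdivrMr ?divr_gt0//.
    exact: truncnS_gt.
  exists N => n k Nn Nk; rewrite ltNge; apply/negP => /(ler_powRr (ltW p0) (ltW e0)).
  apply/negP; rewrite -ltNge; apply: le_lt_trans (CP _ _) _.
  rewrite energy_midpoint.
  have h1 : e `^ p / (4 * (M + 1)) * (nr (w n) `^ p + nr (w k) `^ p) < e `^ p / 2.
    apply: (@le_lt_trans _ _ (e `^ p / (4 * (M + 1)) * (2 * M))).
      rewrite ler_wpM2l ?(ltW d0)//; have := wM n; have := wM k; lra.
    have -> : e `^ p / 2 = e `^ p / (4 * (M + 1)) * (2 * (M + 1)).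
      by field; rewrite gt_eqF// ltr_wpDl.
    rewrite ltr_pM2l//; lra.
  have small_inv (l : nat) : (N <= l)%N -> l.+1%:R^-1 <= N.+1%:R^-1 :> R.
    by move=> Nl; rewrite lef_pV2 ?posrE// ler_nat.
  have h2 : energy (w n) + energy (w k) -
      2 * energy ((2^-1)%:C *: (w n + w k)) <= 2 * N.+1%:R^-1.
    have := mE ((2^-1)%:C *: (w n + w k)).
    have := wP n; have := wP k; have := small_inv n Nn; have := small_inv k Nk.
    move: (n.+1%:R^-1) (k.+1%:R^-1) (N.+1%:R^-1) (energy (w n)) (energy (w k))
      (energy ((2^-1)%:C *: (w n + w k))) => a1 a2 a3 a4 a5 a6.
    lra.
  have h3 : C * (p * (energy (w n) + energy (w k) -
      2 * energy ((2^-1)%:C *: (w n + w k)))) <= A * N.+1%:R^-1.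
    by rewrite /A -!mulrA ler_wpM2l// ler_wpM2l// ltW.
  by rewrite [ltRHS]splitr; apply: ltrD h1 (le_lt_trans h3 NP).
have [u wu] := @Lp_complete _ _ _ mu p p1 w wc.
exists u => v; apply: le_trans (mE v).
have hm : m + n.+1%:R^-1 @[n --> \oo] --> m + 0.
  by apply: cvgD; [exact: cvg_cst|exact: cvg_harmonic].
rewrite -[leRHS]addr0.
apply: (ler_cvg_to (energy_cvg wu) hm); apply: nearW => n; exact/ltW.
Qed.

(** Dominated convergence: both factors are bounded by the corresponding powers of
    [|f| + |h|], whose [p]-th power is integrable. *)
Lemma Re_pairing_cvg (f h : Fp) (g : nat -> Fq) (g0 : Fq) :
  (forall n x, g n x = cdual p (f x + (n.+1%:R^-1)%:C * h x)) ->
  (forall x, g0 x = cdual p (f x)) ->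
  complex.Re (pairing (Lclass h) (Lclass (g n))) @[n --> \oo] -->
  complex.Re (pairing (Lclass h) (Lclass g0)).
Proof.
move=> gE g0E; rewrite pairing_class//.
under eq_fun do rewrite pairing_class//.
rewrite /cintegral /=; apply: fine_cvg; rewrite fineK; last first.
  by have [/(integrable_fin_num measurableT)] := cintegrable_prod pq h g0.
have m_ n : measurable_fun setT (EFin \o (fun x => complex.Re (h x * g n x))).
  by have [] := cmeasurable_prod h (g n); move=> /measurable_EFinP.
have m0 : measurable_fun setT (EFin \o (fun x => complex.Re (h x * g0 x))).
  by have [] := cmeasurable_prod h g0; move=> /measurable_EFinP.
have [if_ _] := integrable_pow f; have [ih _] := integrable_pow h.
have idom : mu.-integrable setT (EFin \o (fun x =>
    2 `^ p * (cmod f x `^ p + cmod h x `^ p))).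
  have i1 := integrableD measurableT if_ ih.
  by move: i1 => /(integrableZl measurableT (2 `^ p)).
have fcv : {ae mu, forall x, setT x ->
    (complex.Re (h x * g n x))%:E @[n --> \oo] --> (complex.Re (h x * g0 x))%:E}.
  apply/nearW => x _; apply/cvg_EFin; first exact: nearW.
  have shrink (a b : R) : a + n.+1%:R^-1 * b @[n --> \oo] --> a.
    have : a + n.+1%:R^-1 * b @[n --> \oo] --> a + 0 * b.
      by apply: cvgD; [exact: cvg_cst|apply: cvgMl; exact: cvg_harmonic].
    by rewrite mul0r addr0.
  have [cr ci] : complex.Re (g n x) @[n --> \oo] --> complex.Re (g0 x) /\
      complex.Im (g n x) @[n --> \oo] --> complex.Im (g0 x).
    rewrite g0E; under eq_fun do rewrite gE.
    under [X in _ /\ (X @ _ --> _)]eq_fun do rewrite gE.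
    apply: (cvg_cdual p1).
      by under eq_fun do rewrite ReD ReM /= mul0r subr0; exact: shrink.
    by under eq_fun do rewrite ImD ImM /= mul0r addr0; exact: shrink.
  under eq_fun do rewrite ReM.
  by rewrite ReM; apply: cvgB; exact: cvgMr.
have fdom : {ae mu, forall x n, setT x -> (`|(complex.Re (h x * g n x))%:E| <=
    (2 `^ p * (cmod f x `^ p + cmod h x `^ p))%:E)%E}.
  apply/nearW => x n _; rewrite lee_fin.
  apply: (@le_trans _ _ ((cmod f x + cmod h x) `^ p)); last first.
    by apply: ler_powRD; rewrite ?cmod_ge0// ltW.
  apply: le_trans (normc_Re _) _; rewrite Normc.normcM gE normc_cdual//.
  set s := cmod f x + cmod h x.
  have s0 : 0 <= s by rewrite addr_ge0 ?cmod_ge0.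
  rewrite -(mulr_powRB1 s0 p0); apply: ler_pM; rewrite ?normc_ge0 ?powR_ge0//.
    by rewrite lerDr cmod_ge0.
  rewrite ler_powRr ?normc_ge0 ?subr_ge0 ?(ltW p1)//.
  rewrite (le_trans (le_normcD _ _))// lerD2l Normc.normcM normc_real.
  rewrite ger0_norm ?invr_ge0// ler_piMl ?normc_ge0//.
  by rewrite invf_le1// ler1n.
by have [_ _] := dominated_convergence measurableT m_ m0 fcv idom fdom.
Qed.

(** First-order condition at the minimiser, tested in one direction: the convexity
    of [nr _ `^ p] turns difference quotients of the energy into values of the
    duality map, which is continuous. *)
Lemma Re_phi_le_pairing (f h : Fp) (g0 : Fq) :
  (forall v, energy (Lclass f) <= energy v) ->
  (forall x, g0 x = cdual p (f x)) ->
  complex.Re (phi (Lclass h)) <= complex.Re (pairing (Lclass h) (Lclass g0)).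
Proof.
move=> fmin g0E; pose s n : R := n.+1%:R^-1.
have /choice[g gP] (n : nat) : exists g : Fq,
    forall x, g x = cdual p ((f + (s n)%:C *: h : Fp) x).
  by have [g gE _] := cdual_exists q1 pq (f + (s n)%:C *: h : Fp); exists g.
have cv := @Re_pairing_cvg f h g g0 gP g0E.
apply: (cvgr_to_ge cv); apply: nearW => n.
have s0 : 0 < s n by rewrite /s.
have := nr_pow_tangent pq f (gP n).
rewrite LclassD LclassZ.
set u := Lclass f; set v := Lclass h; set w := Lclass (g n).
rewrite -[Lscale _ _]/((s n)%:C *: v).
have -> : u - (u + (s n)%:C *: v) = (- (s n)%:C) *: v.
  by rewrite opprD addrA subrr sub0r scaleNr.
rewrite pairingZl// => tang.
have := fmin (u + (s n)%:C *: v).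
rewrite /energy phiD phiZ ReD ReM /= mul0r subr0.
move: tang; rewrite mulNr ReN ReM /= mul0r subr0.
move: (complex.Re (pairing v w)) (complex.Re (phi v)) (complex.Re (phi u)) => a b k.
move: (nr u `^ p) (nr (u + (s n)%:C *: v) `^ p) => x y.
move=> h1 h2; rewrite -(ler_pM2l s0) -(ler_pM2l p0).
have : p * (x / p - k) <= p * (y / p - (k + s n * b)) by rewrite ler_pM2l.
have -> : p * (x / p - k) = x - p * k by field; rewrite gt_eqF.
have -> : p * (y / p - (k + s n * b)) = y - p * k - p * (s n * b).
  by field; rewrite gt_eqF.
lra.
Qed.

(** The duality map of a minimiser of the energy represents [phi]: the first-order
    condition holds in the directions [u] and [-u], which gives equality of real
    parts, and multiplying the direction by [-i] turns imaginary parts into real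
    ones. *)
Theorem Riesz_representation : exists v : Eq, forall u, phi u = pairing u v.
Proof.
have [u0 u0min] := energy_minimizer.
have fmin v : energy (Lclass (Lrepr u0)) <= energy v by rewrite LclassK.
have [g gE _] := cdual_exists q1 pq (Lrepr u0).
have Re_le u : complex.Re (phi u) <= complex.Re (pairing u (Lclass g)).
  by rewrite -[u]LclassK; exact: Re_phi_le_pairing fmin gE.
have ReE u : complex.Re (phi u) = complex.Re (pairing u (Lclass g)).
  apply/eqP; rewrite eq_le Re_le /=; have := Re_le (- u).
  by rewrite -scaleN1r phiZ pairingZl// !mulN1r !ReN lerN2.
exists (Lclass g) => u; have := ReE ((0 +i* (-1)) *: u); have := ReE u.
rewrite phiZ pairingZl//; move: (phi u) (pairing u _) => [a b] [a' b'].
by rewrite !ReM /= !mul0r !sub0r !mulN1r !opprK => -> ->.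
Qed.

End Riesz.

(** * Adjoint operators *)

Section Adjoint.
Context d (T : measurableType d) (R : realType).
Variable mu : {measure set T -> \bar R}.
Variables (p q : R) (p1 : 1 < p) (q1 : 1 < q) (pq : p^-1 + q^-1 = 1).
Local Notation Ep := (cLspace mu (Lp_ge1 p1)).
Local Notation Eq := (cLspace mu (Lp_ge1 q1)).
Implicit Types (A : bop Ep) (B : bop Eq).

Theorem adjoint_exists A : exists2 B : bop Eq, is_adjoint A B & nr B <= 2 * nr A.
Proof.
have A0 : 0 <= 2 * nr A by rewrite mulr_ge0 ?nr_ge0.
have bd (u : Ep) (v : Eq) :
    Normc.normc (pairing (A u) v) <= 2 * nr A * nr v * nr u.
  apply: le_trans (normc_pairing pq _ _) _.
  rewrite -!mulrA ler_wpM2l// [nr v * _]mulrC mulrA ler_wpM2r ?nr_ge0//.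
  exact: ler_nr_bop.
have /choice[f fP] (v : Eq) : exists w : Eq,
    forall u : Ep, pairing (A u) v = pairing u w.
  apply: (@Riesz_representation _ _ _ mu p q p1 q1 pq (fun u => pairing (A u) v) (2 * nr A * nr v)).
  - by move=> u u'; rewrite linearD pairingDl.
  - by move=> a u; rewrite linearZ pairingZl.
  - by move=> u; exact: bd.
have [||B BE] := @bop_of_bound R Eq f (2 * nr A).
- move=> a v w; apply: (pairing_inj (p1 := p1) pq).
  move=> u; by rewrite -fP !pairingDr// !pairingZr// !fP.
- move=> v; apply: (nr_le_pairing (p1 := p1) pq); first by rewrite mulr_ge0 ?nr_ge0.
  by move=> u; rewrite -fP.
exists B; first by move=> u v; rewrite BE.
by apply: nr_bop_le => // v; rewrite BE; apply: (nr_le_pairing (p1 := p1) pq) => [|u];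
  rewrite ?mulr_ge0 ?nr_ge0// -fP.
Qed.

Lemma is_adjoint_unique A B B' : is_adjoint A B -> is_adjoint A B' -> B = B'.
Proof.
move=> AB AB'; apply: bop_eqP => v; apply: (pairing_inj (p1 := p1) pq) => u.
by rewrite -AB -AB'.
Qed.

Lemma is_adjointB A A' B B' : is_adjoint A B -> is_adjoint A' B' ->
  is_adjoint (A - A') (B - B').
Proof.
move=> AB AB' u v; rewrite !bopDE !bopNE -![- (_ : cLspace _ _)]scaleN1r.
by rewrite pairingDl// pairingDr// pairingZl// pairingZr// AB AB'.
Qed.

End Adjoint.

(** * Adjoints of band-dominated operators *)

Section AdjointBandDominated.
Context {R : realType} (X : pmetricType R).
Variables (mu : {measure set (borel X) -> \bar R}).
Variables (p q : R) (p1 : 1 < p) (q1 : 1 < q) (pq : p^-1 + q^-1 = 1).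
Local Notation Ep := (cLspace mu (Lp_ge1 p1)).
Local Notation Eq := (cLspace mu (Lp_ge1 q1)).
Implicit Types (A : bop Ep) (B : bop Eq).

(** Multipliers are self-adjoint for the bilinear pairing, so taking adjoints only
    exchanges [K] and [K']. *)
Lemma adjoint_band r A B : is_adjoint A B -> band r A -> band r B.
Proof.
move=> AB rA K K' mK mK' KK'; apply: bop_eqP => v.
apply: (pairing_inj (p1 := p1) pq) => u; rewrite !bopME.
rewrite -pairing_Mr; last exact: bmfun_indic.
rewrite -AB -pairing_Mr; last exact: bmfun_indic.
have -> : Mr \1_K (A (Mr \1_K' u)) = 0.
  rewrite -[LHS]/((Mi mu p1 K * A * Mi mu p1 K') u) rA//.
  by move=> x y K'x Ky; rewrite metric_sym; exact: KK'.
rewrite bop0E -(scale0r (0 : Ep)) pairingZl//.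
by rewrite -(scale0r (0 : Eq)) pairingZr// !mul0r.
Qed.

(** Adjoints of approximating band operators approximate [B], as passing to adjoints
    is bounded; any constant in place of 2 would serve. *)
Theorem adjoint_BDO A B : is_adjoint A B ->
  BDO mu (Lp_ge1 p1) A -> BDO mu (Lp_ge1 q1) B.
Proof.
move=> AB /closure_nrP clA; apply/closure_nrP => e e0.
have [A' /BOP[r rA'] AA'] := clA (e / 2) (divr_gt0 e0 (ltr0Sn _ 1)).
have [B' AB' _] := adjoint_exists q1 pq A'.
exists B'; first by apply/BOP; exists r; exact: adjoint_band AB' rA'.
have [D AD leD] := adjoint_exists q1 pq (A - A').
rewrite (is_adjoint_unique pq (is_adjointB pq AB AB') AD).
apply: le_lt_trans leD _; lra.
Qed.

End AdjointBandDominated.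

Theorem theorem3p7 (R : realType) (X : pmetricType R)
    (Xproper : proper_space X) (Xbounded : bounded_geometry X)
    (XA : propertyA' X)
    (mu : {measure set (borel X) -> \bar R}) (p : R) (p1 : 1 < p) :
  let BOp := BO mu (Lp_ge1 p1) in
  let BDOp := BDO mu (Lp_ge1 p1) in
  let Kp := [set K : bop (cLspace mu (Lp_ge1 p1)) | compact_op K] in
  [/\ forall f : cLinfty mu, BDOp (mulop (Lp_ge1 p1) f),
      [/\ subalgebra BOp, subalgebra BDOp & closed BDOp],
      (forall A B : bop (cLspace mu (Lp_ge1 p1)),
          BDOp A -> fredholm A -> regulariser A B -> BDOp B) /\
      inverse_closed BDOp,
      two_sided_ideal BDOp Kp /\ closed Kp &
      forall (q : R) (q1 : 1 < q), p^-1 + q^-1 = 1 ->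
        forall A : bop (cLspace mu (Lp_ge1 p1)), BDOp A ->
        exists Astar : bop (cLspace mu (Lp_ge1 q1)),
          (forall B, is_adjoint A B <-> B = Astar) /\
          BDO mu (Lp_ge1 q1) Astar].
Proof.
have cE := @Lp_complete _ _ _ mu p p1.
move=> BOp BDOp Kp; split.
- by move=> f; apply: subset_closure; exact: mulop_BO.
- by split; [exact: BO_subalgebra|exact: BDO_subalgebra|exact: closed_closure].
- split=> [A B AB _ rAB|A B AB AB1 BA1]; first exact: regulariser_BDO rAB.
  apply: (regulariser_BDO Xbounded XA AB); rewrite /regulariser AB1 BA1 subrr.
  by split; apply/(compact_opP cE); exact: totally_bounded_op0.
- split; last exact: compact_op_closed.
  split; first by move=> K; exact: compact_BDO.
    exact: compact_op_submod.
  move=> A K _ /(compact_opP cE) tK; split; apply/(compact_opP cE).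
    exact: totally_bounded_opMl.
  exact: totally_bounded_opMr.
- move=> q q1 pq A BA; have [B AB _] := adjoint_exists q1 pq A.
  exists B; split; last exact: adjoint_BDO AB BA.
  by move=> B'; split=> [AB'|->//]; exact: is_adjoint_unique AB' AB.
Qed.
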